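(* For an arbitrary separable rearrangement-invariant space $E$ on $[0,1]$ with the Fatou property, we have $$\Gamma_{\rm iid}(E)=\Gamma_{\rm i}(E)\Longleftrightarrow\Gamma_{\rm iid}(E)\subseteq\Gamma_{\rm d}(E).$$
   Context: Let $m$ be Lebesgue measure on $[0,1]$ and $x^*(t)=\inf\{s\ge0:m(|x|>s)\le t\}$ the non-increasing rearrangement. A Banach space $(E,\|\cdot\|_E)$ of (classes of) real measurable functions on $[0,1]$ is rearrangement-invariant if (i) $y\in E$, $x$ measurable, $|x|\le|y|$ imply $x\in E$ and $\|x\|_E\le\|y\|_E$; (ii) $y\in E$, $x$ measurable, $x^*=y^*$ imply $x\in E$ and $\|x\|_E=\|y\|_E$. $E$ has the Fatou property if whenever $\{f_n\}\subseteq E$ and $f$ measurable satisfy $f_n\to f$ a.e. and $\sup_n\|f_n\|_E<\infty$, then $f\in E$ and $\|f\|_E\le\liminf_n\|f_n\|_E$. For $p\ge1$, a bounded sequence $\{x_n\}\subset E$ is a $p$-BS-sequence if for every subsequence $\{y_k\}\subset\{x_n\}$ one has $\sup_{m\in\mathbb N}m^{-1/p}\|\sum_{k=1}^my_k\|_E<\infty$. $\Gamma_{\rm i}(E)$ (respectively $\Gamma_{\rm iid}(E)$; $\Gamma_{\rm d}(E)$) is the set of all $p\ge1$ such that every weakly null sequence in $E$ of independent random variables (respectively, of independent identically distributed random variables; of pairwise disjointly supported elements) contains a subsequence which is a $p$-BS-sequence. *)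

(* Defs.v *)
From HB Require Import structures.
From mathcomp Require Import all_boot all_order all_algebra finmap.
From mathcomp Require Import all_classical all_reals all_analysis.

Set Implicit Arguments.
Unset Strict Implicit.
Unset Printing Implicit Defensive.

Import Order.TTheory GRing.Theory Num.Theory.
Import numFieldTopology.Exports numFieldNormedType.Exports.

Local Open Scope classical_set_scope.
Local Open Scope ring_scope.

(* Lebesgue measure on [0, 1], carried by the Borel sets of the real line: a
   class of measurable functions on [0, 1] is a class of Borel functions on R
   for equality leb01-almost everywhere. *)
Definition leb01 {R : realType} : set (measurableTypeR R) -> \bar R :=
  mrestr lebesgue_measure (measurable_itv `[0%R, 1%R]).

HB.instance Definition _ (R : realType) := Measure.on (@leb01 R).

Lemma leb01_setT (R : realType) : @leb01 R [set: _] = 1%:E.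
Proof.
by rewrite /leb01 /mrestr setTI lebesgue_measure_itv/= lte_fin ltr01 oppr0 adde0.
Qed.

HB.instance Definition _ (R : realType) :=
  Measure_isProbability.Build _ _ _ (@leb01 R) (@leb01_setT R).

(* A Banach space of classes of measurable functions on [0, 1]: an abstract
   Banach space with a linear injection into the space of classes, given by a
   choice of representatives. *)
Record banach_fun_space (R : realType) := BanachFunSpace {
  bfs_sort :> completeNormedModType R ;
  rep : bfs_sort -> {RV (@leb01 R) >-> measurableTypeR R} ;
  rep_linear : forall (a : R) (x y : bfs_sort),
    \forall t \ae leb01, rep (a *: x + y) t = a * rep x t + rep y t ;
  rep_inj : forall x y : bfs_sort,
    (\forall t \ae leb01, rep x t = rep y t) -> x = y }.

Section RearrangementInvariantSpaces.
Context {R : realType}.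
Implicit Types (f g : {RV (@leb01 R) >-> measurableTypeR R}).

(* The infimum is taken in \bar R because the set can be empty for t = 0. *)
Definition rearrangement f (t : R) : \bar R :=
  ereal_inf [set s%:E | s in
    [set s : R | 0 <= s /\ (leb01 [set u | (s < `|f u|)%R] <= t%:E)%E]].

Definition represents (E : banach_fun_space R) (x : E) g :=
  \forall t \ae leb01, rep x t = g t.

Definition rearrangement_invariant (E : banach_fun_space R) :=
  (forall (y : E) g, (\forall t \ae leb01, `|g t| <= `|rep y t|) ->
     exists x : E, represents x g /\ `|x| <= `|y|) /\
  (forall (y : E) g,
     (forall t : R, 0 <= t <= 1 -> rearrangement g t = rearrangement (rep y) t) ->
     exists x : E, represents x g /\ `|x| = `|y|).

Definition fatou_property (E : banach_fun_space R) :=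
  forall (f : nat -> E) g,
    (\forall t \ae leb01, (fun n => rep (f n) t : R) @ \oo --> (g t : R)) ->
    has_ubound (range (fun n => `|f n|)) ->
    exists x : E, represents x g /\ `|x| <= limn_inf (fun n => `|f n|).

Definition separable (T : topologicalType) :=
  exists D : set T, countable D /\ dense D.

Definition weakly_null (E : normedModType R) (x : nat -> E) :=
  forall phi : {linear E -> R^o}, continuous phi ->
    (fun n => phi (x n)) @ \oo --> (0 : R^o).

Definition p_BS_sequence (E : normedModType R) (p : R) (x : nat -> E) :=
  bounded_fun x /\
  forall s : nat -> nat, increasing_seq s ->
    has_ubound [set m%:R `^ (- p^-1) * `|\sum_(k < m) x (s k)| |
                m in [set m | (0 < m)%N]].

Definition independent (X : nat -> {RV (@leb01 R) >-> measurableTypeR R}) :=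
  forall (J : {fset nat}) (B : nat -> set (measurableTypeR R)),
    (forall n, measurable (B n)) ->
    leb01 (\bigcap_(n in [set` J]) X n @^-1` B n) =
    (\prod_(n <- J) leb01 (X n @^-1` B n))%E.

(* The library's [distribution] is also defined, as an outer measure, on
   non-measurable sets; these must be excluded. *)
Definition identically_distributed
    (X : nat -> {RV (@leb01 R) >-> measurableTypeR R}) :=
  forall i j (B : set (measurableTypeR R)), measurable B ->
    distribution leb01 (X i) B = distribution leb01 (X j) B.

Definition pairwise_disjoint (X : nat -> {RV (@leb01 R) >-> measurableTypeR R}) :=
  forall i j, i != j -> \forall t \ae leb01, X i t = 0 \/ X j t = 0.

Definition Gamma (E : banach_fun_space R)
    (C : (nat -> {RV (@leb01 R) >-> measurableTypeR R}) -> Prop) : set R :=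
  [set p | 1 <= p /\
    forall x : nat -> E, weakly_null x -> C (fun n => rep (x n)) ->
      exists s : nat -> nat, increasing_seq s /\ p_BS_sequence p (x \o s)].

Definition Gamma_i (E : banach_fun_space R) := Gamma E independent.

Definition Gamma_iid (E : banach_fun_space R) :=
  Gamma E (fun X => independent X /\ identically_distributed X).

Definition Gamma_d (E : banach_fun_space R) := Gamma E pairwise_disjoint.

End RearrangementInvariantSpaces.

(* Main.v *)
Require Import Defs.
From HB Require Import structures.
From mathcomp Require Import all_boot all_order all_algebra finmap.
From mathcomp Require Import all_classical all_reals all_analysis.
From mathcomp Require Import measurable_realfun.
From mathcomp Require Import zify ring lra.

Set Implicit Arguments.
Unset Strict Implicit.
Unset Printing Implicit Defensive.

Import Order.TTheory GRing.Theory Num.Theory.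
Import numFieldTopology.Exports numFieldNormedType.Exports.

Local Open Scope classical_set_scope.
Local Open Scope ring_scope.

(** The inclusion of [Gamma_i] in [Gamma_d] always holds, and this gives the
    implication from left to right. Let [x n] be disjoint and weakly null, with
    representatives [f n], and evaluate these at independent uniform variables
    [unif n]. The supports of the copies [f n \o unif n] have summable measures,
    and the norm of [E] is order continuous ([norm_restr_small], from
    separability and the Fatou property). Hence a subsequence of the copies
    becomes disjoint after summable changes ([nearly_disjoint_subsequence]). By
    independence these changes leave at least half of every tail, so the
    disjointified copies and the original disjoint sequence have comparable
    norms of linear combinations ([disjoint_parts_of_independent_copies]). Weak
    nullity is a statement about norms of convex combinations
    ([weakly_null_convex], [convex_weakly_null]), so it passes to the copies; a
    subsequence given by [Gamma_i] for the copies then has the required growth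
    for [x] too.

    For the converse let [p] belong to [Gamma_iid] and to [Gamma_d], and let [F]
    be independent and weakly null, hence bounded ([weakly_null_bounded]).
    Norms of linear combinations do not change if [F n] is replaced by its
    quantile function evaluated at [unif n] ([quantile_copy]). Quantile functions
    are monotone and, by boundedness in norm, pointwise bounded, so along a
    subsequence they converge in measure to a function [Q], which represents an
    element of [E] by the Fatou property ([quantile_limit]). Therefore a
    subsequence splits as [G + z + u]: [G k] is [Q] at an independent uniform
    variable, the [z k] are disjoint with supports of small measure, and the
    norms of the [u k] are summable ([quantile_splitting]).

    It remains to see that [G] and [z] are weakly null. By the law of large
    numbers in the norm of [E] ([average_norm_small]) the averages of any [N]
    of the [G k] are close to one and the same constant. That constant is small:
    convex combinations of block averages of the whole sequence are small, and
    the contribution of [z] vanishes on a set of measure at least one half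
    ([common_part_weakly_null]). So the convex hull of every subsequence of [G]
    comes close to [0], [G] is weakly null, and so is [z]. The two hypotheses on
    [p] now give the growth condition for [G] and for [z] along a common
    subsequence, and the triangle inequality gives it for [F]. *)

(** * Sublinear functionals and separation *)

Section Sublinear.
Context {R : realType} {V : lmodType R}.
Implicit Types (q : V -> R) (S : V -> set R).

Definition sublinear q :=
  (forall x y, q (x + y) <= q x + q y) /\
  (forall t x, 0 < t -> q (t *: x) <= t * q x).

Lemma sublinear0 q : sublinear q -> q 0 = 0.
Proof.
move=> [qD qZ]; apply/eqP; rewrite eq_le.
have := qD 0 0; rewrite addr0; have := qZ 2^-1 0; rewrite scaler0 invr_gt0 => /(_ ltac:(by [])).
by move=> h1 h2; apply/andP; split; lra.
Qed.

Lemma sublinear_opp_ge q x : sublinear q -> - q (- x) <= q x.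
Proof.
by move=> qs; have := qs.1 x (- x); rewrite subrr (sublinear0 qs); lra.
Qed.

Lemma inf_sublinear S :
    (forall v, S v !=set0) -> (forall v, has_lbound (S v)) ->
    (forall x y a b, S x a -> S y b -> exists2 c, S (x + y) c & c <= a + b) ->
    (forall t x a, 0 < t -> S x a -> exists2 c, S (t *: x) c & c <= t * a) ->
  sublinear (fun v => inf (S v)).
Proof.
move=> S0 Slb SD SZ.
have infS v : has_inf (S v) by split.
split=> [x y|t x t0].
- rewrite -lerBlDr; apply: lb_le_inf => // a Sa.
  rewrite lerBlDr -lerBlDl; apply: lb_le_inf => // b Sb.
  have [c Sc cab] := SD _ _ _ _ Sa Sb.
  by rewrite lerBlDl; apply: le_trans cab; apply: ge_inf.
- rewrite -ler_pdivrMl //; apply: lb_le_inf => // a Sa.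
  have [c Sc cta] := SZ _ _ _ t0 Sa.
  by rewrite ler_pdivrMl //; apply: le_trans cta; apply: ge_inf.
Qed.

(** For a fixed [y], the functional [v |-> inf_t (q (v + t y) - t q y)] is
    sublinear, lies below [q], and takes a value at most [- q y] at [- y]; by
    minimality it is [q], so [q] is odd, and an odd sublinear functional is
    linear. *)
Lemma minimal_sublinear_linear q : sublinear q ->
    (forall r, sublinear r -> (forall v, r v <= q v) -> forall v, q v <= r v) ->
  forall a x y, q (a *: x + y) = a * q x + q y.
Proof.
move=> qs qmin.
have qN y : q (- y) = - q y.
  pose S v := [set q (v + t *: y) - t * q y | t in [set t : R | 0 <= t]].
  have Sq v : S v (q v) by exists 0 => //=; rewrite scale0r addr0 mul0r subr0.
  have Slb v : has_lbound (S v).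
    exists (- q (- v)) => _ [t /= t0 <-].
    have [/eqP ->|tn0] := boolP (t == 0).
      by rewrite scale0r addr0 mul0r subr0 sublinear_opp_ge.
    have tp : 0 < t by rewrite lt_neqAle eq_sym tn0.
    have : t * q y <= q (t *: y).
      by rewrite -ler_pdivlMl//; apply: le_trans (qs.2 _ _ _); rewrite ?invr_gt0// scalerA mulVf ?scale1r.
    have := qs.1 (v + t *: y) (- v); rewrite addrAC subrr add0r; lra.
  have Ss : sublinear (fun v => inf (S v)).
    apply: inf_sublinear => //.
    - by move=> v; exists (q v).
    - move=> u v _ _ [s /= s0 <-] [t /= t0 <-].
      exists (q (u + v + (s + t) *: y) - (s + t) * q y); first by exists (s + t) => //=; rewrite addr_ge0.
      by have := qs.1 (u + s *: y) (v + t *: y); rewrite addrACA -scalerDl; lra.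
    - move=> t u _ t0 [s /= s0 <-].
      exists (q (t *: u + (t * s) *: y) - (t * s) * q y); first by exists (t * s) => //=; rewrite mulr_ge0 // ltW.
      by have := qs.2 t (u + s *: y) t0; rewrite scalerDr scalerA; lra.
  have Sle v : inf (S v) <= q v by apply: ge_inf.
  have /(_ (- y)) := qmin _ Ss Sle.
  have : inf (S (- y)) <= - q y.
    apply: ge_inf => //; exists 1 => //=.
    by rewrite scale1r addNr (sublinear0 qs) mul1r sub0r.
  by have := sublinear_opp_ge (- y) qs; rewrite opprK => *; apply/eqP; rewrite eq_le; apply/andP; split; lra.
have qD x y : q (x + y) = q x + q y.
  apply/eqP; rewrite eq_le qs.1 /=.
  by have := qs.1 (- x) (- y); rewrite -opprD !qN; lra.
have qZp t x : 0 < t -> q (t *: x) = t * q x.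
  move=> t0; apply/eqP; rewrite eq_le qs.2 //=.
  by have := qs.2 t (- x) t0; rewrite scalerN !qN; lra.
move=> a x y; rewrite qD; congr (_ + _).
have [a0|a0|->] := ltgtP a 0; last by rewrite scale0r mul0r sublinear0.
- by rewrite -[a]opprK scaleNr qN qZp ?oppr_gt0//; lra.
- exact: qZp.
Qed.

(** By Zorn's lemma there is a minimal sublinear functional below [p]: the infimum
    of a chain is finite because every member [q] satisfies
    [q v >= - q (- v) >= - p (- v)], and it is sublinear because any two members
    are comparable. *)
Lemma sublinear_dominates_linear (p : V -> R) : sublinear p ->
  exists f : V -> R, (forall a x y, f (a *: x + y) = a * f x + f y) /\
                     forall v, f v <= p v.
Proof.
move=> ps.
pose T := {q : V -> R | sublinear q /\ forall v, q v <= p v}.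
pose below (q r : T) : bool := `[< forall v, sval r v <= sval q v >].
have [|||q qmin] := @ZL_preorder T (exist _ p (conj ps (fun=> lexx _))) below.
- by move=> q; apply/asboolP.
- by move=> r s t /asboolP rs /asboolP st; apply/asboolP => v; exact: le_trans (rs v).
- move=> A totA; have [[q0 Aq0]|A0] := pselect (A !=set0); last first.
    by exists (exist _ p (conj ps (fun=> lexx _))) => s As; exfalso; apply: A0; exists s.
  pose S v := [set sval q v | q in A].
  have Slb v : has_lbound (S v).
    exists (- p (- v)) => _ [[q [qs qp]] /= Aq <-].
    by apply: le_trans (sublinear_opp_ge _ qs); rewrite lerN2.
  have Ss : sublinear (fun v => inf (S v)).
    apply: inf_sublinear => //.
    - by move=> v; exists (sval q0 v); exists q0.
    - move=> x y _ _ [q Aq <-] [r Ar <-].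
      have [/asboolP qr|/asboolP rq] := totA q r Aq Ar.
        exists (sval r (x + y)); first by exists r.
        by apply: le_trans ((svalP r).1.1 x y) _; rewrite lerD2r.
      exists (sval q (x + y)); first by exists q.
      by apply: le_trans ((svalP q).1.1 x y) _; rewrite lerD2l.
    - move=> t x _ t0 [q Aq <-]; exists (sval q (t *: x)); first by exists q.
      exact: (svalP q).1.2.
  have Sp v : inf (S v) <= p v.
    by apply: le_trans ((svalP q0).2 v); apply: ge_inf => //; exists q0.
  exists (exist _ (fun v => inf (S v)) (conj Ss Sp) : T) => s As; apply/asboolP => v /=.
  by apply: ge_inf => //; exists s.
- exists (sval q); split; last exact: (svalP q).2.
  apply: minimal_sublinear_linear (svalP q).1 _ => r rs rq v.
  have rp u : r u <= p u by apply: le_trans (rq u) ((svalP q).2 u).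
  have /asboolP := qmin (exist _ r (conj rs rp) : T) (asboolT rq).
  exact.
Qed.

End Sublinear.

(** * Weakly null sequences *)

Lemma increasing_seq_leq (s : nat -> nat) : increasing_seq s ->
  {mono s : n m / (n <= m)%N}.
Proof. by move=> si n m; have := si n m; rewrite leEnat. Qed.

Lemma increasing_seq_inj (s : nat -> nat) : increasing_seq s -> injective s.
Proof.
have le (i j : nat) : increasing_seq s -> s i = s j -> (i <= j)%N.
  by move=> si sij; rewrite -(increasing_seq_leq si) sij.
by move=> si i j sij; apply/eqP; rewrite eqn_leq !le.
Qed.

Lemma increasing_seq_geq (s : nat -> nat) n : increasing_seq s -> (n <= s n)%N.
Proof.
move=> si; elim: n => [//|n IH]; apply: leq_ltn_trans IH _.
by rewrite ltnNge increasing_seq_leq// -ltnNge.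
Qed.

Lemma increasing_seq_comp (s r : nat -> nat) : increasing_seq s -> increasing_seq r ->
  increasing_seq (s \o r).
Proof. by move=> si ri n m /=; rewrite si increasing_seq_leq. Qed.

Section WeaklyNull.
Context {R : realType} {V : normedModType R}.
Implicit Types (x : nat -> V) (a : nat -> R).

(** The infimum of [|v + w| - s] over the pairs [(w, s)] in the convex cone spanned
    by the [(x k, d)] is a sublinear functional, lies below the norm, and is at
    most [- d] at [- x k]. A linear functional below it separates. *)
Lemma separating_functional x (d : R) :
    (forall n a, (forall k, 0 <= a k) ->
       d * \sum_(k < n) a k <= `|\sum_(k < n) a k *: x k|) ->
  exists phi : {linear V -> R^o},
    (forall v, `|phi v| <= `|v|) /\ forall k, d <= phi (x k).
Proof.
move=> xd.
pose C (w : V) (s : R) := exists n a, [/\ forall k, 0 <= a k,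
  forall k, (n <= k)%N -> a k = 0,
  w = \sum_(k < n) a k *: x k & s = d * \sum_(k < n) a k].
have widen n m (W : lmodType R) a (F : nat -> W) : (forall k, (n <= k)%N -> a k = 0) ->
    \sum_(k < n + m) a k *: F k = \sum_(k < n) a k *: F k.
  move=> a0; rewrite big_split_ord/= [X in _ + X]big1 ?addr0// => k _.
  by rewrite a0 ?leq_addr// scale0r.
have widenR n m a : (forall k, (n <= k)%N -> a k = 0) ->
    \sum_(k < n + m) a k = \sum_(k < n) a k.
  move=> a0; rewrite big_split_ord/= [X in _ + X]big1 ?addr0// => k _.
  by rewrite a0 ?leq_addr.
have CD w s w' s' : C w s -> C w' s' -> C (w + w') (s + s').
  move=> [n [a [ap a0 -> ->]]] [m [b [bp b0 -> ->]]].
  exists (n + m)%N, (fun k => a k + b k); split.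
  - by move=> k; rewrite addr_ge0.
  - move=> k nmk; rewrite a0 ?b0 ?addr0//.
      by apply: leq_trans nmk; rewrite leq_addl.
    by apply: leq_trans nmk; rewrite leq_addr.
  - under [RHS]eq_bigr do rewrite scalerDl.
    by rewrite big_split/= widen// addnC widen.
  - by rewrite big_split/= widenR// addnC widenR// mulrDr.
have CZ t w s : 0 < t -> C w s -> C (t *: w) (t * s).
  move=> t0 [n [a [ap a0 -> ->]]]; exists n, (fun k => t * a k); split.
  - by move=> k; rewrite mulr_ge0 // ltW.
  - by move=> k nk; rewrite a0 ?mulr0.
  - by rewrite scaler_sumr; apply: eq_bigr => k _; rewrite scalerA.
  - by rewrite -mulr_sumr mulrCA.
have C0 : C 0 0.
  by exists 0%N, (fun=> 0); split => //; rewrite !big_ord0 ?mulr0.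
have Cx k : C (x k) d.
  exists k.+1, (fun j => (j == k)%:R); split => //.
  - by move=> j kj; rewrite gtn_eqF.
  - rewrite big_ord_recr/= eqxx scale1r big1 ?add0r// => i _.
    by rewrite ltn_eqF ?scale0r.
  - rewrite big_ord_recr/= eqxx big1 ?add0r ?mulr1// => i _.
    by rewrite ltn_eqF.
have Cle w s : C w s -> s <= `|w| by move=> [n [a [ap _ -> ->]]]; exact: xd.
pose S v := [set r : R | exists w s, C w s /\ r = `|v + w| - s].
have Sn v : S v `|v| by exists 0, 0; rewrite addr0 subr0.
have Slb v : has_lbound (S v).
  exists (- `|v|) => _ [w [s [Cws ->]]].
  have := Cle _ _ Cws; have := ler_normB (v + w) v; rewrite [v + w]addrC addrK; lra.
have Ss : sublinear (fun v => inf (S v)).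
  apply: inf_sublinear => //.
  - by move=> v; exists `|v|.
  - move=> u v _ _ [w [s [Cws ->]]] [w' [s' [Cws' ->]]].
    exists (`|u + v + (w + w')| - (s + s')); first by exists (w + w'), (s + s'); split => //; exact: CD.
    by have := ler_normD (u + w) (v + w'); rewrite addrACA; lra.
  - move=> t v _ t0 [w [s [Cws ->]]]; exists (`|t *: v + t *: w| - t * s).
      by exists (t *: w), (t * s); split => //; exact: CZ.
    by rewrite -scalerDr normrZ gtr0_norm// mulrBr.
have [f [flin fS]] := sublinear_dominates_linear Ss.
have fle v : f v <= `|v| by apply: le_trans (fS v) _; exact: ge_inf.
have lf : GRing.linear_for *:%R (f : V -> R^o) by move=> b u v; rewrite flin.
pose mix := GRing.isLinear.Build R V R^o *:%R f lf.
pose phi : {linear V -> R^o} := HB.pack f mix.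
have fN v : f (- v) = - f v by exact: (raddfN phi).
exists phi; split => /= [v|k].
- by rewrite ler_norml fle andbT -[in X in X <= _](normrN v) lerNl -fN fle.
- rewrite -lerN2 -fN; apply: le_trans (fS _) _; apply: ge_inf => //.
  by exists (x k), d; split; [exact: Cx|rewrite addNr normr0 sub0r].
Qed.

Lemma norm_le_continuous (phi : {linear V -> R^o}) (C : R) :
  (forall v, `|phi v| <= C * `|v|) -> continuous phi.
Proof.
move=> phiC; apply: bounded_linear_continuous; apply/linear_boundedP.
exists C; split; first exact: num_real.
move=> r Cr v; apply: le_trans (phiC v) _.
by rewrite ler_wpM2r// ltW.
Qed.

Lemma continuous_norm_le (phi : {linear V -> R^o}) : continuous phi ->
  exists2 C : R, 0 < C & forall v, `|phi v| <= C * `|v|.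
Proof.
move=> /(_ 0) /continuous_linear_bounded /linear_boundedP [M [_ hM]].
exists (`|M| + 1); first by rewrite ltr_wpDl.
by move=> v; apply: hM; rewrite (le_lt_trans (ler_norm M))// ltrDl.
Qed.

(** Mazur's theorem: were the convex hull at distance at least [e] from [0], some
    functional would be at least [e] on the whole sequence. *)
Lemma weakly_null_convex x : weakly_null x -> forall e : R, 0 < e ->
  exists n a, [/\ forall k, 0 <= a k, \sum_(k < n) a k = 1 &
                  `|\sum_(k < n) a k *: x k| < e].
Proof.
move=> x0 e e0; apply: contrapT => hn.
have [n a a0|phi [phile phie]] := @separating_functional x e.
  have [S0|S0] := eqVneq (\sum_(k < n) a k) 0; first by rewrite S0 mulr0.
  have Sp : 0 < \sum_(k < n) a k by rewrite lt_neqAle eq_sym S0 sumr_ge0.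
  rewrite leNgt; apply/negP => hlt; apply: hn.
  set S := \sum_(k < n) a k in S0 Sp hlt.
  exists n, (fun k => S^-1 * a k); split.
  - by move=> k; rewrite mulr_ge0 // invr_ge0 ltW.
  - by rewrite -mulr_sumr mulVf.
  - under eq_bigr do rewrite -scalerA.
    by rewrite -scaler_sumr normrZ gtr0_norm ?invr_gt0// ltr_pdivrMl// mulrC.
have cphi : continuous phi by apply: (@norm_le_continuous phi 1) => v; rewrite mul1r.
have /cvgrPdist_lt/(_ _ e0)[N _ /(_ N (leqnn N))] := x0 _ cphi.
by rewrite sub0r normrN ltNge (le_trans (phie N) (ler_norm _)).
Qed.

(** The next index may be chosen in dependence on the previous one; [P] receives
    the position, the previous index and the new index. *)
Lemma extract_subsequence (P : nat -> nat -> nat -> Prop) :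
    (forall k p, exists n, (p < n)%N /\ P k p n) ->
  exists s : nat -> nat, [/\ increasing_seq s, P 0%N 0%N (s 0%N) &
    forall k, P k.+1 (s k) (s k.+1)].
Proof.
move=> hP.
have [F hF] : {F : nat -> nat -> nat | forall k p, (p < F k p)%N /\ P k p (F k p)}.
  have h k p := cid (hP k p).
  by exists (fun k p => sval (h k p)) => k p; exact: svalP (h k p).
pose s := fix s k := if k is k'.+1 then F k (s k') else F 0%N 0%N.
exists s; split => [||k]; first by apply/increasing_seqP => n; exact: (hF n.+1 (s n)).1.
- exact: (hF 0%N 0%N).2.
- exact: (hF k.+1 (s k)).2.
Qed.

Lemma extract_frequently (P : nat -> Prop) :
    (forall N, exists n, (N <= n)%N /\ P n) ->
  exists s : nat -> nat, increasing_seq s /\ forall k, P (s k).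
Proof.
move=> hP; have [k p|s [si s0 sS]] := @extract_subsequence (fun _ _ n => P n).
  by have [n [pn Pn]] := hP p.+1; exists n.
by exists s; split => // -[|k].
Qed.

(** Conversely, if the convex hull of every subsequence comes arbitrarily close
    to [0], the sequence is weakly null: otherwise some functional would be
    bounded away from [0], with a constant sign, along a subsequence. *)
Lemma convex_weakly_null x :
    (forall s : nat -> nat, increasing_seq s -> forall e : R, 0 < e ->
       exists n a (t : nat -> nat), [/\ forall k, 0 <= a k, \sum_(k < n) a k = 1 &
                       `|\sum_(k < n) a k *: x (s (t k))| < e]) ->
  weakly_null x.
Proof.
move=> xs phi cphi; have [C C0 phiC] := continuous_norm_le cphi.
apply: contrapT => /cvgrPdist_le/existsNP[e /not_implyP[e0 he]].
have key (sg : R) : `|sg| = 1 -> ~ (forall N, exists n, (N <= n)%N /\ e <= sg * phi (x n)).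
  move=> sg1 /extract_frequently[s [si hs]].
  have [n [a [t [a0 a1]]]] := xs s si (e / C) (divr_gt0 e0 C0).
  apply/negP; rewrite -leNgt ler_pdivrMr// mulrC.
  apply: le_trans (phiC _).
  rewrite -[leRHS]mul1r -sg1 -normrM; apply: le_trans (ler_norm _).
  rewrite linear_sum mulr_sumr -[leLHS]mulr1 -a1 mulr_sumr.
  by apply: ler_sum => k _; rewrite linearZ/= mulrC [leRHS]mulrCA ler_wpM2l.
apply: (key 1); first exact: normr1.
move=> N; apply: contrapT => hN; apply: (key (-1)); first by rewrite normrN1.
move=> M; apply: contrapT => hM; apply: he.
exists (maxn N M) => // n /=; rewrite geq_max => /andP[Nn Mn].
rewrite sub0r normrN ler_norml lerNl; apply/andP; split; rewrite leNgt; apply/negP => h.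
  by apply: hM; exists n; rewrite mulN1r ltW.
by apply: hN; exists n; rewrite mul1r ltW.
Qed.

End WeaklyNull.

Section WeaklyNullBounded.
Context {R : realType} {V : normedModType R}.

Lemma norming_functional (v : V) :
  exists phi : {linear V -> R^o}, (forall w, `|phi w| <= `|w|) /\ phi v = `|v|.
Proof.
have [n a a0|phi [phile phiv]] := @separating_functional R V (fun=> v) `|v|.
  by rewrite -scaler_suml normrZ mulrC ger0_norm// sumr_ge0.
exists phi; split => //; apply/eqP; rewrite eq_le; apply/andP; split; last exact: phiv 0%N.
exact: le_trans (ler_norm _) (phile v).
Qed.

(** Otherwise choose indices [n_k] with [|x n_k| >= k 3^k] and functionals of
    norm one attaining these norms. In the partial sums of
    [phi = sum_k sg_k 3^-k phi_k] the sign [sg_k] can be chosen so that adding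
    the [k]-th term does not cancel at [x n_k]; the tail is at most half of that
    term, so [|phi (x n_k)| >= k / 2], although [phi (x n)] converges. *)
Lemma weakly_null_bounded (x : nat -> V) : weakly_null x ->
  exists M : R, forall n, `|x n| <= M.
Proof.
move=> x0; apply: contrapT => unb.
have /choice[m hm] : forall k : nat, exists n, k%:R * 3 ^+ k <= `|x n|.
  move=> k; apply: contrapT => h; apply: unb; exists (k%:R * 3 ^+ k) => n.
  by rewrite leNgt; apply/negP => hn; apply: h; exists n; exact: ltW.
have /choice[psi hpsi] := fun k => norming_functional (x (m k)).
pose q : R := 3^-1.
pose sg (r : R) : R := if 0 <= r then 1 else -1.
have sg1 r : `|sg r| = 1 by rewrite /sg; case: ifP; rewrite ?normrN1 ?normr1.
pose S := fix S k (v : V) : R :=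
  if k is j.+1 then S j v + sg (S j (x (m j))) * q ^+ j * psi j v else 0.
have Slin k a u v : S k (a *: u + v) = a * S k u + S k v.
  elim: k => [|k IH] /=; first by rewrite mulr0 addr0.
  by rewrite IH linearP/= -!/(_ *: _); rewrite /GRing.scale/=; ring.
have Sbig k : q ^+ k * `|x (m k)| <= `|S k.+1 (x (m k))|.
  rewrite /= (hpsi k).2 /sg; have qx : 0 <= q ^+ k * `|x (m k)|.
    by rewrite mulr_ge0 ?exprn_ge0// invr_ge0.
  case: ifPn => [s0|]; last rewrite -ltNge => s0.
    by rewrite mul1r ger0_norm ?addr_ge0//; lra.
  by rewrite mulN1r mulNr ltr0_norm; lra.
have Sstep k v : `|S k.+1 v - S k v| <= q ^+ k * `|v|.
  rewrite /= addrC addKr !normrM sg1 mul1r ger0_norm ?exprn_ge0 ?invr_ge0//.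
  by rewrite ler_wpM2l ?exprn_ge0 ?invr_ge0// (hpsi k).1.
have q3 : q = 1 / 3 by rewrite div1r.
have Sdist k d v : `|S (k + d)%N v - S k v| <= 3 / 2 * (q ^+ k - q ^+ (k + d)) * `|v|.
  elim: d => [|d IH]; first by rewrite addn0 !subrr normr0 mulr0 mul0r.
  rewrite addnS.
  have -> : S (k + d).+1 v - S k v = (S (k + d).+1 v - S (k + d)%N v) + (S (k + d)%N v - S k v) by ring.
  apply: le_trans (ler_normD _ _) _; apply: le_trans (lerD (Sstep _ _) IH) _.
  by rewrite exprS q3; nra.
have qto0 : q ^+ n @[n --> \oo] --> (0 : R).
  by apply: cvg_expr; rewrite ger0_norm ?invr_ge0// q3; lra.
have Sdist' k n v : (k <= n)%N -> `|S n v - S k v| <= 3 / 2 * q ^+ k * `|v|.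
  move=> kn; rewrite -(subnKC kn); apply: le_trans (Sdist _ _ _) _.
  by rewrite ler_wpM2r// ler_wpM2l// gerBl exprn_ge0// invr_ge0.
have Scvg v : cvgn (fun k => S k v).
  pose T k := S k v + 3 / 2 * q ^+ k * `|v|.
  have Tcvg : cvgn T.
    apply: nonincreasing_is_cvgn.
      apply/nonincreasing_seqP => k; rewrite /T exprS {1}q3.
      by have := ler_norm (S k.+1 v - S k v); have := Sstep k v; lra.
    exists (- (3 / 2 * `|v|)) => _ [k _ <-]; rewrite /T.
    have := Sdist' 0%N k v (leq0n k); rewrite subr0 expr0 mulr1 ler_norml => /andP[+ _].
    have : 0 <= 3 / 2 * q ^+ k * `|v| by rewrite !mulr_ge0 ?exprn_ge0 ?invr_ge0.
    lra.
  have -> : (fun k => S k v) = T \- (fun k => 3 / 2 * q ^+ k * `|v|).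
    by apply/funext => k; rewrite /T /= addrK.
  by apply: is_cvgB => //; apply: is_cvgMr_tmp; apply: is_cvgMl_tmp; apply/cvg_ex; exists 0.
pose phi v : R^o := limn (fun k => S k v).
have phidist k v : `|phi v - S k v| <= 3 / 2 * q ^+ k * `|v|.
  apply/ler_addgt0Pr => e e0.
  have /cvgrPdist_le/(_ _ e0)[N _ hN] : (fun k => S k v) @ \oo --> phi v by exact: Scvg.
  have := hN (maxn N k) (leq_maxl _ _); have := Sdist' k (maxn N k) v (leq_maxr _ _).
  have := ler_normD (phi v - S (maxn N k) v) (S (maxn N k) v - S k v).
  by rewrite addrA subrK; lra.
have philin : GRing.linear_for *:%R phi.
  move=> a u v; rewrite /phi; apply/cvg_lim => //.
  under eq_fun do rewrite Slin.
  by apply: cvgD; [apply: cvgZl_tmp|]; exact: Scvg.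
pose mix := GRing.isLinear.Build R V R^o *:%R phi philin.
pose phil : {linear V -> R^o} := HB.pack phi mix.
have cphi : continuous phil.
  by apply: (@norm_le_continuous _ _ _ (3 / 2)) => v; have := phidist 0%N v; rewrite subr0 expr0 mulr1.
have [B hB] : exists B : R, forall n, `|phi (x n)| <= B.
  have /cvg_seq_bounded[B [_ hB]] : cvgn (fun n => phil (x n)) by apply/cvg_ex; exists 0; exact: x0.
  by exists (`|B| + 1) => n; apply: hB => //; rewrite (le_lt_trans (ler_norm B))// ltrDl.
have [k kB] : exists k : nat, 2 * B < k%:R.
  by exists (Num.bound `|2 * B|); rewrite (le_lt_trans (ler_norm _))// archi_boundP.
have qk : q ^+ k * 3 ^+ k = 1 by rewrite -exprMn mulVf ?expr1n.
have Q0 : 0 < q ^+ k by rewrite exprn_gt0 ?invr_gt0.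
have kX : k%:R <= q ^+ k * `|x (m k)|.
  have := hm k; rewrite -(ler_pM2l Q0) => /(le_trans _); apply.
  by rewrite mulrCA qk mulr1.
have := hB (m k); have := Sbig k; have := phidist k.+1 (x (m k)).
have := ler_normD (S k.+1 (x (m k)) - phi (x (m k))) (phi (x (m k))).
rewrite subrK (distrC (S _ _)) exprS {1}q3 -(mulrA _ (_ * _)) -(mulrA (1 / 3)).
by lra.
Qed.

End WeaklyNullBounded.

(** * Laws of random variables on the unit interval *)

Section Laws.
Context {R : realType}.
Notation P := (@leb01 R).
Implicit Types (f g : R -> R) (A B : set R).

Lemma ae_mono (p q : R -> Prop) : (forall t, p t -> q t) ->
  (\forall t \ae P, p t) -> \forall t \ae P, q t.
Proof.
by move=> pq; exact: (@filterS _ _ (@ae_filter_ringOfSetsType _ _ _ P)).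
Qed.

Lemma ae_and (p q : R -> Prop) : (\forall t \ae P, p t) -> (\forall t \ae P, q t) ->
  \forall t \ae P, p t /\ q t.
Proof. exact: (@filterI _ _ (@ae_filter_ringOfSetsType _ _ _ P)). Qed.

Lemma ae_always (p : R -> Prop) : (forall t, p t) -> \forall t \ae P, p t.
Proof. exact: (@filterE _ _ (@ae_filter_ringOfSetsType _ _ _ P)). Qed.

Lemma leb01_lty A : measurable A -> (P A < +oo)%E.
Proof. by move=> mA; apply: le_lt_trans (probability_le1 P mA) (ltry 1). Qed.

(** The half-lines are stable under intersection and generate the Borel sets. *)
Lemma finite_measure_tails (m1 m2 : {measure set (measurableTypeR R) -> \bar R}) :
    (m1 setT < +oo)%E -> (forall x : R, m1 `]x, +oo[%classic = m2 `]x, +oo[%classic) ->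
  forall B : set (measurableTypeR R), measurable B -> m1 B = m2 B.
Proof.
move=> m1oo m12 B mB.
apply: (@measure_unique _ R (measurableTypeR R) (@RGenOInfty.G R) (fun k => `]- k%:R, +oo[%classic) _ _ _ _ m1 m2) => //.
- exact: RGenOInfty.measurableE.
- move=> _ _ [x ->] [y ->]; exists (Num.max x y).
  by apply/seteqP; split => t /=; rewrite !in_itv/= !andbT gt_max; [case=> -> ->|move/andP].
- by move=> i; exists (- i%:R).
- apply/seteqP; split => // t _; exists (Num.bound `|t|) => //=.
  by rewrite in_itv/= andbT ltrNl (le_lt_trans (ler_norm _))// normrN archi_boundP.
- by move=> _ [x ->]; exact: m12.
- by move=> k; apply: le_lt_trans m1oo; apply: le_measure => //; rewrite inE//; exact: measurable_itv.
Qed.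

Lemma measurable_tail f (x : R) : measurable_fun setT f ->
  measurable [set t | (x < f t)%R].
Proof.
move=> mf; have := mf measurableT `]x, +oo[%classic (measurable_itv _).
by rewrite setTI; congr measurable; apply/seteqP; split => t /=; rewrite in_itv/= andbT.
Qed.

(** Intersecting with events [A] and [A'] makes this usable for conditional laws. *)
Lemma tails_determine_law f g A A' (mf : measurable_fun setT f) (mg : measurable_fun setT g)
    (mA : measurable A) (mA' : measurable A') :
    (forall x : R, P (A `&` [set t | (x < f t)%R]) = P (A' `&` [set t | (x < g t)%R])) ->
  forall B, measurable B -> P (A `&` f @^-1` B) = P (A' `&` g @^-1` B).
Proof.
move=> fg B mB.
have H := @finite_measure_tails (pushforward (mrestr P mA) (f : measurableTypeR R -> measurableTypeR R))
  (pushforward (mrestr P mA') (g : measurableTypeR R -> measurableTypeR R)).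
have : pushforward (mrestr P mA) f B = pushforward (mrestr P mA') g B.
  apply: H => //; rewrite /pushforward.
    change (P (f @^-1` setT `&` A) < +oo)%E.
    by rewrite preimage_setT setTI; exact: leb01_lty.
  move=> x; change (P (f @^-1` `]x, +oo[%classic `&` A) = P (g @^-1` `]x, +oo[%classic `&` A')).
  have := fg x; rewrite setIC (setIC A').
  by congr (P (_ `&` _) = P (_ `&` _)); apply/seteqP; split => t /=; rewrite in_itv/= andbT.
change (P (f @^-1` B `&` A) = P (g @^-1` B `&` A') -> P (A `&` f @^-1` B) = P (A' `&` g @^-1` B)).
by rewrite setIC (setIC _ A').
Qed.

(** Measurable rectangles are stable under intersection and generate the product
    sigma-algebra. *)
Lemma rectangles_determine_law f1 f2 g1 g2 A A'
    (mf1 : measurable_fun setT f1) (mf2 : measurable_fun setT f2)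
    (mg1 : measurable_fun setT g1) (mg2 : measurable_fun setT g2)
    (mA : measurable A) (mA' : measurable A') :
    (forall B1 B2, measurable B1 -> measurable B2 ->
       P (A `&` (f1 @^-1` B1 `&` f2 @^-1` B2)) = P (A' `&` (g1 @^-1` B1 `&` g2 @^-1` B2))) ->
  forall D : set (R * R), measurable D ->
    P (A `&` [set t | D (f1 t, f2 t)]) = P (A' `&` [set t | D (g1 t, g2 t)]).
Proof.
move=> fg D mD.
pose f t := (f1 t, f2 t); pose g t := (g1 t, g2 t).
have mf : measurable_fun setT f by exact: measurable_fun_pair.
have mg : measurable_fun setT g by exact: measurable_fun_pair.
have H : pushforward (mrestr P mA) f D = pushforward (mrestr P mA') g D.
  apply: (@measure_unique _ _ _ [set C | exists B1, measurable B1 /\ exists B2, measurable B2 /\ C = B1 `*` B2] (fun=> setT)) => //.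
  - rewrite measurable_prod_measurableType //; congr (<<s _ >>).
    rewrite predeqE => C; split => [[X mX [Y mY <-]]|[X [mX [Y [mY ->]]]]].
      by exists X; split => //; exists Y.
    by exists X => //; exists Y.
  - move=> _ _ [X1 [mX1 [X2 [mX2 ->]]]] [Y1 [mY1 [Y2 [mY2 ->]]]].
    rewrite -setXI; exists (X1 `&` Y1); split; first exact: measurableI.
    by exists (X2 `&` Y2); split => //; exact: measurableI.
  - by move=> i; exists setT; split => //; exists setT; split => //; rewrite setXTT.
  - by rewrite bigcup_const.
  - move=> _ [B1 [mB1 [B2 [mB2 ->]]]].
    change (P (f @^-1` (B1 `*` B2) `&` A) = P (g @^-1` (B1 `*` B2) `&` A')).
    by rewrite setIC (setIC _ A'); exact: fg.
  - move=> k; change (P (f @^-1` setT `&` A) < +oo)%E.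
    by rewrite preimage_setT setTI; exact: leb01_lty.
move: H; change (P (f @^-1` D `&` A) = P (g @^-1` D `&` A') -> P (A `&` f @^-1` D) = P (A' `&` g @^-1` D)).
by rewrite setIC (setIC _ A').
Qed.

(** If the families [X] and [Y] have the same finite-dimensional laws on
    products of Borel sets, one can replace the first variables by their sum
    one at a time: the pairs (partial sum, next variable) agree in law
    conditionally on any event involving the later variables only. *)
Lemma joint_law_sum (X Y : nat -> R -> R) (a : nat -> R)
    (mX : forall n, measurable_fun setT (X n)) (mY : forall n, measurable_fun setT (Y n)) :
    (forall n (B : nat -> set R), (forall k, measurable (B k)) ->
       P (\bigcap_(k < n) X k @^-1` B k) = P (\bigcap_(k < n) Y k @^-1` B k)) ->
  forall n B, measurable B ->
    P ((fun t => \sum_(k < n) a k * X k t : R) @^-1` B) =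
    P ((fun t => \sum_(k < n) a k * Y k t : R) @^-1` B).
Proof.
move=> XY n B mB.
pose S (Z : nat -> R -> R) m : R -> R := fun t => \sum_(k < m) a k * Z k t.
have mS Z m : (forall n, measurable_fun setT (Z n)) -> measurable_fun setT (S Z m).
  by move=> mZ; apply: measurable_sum => k; apply: measurable_funM.
pose I (Z : nat -> R -> R) (C : nat -> set R) m d : set R := \bigcap_(k in [set k | m <= k < m + d]%N) Z k @^-1` C k.
have mI Z C m d : (forall n, measurable_fun setT (Z n)) -> (forall k, measurable (C k)) -> measurable (I Z C m d).
  move=> mZ mC; apply: bigcap_measurableType => // k _; rewrite -[X in measurable X]setTI; exact: mZ.
suff H : forall m d C D, (forall k, measurable (C k)) -> measurable D ->
    P (I X C m d `&` S X m @^-1` D) = P (I Y C m d `&` S Y m @^-1` D).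
  have := H n 0%N (fun=> setT) B (fun=> measurableT) mB.
  by rewrite /I addn0 (_ : [set k | _] = set0) ?bigcap_set0 ?setTI//; apply/seteqP; split => // k /=; lia.
elim=> [|m IH] d C D mC mD.
  rewrite /S; under eq_fun do rewrite big_ord0; under [in RHS]eq_fun do rewrite big_ord0.
  have E Z : I Z C 0%N d = \bigcap_(k < d) Z k @^-1` C k by apply/seteqP; split => t h k /= hk; apply: h.
  have [D0|D0] := pselect (D 0).
    have -> : (fun _ : R => 0 : R) @^-1` D = setT by apply/seteqP; split.
    by rewrite !setIT !E XY.
  have -> : (fun _ : R => 0 : R) @^-1` D = set0 by apply/seteqP; split.
  by rewrite !setI0.
have mD' : measurable [set z : R * R | D (z.1 + a m * z.2)].
  have mh : measurable_fun setT (fun z : R * R => z.1 + a m * z.2).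
    by apply: measurable_funD => //; apply: measurable_funM.
  by have := mh measurableT D mD; rewrite setTI.
have E Z : S Z m.+1 @^-1` D = [set t | [set z : R * R | D (z.1 + a m * z.2)] (S Z m t, Z m t)].
  by apply/funext => t; rewrite /S /preimage/= big_ord_recr.
rewrite !E; apply: rectangles_determine_law mD' => // [||||B1 B2 mB1 mB2].
1,2: exact: mS.
1,2: exact: mI.
pose C' k := if k == m then B2 else C k.
have E' Z : I Z C m.+1 d `&` (S Z m @^-1` B1 `&` Z m @^-1` B2) = I Z C' m d.+1 `&` S Z m @^-1` B1.
  rewrite setICA setIC; congr (_ `&` _).
  rewrite /I; apply/seteqP; split => t /=.
    move=> [h hB2] k /= /andP[mk kd]; rewrite /C'; case: eqVneq => [->//|km].
    by apply: h; rewrite /=; lia.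
  move=> h; split; last by have := h m; rewrite /C' eqxx; apply; rewrite /=; lia.
  move=> k /= hk; have := h k; rewrite /C' ifN; first by apply; rewrite /=; lia.
  lia.
rewrite !E' IH// => k; rewrite /C'; by case: ifP.
Qed.

End Laws.

(** * Independent uniform variables on the unit interval *)

Section UniformPair.
Context {R : realType}.
Notation P := (@leb01 R).
Implicit Types (A B C : set R) (t x y : R).

(** [clip01 (1 - x)] is the probability that a uniform variable exceeds [x]. *)
Definition clip01 (x : R) : R := Num.max 0 (Num.min 1 x).

Lemma clip01_ge1 x : 1 <= x -> clip01 x = 1.
Proof. by move=> x1; rewrite /clip01 min_l// max_r. Qed.

Lemma clip01_le0 x : x <= 0 -> clip01 x = 0.
Proof. by move=> x0; rewrite /clip01 min_r ?max_l//; lra. Qed.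

Lemma clip01_id x : 0 <= x <= 1 -> clip01 x = x.
Proof. by move=> x0; rewrite /clip01 min_r ?max_r//; lra. Qed.

Lemma leb01_itv (b1 b2 : bool) (l r : R) A : l < r ->
    (forall t, (A t /\ 0 <= t <= 1) <-> t \in Interval (BSide b1 l) (BSide b2 r)) ->
  P A = (r - l)%:E.
Proof.
move=> lr Alr; transitivity (lebesgue_measure [set` Interval (BSide b1 l) (BSide b2 r)]).
  rewrite /leb01/mrestr; congr (_ _); apply/seteqP; split => t /=.
    by move=> [At]; rewrite in_itv/= => t01; apply/Alr.
  by move=> /Alr[At t01]; split => //; rewrite in_itv.
by rewrite lebesgue_measure_itv/= lte_fin lr -EFinB.
Qed.

Lemma leb01_empty A : (forall t, A t -> 0 <= t <= 1 -> False) -> P A = 0%E.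
Proof.
move=> A0; rewrite /leb01/mrestr (_ : _ `&` _ = set0) ?measure0//.
by apply/seteqP; split => t //= [/A0 h]; rewrite in_itv.
Qed.

Lemma leb01_tail x : P [set t | x < t] = (clip01 (1 - x))%:E.
Proof.
have [x0|x0] := ltP x 0.
  rewrite clip01_ge1; last lra.
  rewrite (@leb01_itv true false 0 1)//; first by rewrite subr0.
  by move=> t /=; rewrite in_itv/=; split; [case|move=> ?; split => //; lra].
have [x1|x1] := ltP x 1.
  rewrite clip01_id; last lra.
  rewrite (@leb01_itv false false x 1)// => t /=; rewrite in_itv/=.
  by split => [[]|]; lra.
by rewrite clip01_le0 ?leb01_empty//= => *; lra.
Qed.

Definition bit (t : R) : bool := 2^-1 <= t.
Definition doubling (t : R) : R := 2 * t - (bit t)%:R.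

Lemma bit_doubling_tail (c : bool) x :
  P ([set t | bit t = c] `&` [set t | x < doubling t]) = (2^-1 * clip01 (1 - x))%:E.
Proof.
rewrite (_ : _ `&` _ = [set t | bit t = c /\ x < 2 * t - c%:R]); last first.
  by apply/seteqP; split => t /= [<-].
rewrite /bit.
have [x1|x1] := ltP x 1; last first.
  rewrite leb01_empty ?clip01_le0 ?mulr0 //; first lra.
  by move=> t /= []; case: c => /=; lra.
have [x0|x0] := ltP x 0.
  rewrite clip01_ge1; last lra.
  case: c => /=.
    rewrite (@leb01_itv true false 2^-1 1); first (congr EFin; lra); first lra.
    by move=> t /=; rewrite in_itv/=; split=> [[[]]|h]; last split; try split; lra.
  rewrite (@leb01_itv true true 0 2^-1); first (congr EFin; lra); first lra.
  move=> t /=; rewrite in_itv/=; split=> [[[/negbT]]|h]; rewrite -?ltNge; first lra.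
  by split; [split; [apply/negbTE; rewrite -ltNge|]|]; lra.
rewrite clip01_id; last lra.
case: c => /=.
  rewrite (@leb01_itv false false (2^-1 * (x + 1)) 1); first (congr EFin; lra); first lra.
  by move=> t /=; rewrite in_itv/=; split=> [[[]]|h]; last split; try split; lra.
rewrite (@leb01_itv false true (2^-1 * x) 2^-1); first (congr EFin; lra); first lra.
move=> t /=; rewrite in_itv/=; split=> [[[/negbT]]|h]; rewrite -?ltNge; first lra.
by split; [split; [apply/negbTE; rewrite -ltNge|]|]; lra.
Qed.

Lemma measurable_fun_bit : measurable_fun setT bit.
Proof. exact: measurable_fun_ler. Qed.

Lemma measurable_bit (c : bool) : measurable [set t | bit t = c].
Proof.
rewrite -[X in measurable X]setTI.
by apply: (measurable_fun_bit measurableT (Y := [set c])).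
Qed.

Lemma measurable_fun_bitR : measurable_fun setT (fun t => (bit t)%:R : R).
Proof.
rewrite (_ : (fun t => _) = (fun t => if bit t then 1 else 0 : R)).
  by apply: measurable_fun_ifT => //; exact: measurable_fun_bit.
by apply/funext => t; case: bit.
Qed.

Lemma measurable_doubling : measurable_fun setT doubling.
Proof.
apply: measurable_funB; last exact: measurable_fun_bitR.
by apply: measurable_funM.
Qed.

(** For fixed [A] and [f], both sides are finite measures in [C], so it is enough to
    compare them on half-lines. *)
Lemma tails_product (A : set R) (f : R -> R) (r : R) : measurable A ->
    measurable_fun setT f -> 0 <= r ->
    (forall x, P (A `&` [set t | x < f t]) = (r%:E * P [set t | (x < t)%R])%E) ->
  forall C, measurable C -> P (A `&` f @^-1` C) = (r%:E * P C)%E.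
Proof.
move=> mA mf r0 fr C mC.
pose m1 := pushforward (mrestr P mA) (f : measurableTypeR R -> measurableTypeR R).
have H := @finite_measure_tails R m1 (mscale (NngNum r0) P).
rewrite setIC; apply: (_ : m1 C = _); apply: H => //.
- change (P (f @^-1` setT `&` A) < +oo)%E.
  by rewrite preimage_setT setTI; apply: leb01_lty.
- move=> x; change (P (f @^-1` `]x, +oo[%classic `&` A) = (r%:E * P `]x, +oo[%classic)%E).
  have E : `]x, +oo[%classic = [set t | x < t].
    by apply/seteqP; split => t /=; rewrite in_itv/= andbT.
  by rewrite E -fr setIC.
Qed.

(** On each half of the unit interval the doubling map is an affine bijection
    onto the whole interval, so it preserves the measure and is independent of
    the first binary digit. *)
Lemma bit_doubling (c : bool) C : measurable C ->
  P ([set t | bit t = c] `&` doubling @^-1` C) = (2^-1%:E * P C)%E.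
Proof.
apply: tails_product; [exact: measurable_bit|exact: measurable_doubling|by rewrite invr_ge0|].
by move=> x; rewrite bit_doubling_tail leb01_tail EFinM.
Qed.

(** [even_bits t] is the number whose binary digits are those of [t] at the
    even places, and [odd_bits t] the one made of the remaining digits. *)
Fixpoint even_bits_approx n (t : R) : R :=
  if n is m.+1 then
    2^-1 * (bit t)%:R + 2^-1 * even_bits_approx m (doubling (doubling t))
  else 0.

Definition even_bits (t : R) : R := limn (fun n => even_bits_approx n t).
Definition odd_bits (t : R) : R := even_bits (doubling t).

Lemma even_bits_approx01 n t : 0 <= even_bits_approx n t <= 1.
Proof.
elim: n t => [|n IH] t /=; first by rewrite lexx ler01.
by have := IH (doubling (doubling t)); case: (bit t) => /=; lra.
Qed.

Lemma cvg_even_bits t : (fun n => even_bits_approx n t) @ \oo --> even_bits t.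
Proof.
apply: nondecreasing_is_cvgn.
  apply/nondecreasing_seqP => n; elim: n t => [|n IH] t.
    by case/andP: (even_bits_approx01 1 t).
  by rewrite [leLHS]/= [leRHS]/= lerD2l ler_pM2l ?invr_gt0//; exact: IH.
by exists 1 => _ [n _ <-]; case/andP: (even_bits_approx01 n t).
Qed.

Lemma even_bits01 t : 0 <= even_bits t <= 1.
Proof.
by apply/andP; split; [apply: limr_ge|apply: limr_le]; try exact: cvg_even_bits;
  near=> n; case/andP: (even_bits_approx01 n t).
Unshelve. all: by end_near.
Qed.

Lemma odd_bits01 t : 0 <= odd_bits t <= 1.
Proof. exact: even_bits01. Qed.

Lemma even_bitsE t : even_bits t = 2^-1 * (bit t)%:R + 2^-1 * odd_bits (doubling t).
Proof.
apply/cvg_lim => //; rewrite -(cvg_shiftn 1) /=.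
have -> : (fun n => even_bits_approx (n + 1) t) =
    (fun n => 2^-1 * (bit t)%:R + 2^-1 * even_bits_approx n (doubling (doubling t))).
  by apply/funext => n; rewrite addn1.
apply: cvgD; first exact: cvg_cst.
by apply: cvgMr; exact: cvg_even_bits.
Qed.

Lemma measurable_even_bits : measurable_fun setT even_bits.
Proof.
apply: (@measurable_fun_cvg _ _ _ _ even_bits_approx) => // [n|t _]; last exact: cvg_even_bits.
elim: n => [|n IH] //=; apply: measurable_funD.
  by apply: measurable_funM => //; exact: measurable_fun_bitR.
apply: measurable_funM => //; apply: (measurableT_comp IH).
by apply: measurableT_comp; exact: measurable_doubling.
Qed.

Lemma measurable_odd_bits : measurable_fun setT odd_bits.
Proof. by apply: measurableT_comp; [exact: measurable_even_bits|exact: measurable_doubling]. Qed.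

End UniformPair.

Section UniformPairLaw.
Context {R : realType}.
Notation P := (@leb01 R).
Implicit Types (A B C : set R) (t x y : R).

Lemma leb01_fin A : measurable A -> P A \is a fin_num.
Proof. by move=> mA; rewrite ge0_fin_numE// leb01_lty. Qed.

Let T x y := [set t | x < even_bits t] `&` [set t | y < odd_bits t].
Let F x y := fine (P (T x y)).
Let u x : R := clip01 (1 - x).

Let mT x y : measurable (T x y).
Proof.
apply: measurableI; apply: measurable_tail;
  [exact: measurable_even_bits|exact: measurable_odd_bits].
Qed.

Let FE x y : P (T x y) = (F x y)%:E.
Proof. by rewrite fineK// leb01_fin. Qed.

Let Frec x y : F x y = 2^-1 * F y (2 * x) + 2^-1 * F y (2 * x - 1).
Proof.
apply: EFin_inj; rewrite -FE EFinD !EFinM -!FE.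
rewrite -(bit_doubling false (mT _ _)) -(bit_doubling true (mT _ _)).
have mb c : measurable ([set t | bit t = c] `&` T x y) by apply: measurableI => //; exact: measurable_bit.
rewrite (_ : T x y = ([set t | bit t = false] `&` T x y) `|` ([set t | bit t = true] `&` T x y)); last first.
  by rewrite -setIUl (_ : _ `|` _ = setT) ?setTI//; apply/seteqP; split => // t _ /=; case: bit; [right|left].
rewrite measureU; [|exact: mb|exact: mb|]; last by apply/seteqP; split => t //= [[-> _] []].
have key c t : bit t = c -> T x y t <-> T y (2 * x - c%:R) (doubling t).
  move=> bt; rewrite /T/= (even_bitsE t) bt; case: c bt => _ /=.
    by split => -[h1 h2]; split => //; lra.
  by split => -[h1 h2]; split => //; lra.
congr (P _ + P _)%E; apply/seteqP; split => t [/= bt h]; split => //.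
- by have := (key _ _ bt).1 h; rewrite subr0.
- by apply/(key _ _ bt); rewrite subr0.
- exact: (key _ _ bt).1 h.
- exact/(key _ _ bt).
Qed.

Let F_neg x y : x < 0 -> y < 0 -> F x y = 1.
Proof.
move=> x0 y0; apply: EFin_inj; rewrite -FE (_ : T x y = setT) ?leb01_setT//.
apply/seteqP; split => t //= _; have := even_bits01 t; have := odd_bits01 t; rewrite /T/=; split; lra.
Qed.

Let F_ge1 x y : 1 <= x \/ 1 <= y -> F x y = 0.
Proof.
move=> xy; apply: EFin_inj; rewrite -FE (_ : T x y = set0) ?measure0//.
by apply/seteqP; split => t //= []; have := even_bits01 t; have := odd_bits01 t; rewrite /T/=; lra.
Qed.

Let u_neg x : x < 0 -> u x = 1.
Proof. by move=> x0; rewrite /u clip01_ge1//; lra. Qed.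

Let u_ge1 x : 1 <= x -> u x = 0.
Proof. by move=> x0; rewrite /u clip01_le0//; lra. Qed.

Let u_rec x : u x = 2^-1 * u (2 * x) + 2^-1 * u (2 * x - 1).
Proof.
have [x0|x0] := ltP x 0; first by rewrite !u_neg; lra.
have [x1|x1] := ltP x 1; last by rewrite !u_ge1; lra.
have [x2|x2] := ltP x 2^-1.
  by rewrite (u_neg (x := 2 * x - 1)); last lra; rewrite /u !clip01_id; lra.
by rewrite (u_ge1 (x := 2 * x)); last lra; rewrite /u !clip01_id; lra.
Qed.

Let F01 x y : 0 <= F x y <= 1.
Proof.
by rewrite -!lee_fin -FE measure_ge0/=; exact: (probability_le1 P (mT x y)).
Qed.

Let u01 x : 0 <= u x <= 1.
Proof. by rewrite /u /clip01 le_max lexx/= ge_max ler01 ge_min lexx. Qed.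

(** A bounded family each of whose members is half of another member vanishes; this
    replaces an induction on binary digits. *)
Let contraction (I : Type) (e : I -> R) : (forall i, `|e i| <= 1) ->
  (forall i, exists j, e i = 2^-1 * e j) -> forall i, e i = 0.
Proof.
move=> e1 erec i.
suff H n : forall i, `|e i| <= 2^-1 ^+ n.
  apply/eqP; rewrite -normr_le0; apply/ler_addgt0Pr => d d0; rewrite add0r.
  have /cvgrPdist_lt/(_ _ d0)[N _ /(_ N (leqnn N))] : 2^-1 ^+ n @[n --> \oo] --> (0 : R).
    by apply: cvg_expr; rewrite ger0_norm ?invr_ge0//; lra.
  by rewrite sub0r normrN ger0_norm ?exprn_ge0 ?invr_ge0// => h; apply: le_trans (H N i) (ltW h).
elim: n => [|n IH] {}i; first by rewrite expr0.
have [j ->] := erec i.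
by rewrite exprS normrM ger0_norm ?invr_ge0// ler_wpM2l ?invr_ge0.
Qed.

(** One of the points [2 x] and [2 x - 1] always lies outside the unit interval. *)
Let half (G : R -> R) (x : R) : (forall z, z < 0 \/ 1 <= z -> G z = 0) ->
  exists z, 2^-1 * G (2 * x) + 2^-1 * G (2 * x - 1) = 2^-1 * G z.
Proof.
move=> G0; have [x2|x2] := ltP x 2^-1.
  by exists (2 * x); rewrite (G0 (2 * x - 1)) ?mulr0 ?addr0//; left; lra.
by exists (2 * x - 1); rewrite (G0 (2 * x)) ?mulr0 ?add0r//; right; lra.
Qed.

Let F_negr x y : y < 0 -> F x y = F x (-1).
Proof.
move=> y0; rewrite /F; congr (fine (P _)); apply/seteqP.
by split => t; have := odd_bits01 t; rewrite /T/=; lra.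
Qed.

Let F_negl x y : y < 0 -> F y x = F x (-1).
Proof.
move=> y0; rewrite Frec (F_negr _ (y := 2 * y)); last lra.
by rewrite (F_negr _ (y := 2 * y - 1)); lra.
Qed.

Let F_marginal x : F x (-1) = u x.
Proof.
apply/eqP; rewrite -subr_eq0; apply/eqP; move: x.
have bd z : z < 0 \/ 1 <= z -> F z (-1) - u z = 0.
  case=> z0; first by rewrite F_neg ?u_neg//; lra.
  by rewrite (F_ge1 (or_introl z0)) (u_ge1 z0) subrr.
apply: contraction => x; first by rewrite ler_norml; have := F01 x (-1); have := u01 x; lra.
have [z hz] := half x bd; exists z; rewrite -hz.
have n1 : (-1 : R) < 0 by lra.
by rewrite (Frec x (-1)) (F_negl (2 * x) n1) (F_negl (2 * x - 1) n1) (u_rec x); ring.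
Qed.

(** The error [F x y - u x * u y] satisfies an averaging recursion in which at
    most one of the two terms on the right is not a boundary value, so it is
    halved at every step. *)
Let F_product x y : F x y = u x * u y.
Proof.
apply/eqP; rewrite -subr_eq0; apply/eqP.
pose e (z : R * R) := F z.1 z.2 - u z.1 * u z.2.
apply: (contraction (e := e) _ _ (x, y)) => -[{}x {}y].
  rewrite /e ler_norml; have := F01 x y; have := u01 x; have := u01 y => /=; nra.
have bd z : z < 0 \/ 1 <= z -> e (y, z) = 0.
  rewrite /e; case=> z0 /=; first by rewrite F_negr// F_marginal (u_neg z0) mulr1 subrr.
  by rewrite (F_ge1 (or_intror z0)) (u_ge1 z0) mulr0 subrr.
have [z hz] := half x bd; exists (y, z); rewrite -hz /e/=.
by rewrite (Frec x y) (u_rec x); ring.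
Qed.

(** The product formula is known for tails, and extends to Borel sets in one
    coordinate at a time. *)
Lemma even_odd_bits_product A B : measurable A -> measurable B ->
  P (even_bits @^-1` A `&` odd_bits @^-1` B) = (P A * P B)%E.
Proof.
move=> mA mB.
have mA' : measurable (even_bits @^-1` A).
  by have := measurable_even_bits measurableT mA; rewrite setTI.
have h y : P ([set t | y < odd_bits t] `&` even_bits @^-1` A) = ((u y)%:E * P A)%E.
  apply: tails_product mA.
  - exact: measurable_tail measurable_odd_bits.
  - exact: measurable_even_bits.
  - by case/andP: (u01 y).
  - by move=> x; rewrite setIC -/(T x y) FE F_product mulrC EFinM leb01_tail.
have PA : P A = (fine (P A))%:E by rewrite fineK// leb01_fin.
rewrite PA; apply: tails_product mB.
- exact: mA'.
- exact: measurable_odd_bits.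
- by rewrite fine_ge0.
- by move=> y; rewrite setIC h -PA muleC leb01_tail.
Qed.

Lemma even_bits_uniform A : measurable A -> P (even_bits @^-1` A) = P A.
Proof.
move=> mA; have := even_odd_bits_product mA measurableT.
by rewrite preimage_setT setIT leb01_setT mule1.
Qed.

Lemma odd_bits_uniform A : measurable A -> P (odd_bits @^-1` A) = P A.
Proof.
move=> mA; have := even_odd_bits_product measurableT mA.
by rewrite preimage_setT setTI leb01_setT mul1e.
Qed.

End UniformPairLaw.

Section UniformSequence.
Context {R : realType}.
Notation P := (@leb01 R).
Implicit Types (X Y : nat -> R -> R) (B : nat -> set R).

Definition mkrv (f : R -> R) (mf : measurable_fun setT f) :
    {RV (@leb01 R) >-> measurableTypeR R} :=
  @mfun_Sub _ _ (measurableTypeR R) (measurableTypeR R) f (mem_set mf).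

(** The notion of independence for plain functions, which need not come bundled with
    a proof of measurability. *)
Definition indep X := forall (J : {fset nat}) B, (forall n, measurable (B n)) ->
  P (\bigcap_(n in [set` J]) X n @^-1` B n) = (\prod_(n <- J) P (X n @^-1` B n))%E.

Lemma leb01_ae_eq (A B : set R) : measurable A -> measurable B ->
  (\forall t \ae P, A t <-> B t) -> P A = P B.
Proof.
suff le (C D : set R) : measurable C -> measurable D -> (\forall t \ae P, C t <-> D t) -> (P C <= P D)%E.
  move=> mA mB AB; apply/eqP; rewrite eq_le !le//.
  by apply: ae_mono AB => t [].
move=> mC mD [N [mN N0 hN]].
have CDN : (P C <= P (D `|` (N : set R)))%E.
  apply: le_measure; rewrite ?inE//; first exact: measurableU.
  move=> t Ct; have [Dt|Dt] := pselect (D t); [by left|right; apply: hN => -[h _]].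
  by apply: Dt; exact: h.
apply: (le_trans CDN); apply: (le_trans (measureU2 P mD mN)).
by rewrite /= N0 adde0.
Qed.

Lemma measurable_preimage (f : R -> R) (C : set R) : measurable_fun setT f -> measurable C ->
  measurable (f @^-1` C).
Proof. by move=> mf mC; have := mf measurableT C mC; rewrite setTI. Qed.

Lemma indep_ae X Y : (forall n, measurable_fun setT (X n)) ->
    (forall n, measurable_fun setT (Y n)) ->
    (forall n, \forall t \ae P, X n t = Y n t) -> indep X -> indep Y.
Proof.
move=> mX mY XY iX J B mB.
have /ae_foralln XY' := XY.
rewrite -(leb01_ae_eq (A := \bigcap_(n in [set` J]) X n @^-1` B n)).
- rewrite iX//; apply: eq_bigr => n _; apply: leb01_ae_eq; try exact: measurable_preimage.
  by apply: ae_mono (XY n) => t /= ->.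
- by apply: bigcap_measurableType => // k _; exact: measurable_preimage.
- by apply: bigcap_measurableType => // k _; exact: measurable_preimage.
- by apply: ae_mono XY' => t h; split => hh k /hh; rewrite /preimage/= h.
Qed.

(** The index set [J] of the subsequence is moved to its image under [s], and the
    Borel sets are moved with a left inverse of [s]. *)
Lemma indep_subsequence X (s : nat -> nat) : injective s -> indep X -> indep (X \o s).
Proof.
move=> si iX J B mB.
have [r rs] : exists r : nat -> nat, cancel s r.
  exists (fun j => xget 0%N [set k | s k = j]) => k.
  by apply: si; apply: (@xgetPex _ 0%N [set j | s j = s k]); exists k.
have := iX [fset s k | k in J]%fset (B \o r) (fun n => mB _).
rewrite big_imfset/=; last by move=> i j _ _; exact: si.
under eq_bigr do rewrite rs.
move=> <-; congr P; apply/seteqP; split => t h k /=.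
  by move=> /imfsetP[j /= jJ ->]; rewrite rs; exact: h.
by move=> kJ; have := h (s k); rewrite /= rs; apply; apply/imfsetP; exists k.
Qed.

Lemma indep_comp X (q : nat -> R -> R) : (forall n, measurable_fun setT (q n)) ->
  indep X -> indep (fun n => q n \o X n).
Proof.
move=> mq iX J B mB.
by apply: (iX J (fun n => q n @^-1` B n)) => n; exact: measurable_preimage.
Qed.

(** Independence relative to initial segments is enough: constrain the missing
    indices to lie in the whole line. *)
Lemma indep_prefix X : (forall n, measurable_fun setT (X n)) ->
    (forall n B, (forall k, measurable (B k)) ->
       P (\bigcap_(k < n) X k @^-1` B k) = (\prod_(k < n) P (X k @^-1` B k))%E) ->
  indep X.
Proof.
move=> mX h J B mB.
pose n := (\max_(j <- J) j).+1.
have Jn j : j \in J -> (j < n)%N by move=> jJ; rewrite ltnS; apply: leq_bigmax_seq.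
pose C k := if k \in J then B k else setT.
have mC k : measurable (C k) by rewrite /C; case: ifP.
rewrite (_ : \bigcap_(k in _) _ = \bigcap_(k < n) X k @^-1` C k); last first.
  apply/seteqP; split => t ht k /= hk.
    by rewrite /C; case: ifPn => // kJ; exact: ht.
  by have := ht k (Jn _ hk); rewrite /C hk.
rewrite h// -(big_mkord xpredT (fun k => P (X k @^-1` C k))).
rewrite (bigID (fun k => k \in J))/= [X in (_ * X)%E]big1 ?mule1; last first.
  by move=> k kJ; rewrite /C (negbTE kJ) preimage_setT leb01_setT.
rewrite -big_filter; under eq_big_seq => k do rewrite mem_filter => /andP[kJ _].
rewrite (perm_big J); first by apply: eq_big_seq => k kJ; rewrite /C kJ.
apply: uniq_perm; [by rewrite filter_uniq// iota_uniq|exact: fset_uniq|].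
move=> k; rewrite mem_filter mem_index_iota/=.
by apply/andP/idP => [[]//|kJ]; split => //; exact: Jn.
Qed.

Lemma indep_prefixE X n B : indep X -> (forall k, measurable (B k)) ->
  P (\bigcap_(k < n) X k @^-1` B k) = (\prod_(k < n) P (X k @^-1` B k))%E.
Proof.
move=> iX mB; pose J := [fset k | k in iota 0 n]%fset.
have Jn k : (k \in J) = (k < n)%N.
  by apply/imfsetP/idP => [[j + ->]|kn]; [rewrite /= mem_iota|exists k; rewrite //= mem_iota].
have := iX J B mB.
rewrite -(big_mkord xpredT (fun k => P (X k @^-1` B k))).
rewrite (perm_big (index_iota 0 n)); last first.
  apply: uniq_perm; [exact: fset_uniq|exact: iota_uniq|move=> k].
  by transitivity (k \in J) => //; rewrite Jn mem_index_iota.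
by move=> <-; congr P; apply/seteqP; split => t h k /= hk; apply: h => /=; move: hk; rewrite Jn.
Qed.

(** Splitting off the digits at even places again and again yields infinitely
    many independent uniform variables. *)
Fixpoint unif n : R -> R := if n is m.+1 then unif m \o odd_bits else even_bits.

Lemma measurable_unif n : measurable_fun setT (unif n).
Proof.
elim: n => [|n IH] /=; first exact: measurable_even_bits.
by apply: measurableT_comp => //; exact: measurable_odd_bits.
Qed.

Lemma unif_uniform n A : measurable A -> P (unif n @^-1` A) = P A.
Proof.
move=> mA; elim: n => [|n IH] /=; first exact: even_bits_uniform.
rewrite comp_preimage odd_bits_uniform//; exact: measurable_preimage (measurable_unif n) mA.
Qed.

(** One step of the induction splits off the even digits, which are independent of
    everything computed from the odd ones. *)
Lemma indep_unif : indep unif.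
Proof.
apply: indep_prefix => [n|]; first exact: measurable_unif.
elim=> [|n IH] B mB; first by rewrite big_ord0 bigcap_mkord big_ord0 leb01_setT.
rewrite (_ : \bigcap_(k < n.+1) _ =
    even_bits @^-1` B 0%N `&` odd_bits @^-1` (\bigcap_(k < n) unif k @^-1` B k.+1)); last first.
  apply/seteqP; split => t.
    by move=> h; split; [exact: (h 0%N)|move=> k /= kn; exact: (h k.+1)].
  by move=> [h0 h] [|k] /= kn; [exact: h0|exact: (h k)].
rewrite even_odd_bits_product//; last first.
  by apply: bigcap_measurableType => // k _; exact: measurable_preimage (measurable_unif k) _.
rewrite IH// big_ord_recl; congr (_ * _)%E; first by rewrite even_bits_uniform.
by apply: eq_bigr => k _; rewrite !unif_uniform.
Qed.

End UniformSequence.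

Section Quantile.
Context {R : realType}.
Notation P := (@leb01 R).
Implicit Types (f g : R -> R) (A B : set R).

Definition pr A : R := fine (P A).

Lemma prE A : measurable A -> P A = (pr A)%:E.
Proof. by move=> mA; rewrite fineK// leb01_fin. Qed.

Lemma pr_ge0 A : 0 <= pr A.
Proof. by rewrite fine_ge0. Qed.

Lemma pr_le1 A : measurable A -> pr A <= 1.
Proof. by move=> mA; rewrite -lee_fin -prE//; exact: (probability_le1 P mA). Qed.

Lemma le_pr A B : measurable A -> measurable B -> A `<=` B -> pr A <= pr B.
Proof.
by move=> mA mB AB; rewrite -lee_fin -!prE//; apply: le_measure; rewrite ?inE.
Qed.

Lemma pr0 : pr set0 = 0.
Proof. by rewrite /pr measure0. Qed.

Lemma prT : pr setT = 1.
Proof. by rewrite /pr leb01_setT. Qed.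

Lemma pr_split A B : measurable A -> measurable B -> pr A = pr (A `&` B) + pr (A `&` ~` B).
Proof.
move=> mA mB; have mC := measurableC mB.
apply: EFin_inj; rewrite EFinD -!prE//; try exact: measurableI.
rewrite -measureU//; try exact: measurableI.
  by rewrite -setIUr setUv setIT.
by apply/seteqP; split => t //= [[_ ?] []].
Qed.

Lemma prC A : measurable A -> pr (~` A) = 1 - pr A.
Proof. by move=> mA; rewrite -prT (pr_split measurableT mA) !setTI; lra. Qed.

Lemma prU_le A B : measurable A -> measurable B -> pr (A `|` B) <= pr A + pr B.
Proof.
move=> mA mB; rewrite -lee_fin EFinD -!prE//; last exact: measurableU.
exact: (measureU2 P mA mB).
Qed.

(** Continuity from above at the empty set. *)
Lemma pr_decreasing_to0 (F : nat -> set R) : (forall n, measurable (F n)) ->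
    (forall n m, (n <= m)%N -> F m `<=` F n) -> (forall t, ~ forall n, F n t) ->
  forall e : R, 0 < e -> exists n, pr (F n) < e.
Proof.
move=> mF dF F0 e e0.
have F0' : \bigcap_n F n = set0 by apply/seteqP; split => // t h; apply: (F0 t) => n; exact: h.
have := @nonincreasing_cvg_mu _ _ _ P F _ mF _ _.
rewrite F0' measure0 => /(_ _ _ _)/fine_cvgP[].
- exact: leb01_lty.
- exact: measurable0.
- by move=> n m nm; apply/subsetPset; exact: dF.
move=> _ /cvgrPdist_lt/(_ _ e0)[N _ /(_ N (leqnn N))].
rewrite sub0r normrN => h; exists N.
by apply: le_lt_trans h; exact: ler_norm.
Qed.

Lemma ae_of_pr1 A : measurable A -> pr A = 1 -> \forall t \ae P, A t.
Proof.
move=> mA A1; exists (~` A); split => //; first exact: measurableC.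
by rewrite prE ?prC ?A1 ?subrr//; exact: measurableC.
Qed.

Lemma ae_open01 : \forall u \ae P, (0 : R) < u < 1.
Proof.
have m01 : measurable [set u : R | 0 < u < 1].
  have : measurable `]0 : R, 1[%classic by exact: measurable_itv.
  by congr measurable; apply/seteqP; split => u /=; rewrite in_itv.
apply: (ae_of_pr1 m01); apply: EFin_inj; rewrite -prE//.
rewrite (@leb01_itv _ false true 0 1)// ?subr0// => u /=; rewrite in_itv/=.
by split => [[]//|?]; split => //; lra.
Qed.

Definition same_law f g := forall B, measurable B -> P (f @^-1` B) = P (g @^-1` B).

Lemma same_law_sym f g : same_law f g -> same_law g f.
Proof. by move=> fg B mB; rewrite fg. Qed.

Lemma same_law_comp f g (h : R -> R) : measurable_fun setT h -> same_law f g ->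
  same_law (h \o f) (h \o g).
Proof. by move=> mh fg B mB; exact: fg _ (measurable_preimage mh mB). Qed.

Lemma same_law_tails f g : measurable_fun setT f -> measurable_fun setT g ->
  (forall x : R, P [set t | (x < f t)%R] = P [set t | (x < g t)%R]) -> same_law f g.
Proof.
move=> mf mg fg B mB.
rewrite -[f @^-1` B]setTI -[g @^-1` B]setTI; apply: tails_determine_law => // x.
by rewrite !setTI.
Qed.

Lemma measurable_of_tails f : (forall x, measurable [set t | x < f t]) -> measurable_fun setT f.
Proof.
move=> h; apply: (measurability _ (RGenOInfty.measurableE R)) => // _ [_ [x ->] <-].
rewrite setTI (_ : f @^-1` _ = [set t | x < f t]); first exact: h.
by apply/seteqP; split => t /=; rewrite in_itv/= andbT.
Qed.

Lemma measurable_nondecreasing_on01 f :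
    (forall u v, 0 < u -> u <= v -> v < 1 -> f u <= f v) ->
    (forall u, ~~ (0 < u < 1) -> f u = 0) ->
  measurable_fun setT f.
Proof.
move=> fnd f0; apply: measurable_of_tails => x.
have m01 : measurable [set u : R | 0 < u < 1].
  have : measurable `]0 : R, 1[%classic by exact: measurable_itv.
  by congr measurable; apply/seteqP; split => u /=; rewrite in_itv.
have mx : measurable [set _ : R | x < 0].
  case: (x < 0); first by rewrite (_ : mkset _ = setT)//; apply/seteqP; split.
  by rewrite (_ : mkset _ = set0)//; apply/seteqP; split.
rewrite (_ : [set t | _] = [set u | 0 < u < 1 /\ x < f u] `|` ([set u | x < 0] `&` ~` [set u | 0 < u < 1])).
  apply: measurableU; last by apply: measurableI; [exact: mx|exact: measurableC].
  apply: is_interval_measurable => u v [/andP[u0 u1] xu] [/andP[v0 v1] xv] w /andP[uw wv] /=.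
  by split; [lra|apply: lt_le_trans xu (fnd _ _ _ _ _)] => //; lra.
apply/seteqP; split => u /=.
  have [u01|u01] := boolP (0 < u < 1); first by left.
  by rewrite f0// => x0; right.
by move=> [[]//|[x0 /negP u01]]; rewrite f0.
Qed.

Definition cumul f (s : R) : R := pr [set t | f t <= s].

Definition quantile f (u : R) : R :=
  if 0 < u < 1 then inf [set s | u <= cumul f s] else 0.

Lemma tail_cumul f s : measurable_fun setT f -> pr [set t | s < f t] = 1 - cumul f s.
Proof.
move=> mf; rewrite /cumul -prC; last first.
  have := measurableC (measurable_tail s mf); congr measurable.
  by apply/seteqP; split => t /=; rewrite leNgt => /negP.
by congr pr; apply/seteqP; split => t /=; rewrite ltNge => /negP.
Qed.

Lemma cumul_nondecreasing f s s' : measurable_fun setT f -> s <= s' -> cumul f s <= cumul f s'.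
Proof.
move=> mf ss'; suff : pr [set t | s' < f t] <= pr [set t | s < f t] by rewrite !tail_cumul//; lra.
by apply: le_pr => [||t /=]; try exact: measurable_tail; exact: le_lt_trans.
Qed.

Lemma quantile_set f u : measurable_fun setT f -> 0 < u < 1 -> has_inf [set s | u <= cumul f s].
Proof.
move=> mf /andP[u0 u1].
have tl (h : R -> R) e : measurable_fun setT h -> 0 < e -> exists n : nat, pr [set t | n%:R < h t] < e.
  move=> mh; apply: (@pr_decreasing_to0 (fun n => [set t | n%:R < h t])).
  - by move=> n; exact: measurable_tail.
  - by move=> n m nm t /=; apply: le_lt_trans; rewrite ler_nat.
  - move=> t /(_ (Num.bound `|h t|)) /=; apply/negP; rewrite -leNgt.
    by apply: le_trans (ler_norm _) (ltW _); rewrite archi_boundP.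
split.
  have u1' : 0 < 1 - u by lra.
  by have [n] := tl f _ mf u1'; rewrite tail_cumul// => h; exists n%:R => /=; lra.
have mNf : measurable_fun setT (fun t => - f t) by exact: measurable_funN.
have [n hn] := tl _ _ mNf u0.
exists (- n%:R - 1) => s /= us; rewrite leNgt; apply/negP => sn.
have : cumul f s <= pr [set t | n%:R < - f t].
  apply: le_pr => [||t /=]; [|exact: measurable_tail|lra].
  have := measurableC (measurable_tail s mf); congr measurable.
  by apply/seteqP; split => t /=; rewrite leNgt => /negP.
lra.
Qed.

Lemma cumul_right_continuous f s (u : R) : measurable_fun setT f ->
  (forall s', s < s' -> u <= cumul f s') -> u <= cumul f s.
Proof.
move=> mf hu; rewrite leNgt; apply/negP => us.
pose F n := [set t | s < f t] `&` ~` [set t | s + n.+1%:R^-1 < f t].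
have [||||n] := @pr_decreasing_to0 F _ _ _ (u - cumul f s).
- by move=> n; apply: measurableI; [|apply: measurableC]; exact: measurable_tail.
- move=> n m nm t [/= st h]; split => //= h'; apply: h; apply: le_lt_trans h'.
  by rewrite lerD2l lef_pV2 ?posrE// ler_nat ltnS.
- move=> t h; have [/= st _] := h 0%N.
  have d0 : 0 < f t - s by lra.
  have := (h (Num.bound (f t - s)^-1)).2; apply => /=.
  rewrite -ltrBrDl invf_plt ?posrE//; apply: lt_le_trans (archi_boundP _) _; last by rewrite ler_nat.
  by rewrite invr_ge0 ltW.
- lra.
apply/negP; rewrite -leNgt.
have m1 := measurable_tail s mf; have m2 := measurable_tail (s + n.+1%:R^-1) mf.
have := pr_split m1 m2.
have -> : [set t | s < f t] `&` [set t | s + n.+1%:R^-1 < f t] = [set t | s + n.+1%:R^-1 < f t].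
  by apply/seteqP; split => t /= => [[]//|h]; split => //; apply: lt_trans h; rewrite ltrDl invr_gt0.
rewrite -/(F n) !tail_cumul//.
have := hu (s + n.+1%:R^-1); rewrite ltrDl invr_gt0 ltr0n => /(_ isT); lra.
Qed.

(** The Galois connection between the quantile and the distribution function. *)
Lemma quantile_le f u s : measurable_fun setT f -> 0 < u < 1 ->
  (quantile f u <= s) = (u <= cumul f s).
Proof.
move=> mf u01; have [Sn Slb] := quantile_set mf u01.
rewrite /quantile u01; apply/idP/idP => [us|us]; last exact: ge_inf.
apply: cumul_right_continuous => // s' ss'.
have [v /= uv vs'] : exists2 v, u <= cumul f v & v < s'.
  by have [v] := @inf_lt _ [set s | u <= cumul f s] s' Sn (le_lt_trans us ss'); exists v.
by apply: le_trans uv _; apply: cumul_nondecreasing => //; exact: ltW.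
Qed.

Lemma quantile_nondecreasing f u v : measurable_fun setT f ->
  0 < u -> u <= v -> v < 1 -> quantile f u <= quantile f v.
Proof.
move=> mf u0 uv v1; rewrite quantile_le//; last lra.
have v01 : 0 < v < 1 by lra.
by apply: le_trans uv _; rewrite -quantile_le.
Qed.

Lemma measurable_quantile f : measurable_fun setT f -> measurable_fun setT (quantile f).
Proof.
move=> mf; apply: measurable_nondecreasing_on01 => [u v|u u01]; first exact: quantile_nondecreasing.
by rewrite /quantile (negbTE u01).
Qed.

(** By [quantile_le], the set where the quantile exceeds [x] is the half-line
    above [cumul f x], whose measure is the tail of [f]. *)
Lemma quantile_law f : measurable_fun setT f -> same_law (quantile f) f.
Proof.
move=> mf; have mq := measurable_quantile mf.
apply: same_law_tails => // x.
rewrite (@leb01_ae_eq _ _ [set u | cumul f x < u]).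
- rewrite leb01_tail prE ?tail_cumul//; last exact: measurable_tail.
  rewrite clip01_id//; have := pr_ge0 [set t | f t <= x]; have := pr_ge0 [set t | x < f t].
  by rewrite tail_cumul// -/(cumul f x); lra.
- exact: measurable_tail.
- exact: (@measurable_tail _ id).
- by apply: ae_mono ae_open01 => u u01 /=; rewrite !ltNge quantile_le.
Qed.

Lemma quantile_mono f g : measurable_fun setT f -> measurable_fun setT g ->
    (forall s, pr [set t | s < f t] <= pr [set t | s < g t]) ->
  forall u, quantile f u <= quantile g u.
Proof.
move=> mf mg fg u; have [u01|u01] := boolP (0 < u < 1); last by rewrite /quantile (negbTE u01).
rewrite quantile_le//; have := fg (quantile g u); rewrite !tail_cumul//.
by have : u <= cumul g (quantile g u); [rewrite -quantile_le|lra].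
Qed.

End Quantile.

(** * The lattice structure of a rearrangement-invariant space *)

Section Representatives.
Context {R : realType} {E : banach_fun_space R}.
Notation P := (@leb01 R).
Implicit Types (x y z : E) (f g h : R -> R).

(** Representatives are arbitrary functions here, so that algebraic expressions can
    represent vectors without bundling a proof of measurability. *)
Definition reps x f := \forall t \ae P, rep x t = f t.

Lemma measurable_rep x : measurable_fun setT (rep x : R -> R).
Proof. exact: (@measurable_funPT _ _ _ _ (rep x)). Qed.

Lemma reps_rep x : reps x (rep x).
Proof. exact: ae_always. Qed.

Lemma reps_uniq x y f : reps x f -> reps y f -> x = y.
Proof.
move=> xf yf; apply: rep_inj.
by apply: ae_mono (ae_and xf yf) => t [-> ->].
Qed.

Lemma reps_ae x f g : reps x f -> (\forall t \ae P, f t = g t) -> reps x g.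
Proof. by move=> xf fg; apply: ae_mono (ae_and xf fg) => t [-> ->]. Qed.

Lemma reps_linear (a : R) x y f g : reps x f -> reps y g ->
  reps (a *: x + y) (fun t => a * f t + g t).
Proof.
move=> xf yg; apply: ae_mono (ae_and (rep_linear a x y) (ae_and xf yg)).
by move=> t [-> [-> ->]].
Qed.

Lemma repsD x y f g : reps x f -> reps y g -> reps (x + y) (fun t => f t + g t).
Proof.
move=> xf yg; have := reps_linear 1 xf yg; rewrite scale1r => h.
by apply: reps_ae h _; apply: ae_always => t; rewrite mul1r.
Qed.

Lemma reps0 : reps 0 (fun=> 0).
Proof.
have := reps_linear (-1) (reps_rep 0) (reps_rep 0); rewrite scaler0 addr0 => h.
by apply: reps_ae h _; apply: ae_always => t; rewrite mulN1r addNr.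
Qed.

Lemma repsZ (a : R) x f : reps x f -> reps (a *: x) (fun t => a * f t).
Proof.
move=> xf; have := reps_linear a xf reps0; rewrite addr0 => h.
by apply: reps_ae h _; apply: ae_always => t; rewrite addr0.
Qed.

Lemma repsB x y f g : reps x f -> reps y g -> reps (x - y) (fun t => f t - g t).
Proof.
move=> xf yg; have := reps_linear (-1) yg xf; rewrite scaleN1r addrC => h.
by apply: reps_ae h _; apply: ae_always => t; rewrite mulN1r addrC.
Qed.

Lemma reps_sum n (a : nat -> R) (x : nat -> E) (f : nat -> R -> R) :
  (forall k, reps (x k) (f k)) ->
  reps (\sum_(k < n) a k *: x k) (fun t => \sum_(k < n) a k * f k t).
Proof.
move=> xf; elim: n => [|n IH].
  by rewrite big_ord0; apply: reps_ae reps0 _; apply: ae_always => t; rewrite big_ord0.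
rewrite big_ord_recr/=; apply: reps_ae (repsD IH (repsZ (a n) (xf n))) _.
by apply: ae_always => t; rewrite big_ord_recr.
Qed.

End Representatives.

Section Lattice.
Context {R : realType} {E : banach_fun_space R}.
Context (E_ri : rearrangement_invariant E).
Notation P := (@leb01 R).
Implicit Types (x y z : E) (f g h : R -> R).

Lemma reps_ideal y f g : measurable_fun setT g -> reps y f ->
    (\forall t \ae P, `|g t| <= `|f t|) ->
  exists2 x : E, reps x g & `|x| <= `|y|.
Proof.
move=> mg yf gf; have [x [xg xy]] : exists x : E, represents x (mkrv mg) /\ `|x| <= `|y|.
  by apply: E_ri.1; apply: ae_mono (ae_and yf gf) => t [->].
by exists x.
Qed.

Lemma norm_le_of_ae x y f g : measurable_fun setT g -> reps x g -> reps y f ->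
  (\forall t \ae P, `|g t| <= `|f t|) -> `|x| <= `|y|.
Proof.
move=> mg xg yf gf; have [x' x'g] := reps_ideal mg yf gf.
by rewrite (reps_uniq x'g xg).
Qed.

(** For classes of functions, equality of the laws of the absolute values gives
    equality of the rearrangements. *)
Lemma reps_same_law y f g : measurable_fun setT g -> measurable_fun setT f ->
    reps y f -> same_law (fun t => `|g t|) (fun t => `|f t|) ->
  exists2 x : E, reps x g & `|x| = `|y|.
Proof.
move=> mg mf yf gf.
have [x [xg xy]] : exists x : E, represents x (mkrv mg) /\ `|x| = `|y|.
  apply: E_ri.2 => t _; rewrite /rearrangement; congr (ereal_inf (_ @` _)).
  apply/funext => s; rewrite /mkset; congr (_ /\ (_ <= _)%E).
  have E1 (h : R -> R) : [set u | (s < `|h u|)%R] = (fun t => `|h t|) @^-1` `]s, +oo[%classic.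
    by apply/seteqP; split => u /=; rewrite in_itv/= andbT.
  have Eg : P [set u | (s < `|g u|)%R] = P [set u | (s < `|f u|)%R].
    by rewrite (E1 g) (E1 f) gf//; exact: measurable_itv.
  transitivity (P [set u | (s < `|f u|)%R]); first exact: Eg.
  apply: leb01_ae_eq.
  - by apply: (measurable_tail (f := fun t => `|f t|)); exact: measurableT_comp.
  - by apply: (measurable_tail (f := fun t => `|rep y t|)); apply: measurableT_comp => //; exact: measurable_rep.
  - by apply: ae_mono yf => u /= ->.
by exists x.
Qed.

Lemma quantile_ge0 f u : measurable_fun setT f -> (forall t, 0 <= f t) -> 0 <= quantile f u.
Proof.
move=> mf f0; have [u01|u01] := boolP (0 < u < 1); last by rewrite /quantile (negbTE u01).
rewrite leNgt; apply/negP => q0.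
have : u <= cumul f (quantile f u) by rewrite -quantile_le.
rewrite /cumul (_ : mkset _ = set0) ?pr0; first lra.
by apply/seteqP; split => // t /= h; have := f0 t; lra.
Qed.

(** Both functions may be replaced by their decreasing rearrangements, for
    which the comparison of tails is a pointwise inequality. *)
Lemma reps_tail_le y f g : measurable_fun setT g -> measurable_fun setT f -> reps y f ->
    (forall s : R, 0 <= s -> pr [set t | s < `|g t|] <= pr [set t | s < `|f t|]) ->
  exists2 x : E, reps x g & `|x| <= `|y|.
Proof.
move=> mg mf yf gf.
have mag (h : R -> R) : measurable_fun setT h -> measurable_fun setT (fun t => `|h t|).
  by move=> mh; exact: measurableT_comp.
pose qf := quantile (fun t => `|f t|); pose qg := quantile (fun t => `|g t|).
have mqf : measurable_fun setT qf by exact: measurable_quantile (mag _ mf).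
have mqg : measurable_fun setT qg by exact: measurable_quantile (mag _ mg).
have qf0 u : 0 <= qf u by apply: quantile_ge0 => //; exact: mag.
have qg0 u : 0 <= qg u by apply: quantile_ge0 => //; exact: mag.
have qfE : (fun u => `|qf u|) = qf by apply/funext => u; rewrite ger0_norm.
have qgE : (fun u => `|qg u|) = qg by apply/funext => u; rewrite ger0_norm.
have [z zqf zy] : exists2 z : E, reps z qf & `|z| = `|y|.
  by apply: (reps_same_law mqf mf yf); rewrite qfE; exact: quantile_law (mag _ mf).
have [w wqg wz] : exists2 w : E, reps w qg & `|w| <= `|z|.
  apply: (reps_ideal mqg zqf); apply: ae_always => u.
  rewrite !ger0_norm//; apply: quantile_mono; [exact: mag|exact: mag|move=> s].
  have [s0|s0] := leP 0 s; first exact: gf.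
  have T (h : R -> R) : [set t | s < `|h t|] = setT.
    by apply/seteqP; split => // t _ /=; apply: lt_le_trans s0 _.
  by rewrite !T.
have [x xg xw] : exists2 x : E, reps x g & `|x| = `|w|.
  by apply: (reps_same_law mg mqg wqg); rewrite qgE; exact: same_law_sym (quantile_law (mag _ mg)).
by exists x => //; rewrite xw -zy.
Qed.

(** Moving the function to an independent coordinate and cutting it with a
    fair coin splits it into two functions with half of the tail. *)
Lemma reps_tail_le_double y f g : measurable_fun setT g -> measurable_fun setT f -> reps y f ->
  forall k, 
    (forall s : R, 0 <= s -> pr [set t | s < `|g t|] <= 2 ^+ k * pr [set t | s < `|f t|]) ->
  exists2 x : E, reps x g & `|x| <= 2 ^+ k * `|y|.
Proof.
move=> mg mf yf k; elim: k g mg => [|k IH] g mg gf.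
  by rewrite expr0 mul1r; apply: (reps_tail_le mg mf yf) => s s0; have := gf s s0; rewrite expr0 mul1r.
pose cut (c : bool) t := if bit (even_bits t) == c then g (odd_bits t) else 0.
have mcut c : measurable_fun setT (cut c).
  apply: measurable_fun_ifT => //; last exact: (measurableT_comp mg measurable_odd_bits).
  have mb := measurableT_comp (@measurable_fun_bit R) (@measurable_even_bits R).
  by case: c; [under eq_fun do rewrite eqb_id|under eq_fun do rewrite eqbF_neg; exact: measurable_neg].
have cut_tail c s : 0 <= s -> pr [set t | s < `|cut c t|] = 2^-1 * pr [set t | s < `|g t|].
  move=> s0.
  have mgs : measurable [set t | s < `|g t|].
    by apply: (measurable_tail (f := fun t => `|g t|)); exact: measurableT_comp.
  have -> : [set t | s < `|cut c t|] = even_bits @^-1` [set t | bit t = c] `&` odd_bits @^-1` [set t | s < `|g t|].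
    apply/seteqP; split => t; rewrite /cut/=.
      by case: eqP => // _; rewrite normr0 ltNge s0.
    by move=> [-> h]; rewrite eqxx.
  rewrite /pr even_odd_bits_product//; last exact: measurable_bit.
  rewrite fineM ?leb01_fin//; last exact: measurable_bit.
  have fair : P [set t | bit t = c] = (2^-1)%:E.
    have := @bit_doubling R c setT measurableT.
    by rewrite leb01_setT mule1 => <-; congr P; apply/seteqP; split => t /= [].
  by congr (_ * _); rewrite fair.
have step c : exists2 z : E, reps z (cut c) & `|z| <= 2 ^+ k * `|y|.
  apply: (IH _ (mcut c)) => s s0; rewrite cut_tail//.
  by have := gf s s0; rewrite exprS; lra.
have [z0 z0c n0] := step false; have [z1 z1c n1] := step true.
have mgo : measurable_fun setT (g \o odd_bits) by exact: measurableT_comp mg measurable_odd_bits.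
have [x xg xz] : exists2 x : E, reps x g & `|x| = `|z0 + z1|.
  apply: (reps_same_law mg mgo).
    apply: reps_ae (repsD z0c z1c) _; apply: ae_always => t.
    by rewrite /cut/=; case: (bit _); rewrite ?addr0 ?add0r.
  move=> B mB; rewrite -[RHS]/(P (odd_bits @^-1` ((fun t => `|g t|) @^-1` B))).
  rewrite odd_bits_uniform//.
  by apply: (@measurable_preimage _ (fun t => `|g t|)) => //; exact: measurableT_comp.
exists x => //; rewrite xz; apply: le_trans (ler_normD _ _) _.
by rewrite exprS; lra.
Qed.

End Lattice.

(** * Order continuity of the norm *)

Section SmallSets.
Context {R : realType}.
Notation P := (@leb01 R).

Lemma pr_finite_union_le (A : nat -> set R) n : (forall k, measurable (A k)) ->
  pr (\bigcup_(k in [set k | (k < n)%N]) A k) <= \sum_(k < n) pr (A k).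
Proof.
move=> mA; pose S n := \bigcup_(k in [set k | (k < n)%N]) A k.
have mS m : measurable (S m) by apply: bigcup_measurable.
rewrite -/(S n); elim: n => [|n IH].
  by rewrite big_ord0 (_ : S 0%N = set0) ?pr0//; apply/seteqP; split => // t [].
rewrite big_ord_recr/=; apply: (@le_trans _ _ (pr (S n `|` A n))).
  apply: le_pr => //; first exact: measurableU.
  move=> t [k /=]; rewrite ltnS leq_eqVlt => /predU1P[->|kn] Ak; [by right|].
  by left; exists k.
by apply: le_trans (prU_le _ _) _ => //; rewrite lerD2r.
Qed.

Lemma pr_bigcup_le (A : nat -> set R) (b : R) : (forall n, measurable (A n)) ->
  (forall n, \sum_(k < n) pr (A k) <= b) -> pr (\bigcup_n A n) <= b.
Proof.
move=> mA Ab.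
have mU : measurable (\bigcup_n A n) by exact: bigcupT_measurable.
pose S n := \bigcup_(k in [set k | (k < n)%N]) A k.
have mS n : measurable (S n) by apply: bigcup_measurable.
have prS n : pr (S n) <= b by exact: le_trans (pr_finite_union_le n mA) (Ab n).
apply/ler_addgt0Pr => e e0.
have [||t h|//|n hn] := @pr_decreasing_to0 R (fun n => (\bigcup_n A n) `&` ~` S n) _ _ _ e.
- by move=> n; apply: measurableI => //; exact: measurableC.
- move=> n m nm t [At nS]; split => // -[k /= kn Ak]; apply: nS.
  by exists k => //=; exact: leq_trans nm.
- by have [[k _ Ak] _] := h 0%N; have [_] := h k.+1; apply; exists k => /=.
rewrite (pr_split mU (mS n)); apply: lerD; last exact: ltW.
by apply: le_trans (prS n); apply: le_pr => //; apply: measurableI.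
Qed.

Lemma geometric_sum_le (n : nat) : \sum_(k < n) (2^-1 : R) ^+ k <= 2.
Proof.
suff : \sum_(k < n) (2^-1 : R) ^+ k = 2 - 2 * 2^-1 ^+ n.
  by move=> ->; rewrite gerBl mulr_ge0// exprn_ge0// invr_ge0.
elim: n => [|n IH]; first by rewrite big_ord0 expr0; lra.
by rewrite big_ord_recr/= IH exprS; lra.
Qed.

(** Summation of a geometric series. *)
Lemma pr_tail_union (A : nat -> set R) (c : R) (j : nat) : (forall n, measurable (A n)) ->
  (forall n, pr (A n) <= c * 2^-1 ^+ n) ->
  pr (\bigcup_(k in [set k | (j <= k)%N]) A k) <= 2 * c * 2^-1 ^+ j.
Proof.
move=> mA Ac.
have -> : \bigcup_(k in [set k | (j <= k)%N]) A k = \bigcup_k A (j + k)%N.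
  apply/seteqP; split => t [k /= jk Ak]; last by exists (j + k)%N => //=; rewrite leq_addr.
  by exists (k - j)%N => //; rewrite subnKC.
apply: pr_bigcup_le => // n.
have c0 : 0 <= c by have := le_trans (pr_ge0 (A 0%N)) (Ac 0%N); rewrite expr0 mulr1.
have h : \sum_(k < n) pr (A (j + k)%N) <= \sum_(k < n) c * 2^-1 ^+ j * 2^-1 ^+ k.
  by apply: ler_sum => k _; rewrite -mulrA -exprD.
apply: le_trans h _; rewrite -mulr_sumr.
apply: le_trans (ler_wpM2l _ (geometric_sum_le n)) _; last by rewrite mulrC mulrA.
by rewrite mulr_ge0// exprn_ge0// invr_ge0.
Qed.

Lemma half_pow_small (e : R) : 0 < e -> exists n, (2^-1 : R) ^+ n < e.
Proof.
move=> e0.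
have /cvgrPdist_lt/(_ _ e0)[N _ /(_ N (leqnn N))] : 2^-1 ^+ n @[n --> \oo] --> (0 : R).
  by apply: cvg_expr; rewrite ger0_norm ?invr_ge0//; lra.
by rewrite sub0r normrN ger0_norm ?exprn_ge0 ?invr_ge0// => h; exists N.
Qed.

(** The Borel--Cantelli lemma for sets of geometrically decreasing measure. *)
Lemma ae_eventually_outside (A : nat -> set R) (c : R) : (forall n, measurable (A n)) ->
  (forall n, pr (A n) <= c * 2^-1 ^+ n) ->
  \forall t \ae P, exists N, forall n, (N <= n)%N -> ~ A n t.
Proof.
move=> mA Ac.
pose C j := \bigcup_(k in [set k | (j <= k)%N]) A k.
have mC j : measurable (C j) by apply: bigcup_measurable.
have mI : measurable (\bigcap_j C j) by apply: bigcapT_measurable.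
have c0 : 0 <= c by have := le_trans (pr_ge0 (A 0%N)) (Ac 0%N); rewrite expr0 mulr1.
have I0 : pr (\bigcap_j C j) = 0.
  apply/eqP; rewrite eq_le pr_ge0 andbT; apply/ler_addgt0Pr => e e0; rewrite add0r.
  have c1 : 0 < 2 * c + 1 by lra.
  have [n hn] := half_pow_small (divr_gt0 e0 c1).
  have h1 : pr (\bigcap_j C j) <= pr (C n) by apply: le_pr => // t; exact.
  apply: le_trans h1 _; apply: le_trans (pr_tail_union _ mA Ac) _.
  move: hn; rewrite ltr_pdivlMr//.
  have : 0 <= (2^-1 : R) ^+ n by rewrite exprn_ge0// invr_ge0.
  by move: (2^-1 ^+ n) => q; nra.
exists (\bigcap_j C j); split => //; first by rewrite prE// I0.
move=> t /= h j _; apply: contrapT => hC; apply: h; exists j => n jn At.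
by apply: hC; exists n.
Qed.

End SmallSets.

Section OrderContinuity.
Context {R : realType} {E : banach_fun_space R}.
Context (E_ri : rearrangement_invariant E) (E_separable : separable E)
  (E_fatou : fatou_property E).
Notation P := (@leb01 R).
Implicit Types (x y z : E) (f g h : R -> R).

Lemma limn_inf_le (u : nat -> R) (c : R) : (forall n, 0 <= u n) -> (forall n, u n <= c) ->
  limn_inf u <= c.
Proof.
move=> u0 uc.
have bu : bounded_fun u.
  by exists c; split; [exact: num_real|move=> M cM n _; rewrite /= ger0_norm// (le_trans (uc n)) ?ltW].
rewrite limn_infE//; apply: ge_sup; first by exists (infs u 0%N), 0%N.
move=> _ [n _ <-]; apply: le_trans (uc n); apply: ge_inf; last by exists n => /=.
by exists 0 => _ [k _ <-].
Qed.

(** The Fatou property for norms bounded by [c], without the lower limit. *)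
Lemma reps_fatou (x : nat -> E) (f : nat -> R -> R) g (c : R) :
    measurable_fun setT g -> (forall n, reps (x n) (f n)) ->
    (forall n, `|x n| <= c) ->
    (\forall t \ae P, (fun n => f n t) @ \oo --> g t) ->
  exists2 z : E, reps z g & `|z| <= c.
Proof.
move=> mg xf xc fg.
have [||z [zg zx]] := @E_fatou x (mkrv mg).
- have /ae_foralln xf' := xf.
  apply: ae_mono (ae_and xf' fg) => t [h1 h2].
  by rewrite (_ : (fun n => _) = (fun n => f n t))//; apply/funext => n; exact: h1.
- by exists c => _ [n _ <-].
exists z => //; apply: le_trans zx _; exact: limn_inf_le.
Qed.

Definition restr f (A : set R) (t : R) : R := f t * \1_A t.

Lemma measurable_restr f A : measurable_fun setT f -> measurable A ->
  measurable_fun setT (restr f A).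
Proof. by move=> mf mA; apply: measurable_funM => //; exact: measurable_indic. Qed.

Lemma restr_in f A t : A t -> restr f A t = f t.
Proof. by move=> At; rewrite /restr indicE mem_set// mulr1. Qed.

Lemma restr_out f A t : ~ A t -> restr f A t = 0.
Proof. by move=> At; rewrite /restr indicE memNset// mulr0. Qed.

Lemma norm_restr_le f A t : `|restr f A t| <= `|f t|.
Proof.
by have [At|At] := pselect (A t); [rewrite restr_in|rewrite restr_out// normr0].
Qed.

Lemma reps_restr y f A : measurable_fun setT f -> measurable A -> reps y f ->
  exists2 x : E, reps x (restr f A) & `|x| <= `|y|.
Proof.
move=> mf mA yf; apply: (reps_ideal E_ri (measurable_restr mf mA) yf).
by apply: ae_always => t; exact: norm_restr_le.
Qed.

(** In a separable metric space no family indexed by all subsets of the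
    natural numbers is uniformly separated, by Cantor's diagonal argument. *)
Lemma separable_no_separated_powerset (z : set nat -> E) (e : R) : 0 < e ->
  (forall S S' k, S k -> ~ S' k -> e <= `|z S - z S'|) -> False.
Proof.
move=> e0 zS; have [D [cD dD]] := E_separable.
have [F [injF]] : exists F : E -> nat, {in D &, injective F} /\ True.
  by have /countable_injP[F injF] := cD; exists F.
have near S : exists d, D d /\ `|z S - d| < e / 2.
  have [||d [h Dd]] := dD (ball (z S) (e / 2)); last by exists d; move: h; rewrite -ball_normE.
  - by exists (z S); apply: ballxx; lra.
  - exact: ball_open.
move=> _; have [d hd] := choice near.
have dinj S S' k : d S = d S' -> S k -> S' k.
  move=> dd Sk; apply: contrapT => S'k; have := zS _ _ _ Sk S'k.
  have [_ h1] := hd S; have [_ h2] := hd S'; rewrite -dd in h2.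
  have := ler_normD (z S - d S) (d S - z S'); rewrite addrA subrK (distrC (d S)); lra.
(* The diagonal set: [F] codes the dense points injectively by numbers. *)
pose T := [set n | exists S, F (d S) = n /\ ~ S n].
have [TT|nTT] := pselect (T (F (d T))).
- have [S [FS nS]] := TT; apply: nS; apply: dinj TT.
  by apply: injF; rewrite ?inE ?FS//; [exact: (hd T).1|exact: (hd S).1].
- by apply: (nTT); exists T.
Qed.

(** If restrictions of [f] to sets of arbitrarily small measure had norm at
    least [e], the Fatou property would make it possible to choose such sets
    disjoint; the restrictions of [f] to their unions would then form a
    uniformly separated family indexed by the sets of natural numbers. *)
Lemma norm_restr_small y f : measurable_fun setT f -> reps y f -> forall e : R, 0 < e ->
  exists2 d : R, 0 < d & forall A x, measurable A -> pr A < d -> reps x (restr f A) -> `|x| < e.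
Proof.
move=> mf yf e e0; apply: contrapT => Hn.
have /choice[AX hAX] : forall n : nat, exists Ax : set R * E, [/\ measurable Ax.1,
    pr Ax.1 <= 1 * 2^-1 ^+ n, reps Ax.2 (restr f Ax.1) & e <= `|Ax.2|].
  move=> n; apply: contrapT => h; apply: Hn; exists (2^-1 ^+ n).
    by rewrite exprn_gt0// invr_gt0.
  move=> A x mA An xf; rewrite ltNge; apply/negP => ex; apply: h.
  by exists (A, x); split => //=; rewrite mul1r ltW.
pose A n := (AX n).1; pose X n := (AX n).2.
have mA n : measurable (A n) by have [] := hAX n.
have prA n : pr (A n) <= 1 * 2^-1 ^+ n by have [] := hAX n.
have XA n : reps (X n) (restr f (A n)) by have [] := hAX n.
have eX n : e <= `|X n| by have [] := hAX n.
pose C j := \bigcup_(k in [set k | (j <= k)%N]) A k.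
have mC j : measurable (C j) by apply: bigcup_measurable.
have mAC p n : measurable (A p `\` C n) by exact: measurableD.
have hW (pn : nat * nat) : exists w : E, reps w (restr f (A pn.1 `\` C pn.2)).
  by have [w] := reps_restr mf (mAC pn.1 pn.2) yf; exists w.
have [W0 hW0] := choice hW; pose W p n := W0 (p, n).
have WAC p n : reps (W p n) (restr f (A p `\` C n)) by exact: (hW0 (p, n)).
(* By the Fatou property, removing a far enough tail of the sets [A k] from
   [A p] leaves at least half of the norm. *)
have [k p|s [si _ sW]] := @extract_subsequence (fun _ p n => e / 2 <= `|W p n|).
  apply: contrapT => h.
  have Wlt n : `|W p (p.+1 + n)%N| <= e / 2.
    rewrite leNgt; apply/negP => hn; apply: h; exists (p.+1 + n)%N.
    by rewrite leq_addr ltW.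
  have [|z zA ze] := reps_fatou (measurable_restr mf (mA p)) (fun n => WAC p (p.+1 + n)%N) Wlt.
    apply: ae_mono (ae_eventually_outside mA prA) => t [N hN].
    apply: cvg_near_cst; exists N => // n /= Nn.
    have nC : ~ C (p.+1 + n)%N t.
      by move=> [l /= pl]; apply: hN; apply: leq_trans Nn (leq_trans (leq_addl _ _) pl).
    have [At|At] := pselect (A p t); first by rewrite !restr_in//.
    by rewrite !restr_out// => -[].
  have := eX p; rewrite (reps_uniq (XA p) zA); lra.
pose B k := A (s k) `\` C (s k.+1).
have mB k : measurable (B k) by exact: mAC.
have tB k l : (k < l)%N -> B k `&` B l = set0.
  move=> kl; apply/seteqP; split => // t [[_ nC] [Al _]]; apply: nC.
  by exists (s l) => //=; rewrite increasing_seq_leq.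
have disj t k l : B k t -> B l t -> k = l.
  move=> Bk Bl; have [kl|lk|//] := ltngtP k l.
    by have : (B k `&` B l) t by []; rewrite tB.
  by have : (B l `&` B k) t by []; rewrite tB.
pose U (S : set nat) := \bigcup_(k in S) B k.
have mU S : measurable (U S) by apply: bigcup_measurable.
have hZ S : exists z : E, reps z (restr f (U S)).
  by have [z] := reps_restr mf (mU S) yf; exists z.
have [Z ZU] := choice hZ.
have e2 : 0 < e / 2 by lra.
apply: (separable_no_separated_powerset (z := Z) e2) => S S' k Sk S'k.
apply: le_trans (sW k) _.
apply: (norm_le_of_ae E_ri _ (WAC _ _) (repsB (ZU S) (ZU S'))); first exact: measurable_restr.
apply: ae_always => t; have [Bt|Bt] := pselect (B k t); last by rewrite restr_out// normr0.
rewrite restr_in// restr_in; last by exists k.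
by rewrite restr_out ?subr0// => -[l S'l Bl]; apply: S'k; rewrite (disj _ _ _ Bt Bl).
Qed.

End OrderContinuity.

(** * Sequences with disjoint and with nearly disjoint supports *)

Section Disjoint.
Context {R : realType}.
Notation P := (@leb01 R).
Implicit Types (f g h : nat -> R -> R) (a : nat -> R).

Definition disjoint f := forall i j t, i != j -> f i t = 0 \/ f j t = 0.

Lemma measurable_abs_tail (q : R -> R) (s : R) : measurable_fun setT q ->
  measurable [set t | s < `|q t|].
Proof.
by move=> mq; apply: (measurable_tail (f := fun t => `|q t|)); exact: measurableT_comp.
Qed.

Lemma measurable_lin_comb n a f : (forall k, measurable_fun setT (f k)) ->
  measurable_fun setT (fun t => \sum_(k < n) a k * f k t).
Proof. by move=> mf; apply: measurable_sum => k; apply: measurable_funM. Qed.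

Lemma disjoint_sum_tail f a n (s : R) : (forall k, measurable_fun setT (f k)) ->
    disjoint f -> 0 <= s ->
  pr [set t | s < `|\sum_(k < n) a k * f k t|] = \sum_(k < n) pr [set t | s < `|a k * f k t|].
Proof.
move=> mf df s0; elim: n => [|n IH].
  rewrite big_ord0 (_ : mkset _ = set0) ?pr0//; apply/seteqP; split => // t /=.
  by rewrite big_ord0 normr0 ltNge s0.
rewrite big_ord_recr/= -IH.
pose S t := \sum_(k < n) a k * f k t.
have SD t : S t = 0 \/ f n t = 0.
  have [fn|fn] := eqVneq (f n t) 0; first by right.
  left; apply: big1 => k _; have [->|/eqP] := df k n t (negbT (ltn_eqF (ltn_ord k))); first by rewrite mulr0.
  by rewrite (negbTE fn).
have mS : measurable_fun setT S by exact: measurable_lin_comb.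
have mn : measurable_fun setT (fun t => a n * f n t) by exact: measurable_funM.
have mT : measurable [set t | s < `|\sum_(k < n.+1) a k * f k t|].
  by apply: measurable_abs_tail; exact: measurable_lin_comb.
rewrite (pr_split mT (measurable_abs_tail s mS)); congr (pr _ + pr _); apply/seteqP; split => t /=;
  rewrite big_ord_recr/= -/(S t).
- by case.
- by move=> st; split => //; have [S0|->] := SD t; [move: st; rewrite S0 normr0 ltNge s0|rewrite mulr0 addr0].
- by move=> [+ nS]; have [->|->] := SD t; [rewrite add0r|rewrite mulr0 addr0 => /nS].
- move=> st; have [S0|f0] := SD t; last by move: st; rewrite f0 mulr0 normr0 ltNge s0.
  by rewrite S0 add0r; split => //; rewrite normr0 ltNge s0.
Qed.

Context {E : banach_fun_space R}.
Context (E_ri : rearrangement_invariant E).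

(** The norm of a disjoint sum is controlled by the tails of its terms, since
    the tail of the sum is the sum of the tails. *)
Lemma disjoint_sum_norm_le m f g (x y : nat -> E) a n :
    (forall k, measurable_fun setT (f k)) -> (forall k, measurable_fun setT (g k)) ->
    disjoint f -> disjoint g ->
    (forall k, reps (x k) (f k)) -> (forall k, reps (y k) (g k)) ->
    (forall k s, 0 <= s -> pr [set t | s < `|g k t|] <= 2 ^+ m * pr [set t | s < `|f k t|]) ->
  `|\sum_(k < n) a k *: y k| <= 2 ^+ m * `|\sum_(k < n) a k *: x k|.
Proof.
move=> mf mg df dg xf yg gf.
have [|z zg zx] := reps_tail_le_double E_ri (measurable_lin_comb n a mg)
    (measurable_lin_comb n a mf) (reps_sum n a xf) (k := m).
  move=> s s0; rewrite !disjoint_sum_tail// mulr_sumr; apply: ler_sum => k _.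
  have scale (q : R -> R) : [set t | s < `|a k * q t|] =
      if a k == 0 then set0 else [set t | s / `|a k| < `|q t|].
    have [->|ak] := eqVneq (a k) 0.
      by apply/seteqP; split => t //=; rewrite mul0r normr0 ltNge s0.
    apply/seteqP; split => t /=; by rewrite normrM ltr_pdivrMr ?normr_gt0// mulrC.
  rewrite !scale; case: ifP => _; first by rewrite !pr0 mulr0.
  by apply: gf; rewrite divr_ge0.
by rewrite (reps_uniq (reps_sum n a yg) zg).
Qed.

(** Each representative is cut to the complement of the supports of the earlier
    ones, which changes it only on a null set. *)
Lemma disjoint_representatives (x : nat -> E) : pairwise_disjoint (fun n => rep (x n)) ->
  exists f : nat -> R -> R, [/\ forall k, measurable_fun setT (f k),
    forall k, reps (x k) (f k) & disjoint f].
Proof.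
move=> dx.
pose A k := [set t | (0 : R) < `|rep (x k) t|].
have mA k : measurable (A k) by apply: measurable_abs_tail; exact: measurable_rep.
pose C k := \bigcup_(j in [set j | (j < k)%N]) A j.
have mC k : measurable (~` C k) by apply: measurableC; apply: bigcup_measurable.
exists (fun k => restr (rep (x k)) (~` C k)); split => [k|k|].
- exact: (measurable_restr (measurable_rep (x k)) (mC k)).
- have h : \forall t \ae P, forall j, j != k -> rep (x j) t = 0 \/ rep (x k) t = 0.
    apply: ae_foralln => j; have [->|jk] := eqVneq j k; first exact: ae_always.
    by apply: ae_mono (dx j k jk) => t ? _.
  apply: ae_mono h => t ht; have [Ct|Ct] := pselect (C k t); last by rewrite restr_in.
  rewrite restr_out; last by move=> /(_ Ct).
  by have [j /= jk] := Ct; rewrite /A/= normr_gt0; have [|->|//] := ht j; rewrite ?eqxx// ltn_eqF.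
- have lt i j t : (i < j)%N -> restr (rep (x i)) (~` C i) t = 0 \/ restr (rep (x j)) (~` C j) t = 0.
    move=> ij; have [Ct|Ct] := pselect (C j t); first by right; rewrite restr_out// => /(_ Ct).
    left; have [xi|xi] := eqVneq (rep (x i) t : R) 0; first by rewrite /restr xi mul0r.
    by exfalso; apply: Ct; exists i => //; rewrite /A/= normr_gt0.
  move=> i j t; rewrite neq_ltn => /orP[ij|ji]; first exact: lt.
  by have [] := lt j i t ji; [right|left].
Qed.

(** A diagonal minimum: [D p] serves all the tolerances [d m i] with both indices at
    most [p]. *)
Lemma positive_lower_bounds (d : nat -> nat -> R) : (forall m i, 0 < d m i) ->
  exists D : nat -> R, forall p, [/\ 0 < D p, D p <= 1 &
    forall m i, (m <= p)%N -> (i <= p)%N -> D p <= d m i].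
Proof.
move=> d0; exists (fun p => \big[Num.min/1]_(mi : 'I_p.+1 * 'I_p.+1) d mi.1 mi.2) => p; split.
- by apply: lt_bigmin => // mi _.
- exact: bigmin_le_id.
- move=> m i; rewrite -ltnS => mp; rewrite -ltnS => ip.
  exact: (bigmin_le 1 (Ordinal mp, Ordinal ip) (fun mi : 'I_p.+1 * 'I_p.+1 => d mi.1 mi.2)).
Qed.

Context (E_separable : separable E) (E_fatou : fatou_property E).

(** The norms of the pieces that are cut off are small by order continuity,
    once the measures of the supports decrease fast enough along the chosen
    subsequence. *)
Lemma nearly_disjoint_subsequence (y : nat -> E) h (A : nat -> set R) (e : R) :
    (forall k, measurable_fun setT (h k)) -> (forall k, measurable (A k)) ->
    (forall k, reps (y k) (h k)) -> (forall k t, ~ A k t -> h k t = 0) ->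
    (forall d : R, 0 < d -> exists N, forall n, (N <= n)%N -> pr (A n) < d) -> 0 < e ->
  exists s (z : nat -> E), 
    let B k := ~` \bigcup_j A (s (k.+1 + j)%N) in
    [/\ increasing_seq s, forall k, pr (A (s k)) <= 4^-1 * 2^-1 ^+ k,
      forall k, reps (z k) (restr (h (s k)) (B k)),
      disjoint (fun k => restr (h (s k)) (B k)) &
      forall k, `|y (s k) - z k| <= e * 2^-1 ^+ k].
Proof.
move=> mh mA yh hA A0 e0.
have pow0 k : 0 < (2^-1 : R) ^+ k by rewrite exprn_gt0// invr_gt0.
have hd (ni : nat * nat) : exists d : R, 0 < d /\ forall C (x : E), measurable C -> pr C < d ->
    reps x (restr (h ni.1) C) -> `|x| < e * 2^-1 ^+ ni.2.
  have [d d0 hd] := norm_restr_small E_ri E_separable E_fatou (mh ni.1) (yh ni.1) (mulr_gt0 e0 (pow0 ni.2)).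
  by exists d; split=> //; exact: hd.
have [d0 hd0] := choice hd; pose d n i := d0 (n, i).
have [D hD] := positive_lower_bounds (fun m i => (hd0 (m, i)).1 : 0 < d m i).
(* The factor [4^-1] makes the later supports cover at most half of any
   independent event, after summation of the geometric series. *)
have [k p|s [si s0 sS]] := @extract_subsequence (fun k p n => pr (A n) <= 4^-1 * D p * 2^-1 ^+ k).
  have [Dp _ _] := hD p.
  have [|N hN] := A0 (4^-1 * D p * 2^-1 ^+ k); first by rewrite !mulr_gt0// invr_gt0.
  exists (maxn N p.+1); split; first exact: leq_maxr.
  by apply: ltW; apply: hN; exact: leq_maxl.
have sle i j : (i <= j)%N -> (s i <= s j)%N by rewrite increasing_seq_leq.
pose U k := \bigcup_j A (s (k.+1 + j)%N).
have mU k : measurable (U k) by apply: bigcupT_measurable.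
have U_small k : pr (U k) < d (s k) k.
  have dk : 0 < d (s k) k by exact: (hd0 (s k, k)).1.
  have := @pr_tail_union R (fun j => A (s (k.+1 + j)%N)) (4^-1 * d (s k) k) 0%N.
  rewrite (_ : \bigcup_(_ in _) _ = U k); last by apply/seteqP; split => t [j _ Aj]; exists j.
  rewrite expr0 mulr1 => h1; apply: le_lt_trans (h1 _ _) _ => //; last lra.
  move=> j; rewrite addSn; apply: le_trans (sS _) _.
  have [Dp _ Dd] := hD (s (k + j)%N).
  have h2 : D (s (k + j)%N) <= d (s k) k.
    apply: Dd; first by apply: sle; rewrite leq_addr.
    by apply: leq_trans (increasing_seq_geq _ si); rewrite leq_addr.
  have h3 : (2^-1 : R) ^+ (k + j).+1 <= 2^-1 ^+ j.
    by apply: ler_wiXn2l; [lra|lra|rewrite -addSn leq_addl].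
  rewrite -!mulrA ler_wpM2l ?invr_ge0//; apply: ler_pM => //; first exact: ltW.
have hw k : exists w : E, reps w (restr (h (s k)) (U k)).
  by have [w] := reps_restr E_ri (mh (s k)) (mU k) (yh (s k)); exists w.
have [w hw'] := choice hw.
exists s, (fun k => y (s k) - w k); split => //.
- case=> [|k]; [apply: le_trans s0 _; have [D0 D1 _] := hD 0%N|apply: le_trans (sS k) _; have [D0 D1 _] := hD (s k)];
  by rewrite ler_wpM2r ?exprn_ge0 ?invr_ge0//; lra.
- move=> k; apply: reps_ae (repsB (yh (s k)) (hw' k)) _; apply: ae_always => t.
  have [Ut|Ut] := pselect (U k t); first by rewrite restr_in// restr_out ?subrr// => /(_ Ut).
  by rewrite restr_out// subr0 restr_in.
- have lt i j t : (i < j)%N -> restr (h (s i)) (~` U i) t = 0 \/ restr (h (s j)) (~` U j) t = 0.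
    move=> ij; have [At|At] := pselect (A (s j) t).
      left; rewrite restr_out// => h1; apply: h1; exists (j - i.+1)%N => //.
      by rewrite subnKC.
    by right; rewrite /restr (hA _ _ At) mul0r.
  move=> i j t; rewrite neq_ltn => /orP[ij|ji]; first exact: lt.
  by have [] := lt j i t ji; [right|left].
- by move=> k; rewrite subKr ltW//; apply: (hd0 (s k, k)).2 (mU k) (U_small k) (hw' k).
Qed.

End Disjoint.

(** * Averages of bounded independent identically distributed variables *)

Section Averages.
Context {R : realType}.
Notation Om := (measurableTypeR R).
Notation P := (@leb01 R).
Implicit Types (f g : R -> R).

Lemma indep_pair (X : nat -> R -> R) i j (B C : set R) : indep X -> i != j ->
  measurable B -> measurable C ->
  P (X i @^-1` B `&` X j @^-1` C) = (P (X i @^-1` B) * P (X j @^-1` C))%E.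
Proof.
move=> iX ij mB mC.
have := iX [fset i; j]%fset (fun k => if k == i then B else C).
rewrite big_fsetU1/= ?big_seq_fset1/=; last by rewrite inE.
rewrite eqxx eq_sym (negbTE ij) => <-; last by move=> n; case: ifP.
congr P; apply/seteqP; split => t /=.
  by move=> [Bt Ct] k /=; rewrite !inE => /orP[/eqP->|/eqP->]; rewrite ?eqxx// eq_sym (negbTE ij).
move=> h; split; first by have := h i; rewrite /= eqxx; apply; rewrite !inE eqxx.
by have := h j; rewrite /= eq_sym (negbTE ij); apply; rewrite !inE eqxx orbT.
Qed.

Definition bounded_measurable f := measurable_fun setT f /\ exists M : R, forall t, `|f t| <= M.

Lemma bounded_measurableD f g : bounded_measurable f -> bounded_measurable g ->
  bounded_measurable (fun t => f t + g t).
Proof.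
move=> [mf [M hM]] [mg [N hN]]; split; first exact: measurable_funD.
by exists (M + N) => t; apply: le_trans (ler_normD _ _) (lerD _ _).
Qed.

Lemma bounded_measurableM f g : bounded_measurable f -> bounded_measurable g ->
  bounded_measurable (fun t => f t * g t).
Proof.
move=> [mf [M hM]] [mg [N hN]]; split; first exact: measurable_funM.
by exists (M * N) => t; rewrite normrM ler_pM.
Qed.

Lemma bounded_measurable_cst (c : R) : bounded_measurable (fun=> c).
Proof. by split => //; exists `|c|. Qed.

Lemma bounded_measurable_comp f g : bounded_measurable f -> measurable_fun setT g ->
  bounded_measurable (f \o g).
Proof. by move=> [mf [M hM]] mg; split; [exact: measurableT_comp|exists M => t /=]. Qed.

Definition expect f : R := Rintegral P setT f.

Lemma bounded_measurable_integrable f : bounded_measurable f ->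
  P.-integrable setT (EFin \o (f : Om -> R)).
Proof.
move=> [mf [M hM]]; apply: measurable_bounded_integrable => //.
  exact: leb01_lty.
by exists M; split; [exact: num_real|move=> N MN t _ /=; apply: le_trans (hM t) (ltW MN)].
Qed.

Lemma expectD f g : bounded_measurable f -> bounded_measurable g ->
  expect (fun t => f t + g t) = expect f + expect g.
Proof.
move=> bf bg; apply: (RintegralD (mu := P)) => //; exact: bounded_measurable_integrable.
Qed.

Lemma expectZ (c : R) f : bounded_measurable f -> expect (fun t => c * f t) = c * expect f.
Proof. by move=> bf; apply: (RintegralZl (mu := P)) => //; exact: bounded_measurable_integrable. Qed.

Lemma expect_cst (c : R) : expect (fun=> c) = c.
Proof.
rewrite /expect (@Rintegral_cst _ _ _ P)//.
by rewrite -[X in _ * X]/(pr setT) prT mulr1.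
Qed.

Lemma expect_le f g : bounded_measurable f -> bounded_measurable g ->
  (forall t, f t <= g t) -> expect f <= expect g.
Proof.
move=> bf bg fg; apply: (le_Rintegral (mu := P)) => //; exact: bounded_measurable_integrable.
Qed.

(** The pair [(unif i, unif j)] transports the measure to the product measure, where
    the formula is Fubini's theorem. *)
Lemma expect_unif_prod i j f g : i != j -> bounded_measurable f -> bounded_measurable g ->
  expect (fun t => f (unif i t) * g (unif j t)) = expect f * expect g.
Proof.
move=> ij bf bg.
pose phi (t : Om) : Om * Om := (unif i t, unif j t).
have mphi : measurable_fun setT phi.
  by apply: measurable_fun_pair; exact: measurable_unif.
pose F (z : Om * Om) : \bar R := (f z.1 * g z.2)%:E.
have mF : measurable_fun setT F.
  apply/measurable_EFinP; apply: measurable_funM.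
    by apply: (measurableT_comp bf.1); exact: measurable_fst.
  by apply: (measurableT_comp bg.1); exact: measurable_snd.
have bfg : bounded_measurable (fun t => f (unif i t) * g (unif j t)).
  by apply: bounded_measurableM; apply: (bounded_measurable_comp (f := f)) || apply: (bounded_measurable_comp (f := g)); 
    rewrite //; exact: measurable_unif.
have iF : (P \x P)%E.-integrable setT F.
  apply: measurable_bounded_integrable => //.
  - have -> : [set: Om * Om] = setT `*` setT by rewrite setXTT.
    apply: (@le_lt_trans _ _ (P setT * P setT)%E); last by rewrite leb01_setT mule1 ltry.
    by have := (@product_measure1E _ _ _ _ _ P P setT setT measurableT measurableT) => <-.
  - by apply/measurable_EFinP.
  - have [M1 hM1] := bf.2; have [M2 hM2] := bg.2.
    exists (M1 * M2); split; first exact: num_real.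
    by move=> N MN z _ /=; apply: le_trans (ltW MN); rewrite normrM ler_pM.
have E1 : expect (fun t => f (unif i t) * g (unif j t)) = fine (\int[(P \x P)%E]_z F z)%E.
  rewrite /expect /Rintegral; congr fine.
  transitivity (\int[pushforward P phi]_z F z)%E.
    rewrite (@integral_pushforward _ _ _ _ _ phi mphi P setT F) //.
    exact: bounded_measurable_integrable bfg.
  apply: eq_measure_integral => A mA _; symmetry.
  apply: (product_measure_unique (m1 := P) (m2 := P)) => // B C mB mC.
  have := indep_pair (@indep_unif R) ij mB mC; rewrite !unif_uniform//; exact.
rewrite E1 -integral12_prod_meas1//.
transitivity (fine (\int[P]_x ((expect g * f x)%:E))%E); last first.
  by rewrite mulrC; exact: (expectZ (expect g) bf).
congr fine; apply: eq_integral => x _; rewrite /fubini_F /F /=.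
have := expectZ (f x) bg; rewrite mulrC => <-; rewrite /expect /Rintegral fineK//.
apply: integrable_fin_num => //; apply: bounded_measurable_integrable.
by apply: bounded_measurableM => //; exact: bounded_measurable_cst.
Qed.

End Averages.

Section LawOfLargeNumbers.
Context {R : realType}.
Notation P := (@leb01 R).
Implicit Types (f g : R -> R).

Lemma expect_indic (A : set R) : measurable A -> expect (\1_A : R -> R) = pr A.
Proof.
move=> mA; rewrite /expect /Rintegral /pr; congr fine.
have h : (\int[P]_x (\1_A x)%:E)%E = P (A `&` setT) by exact: (integral_indic P measurableT mA).
by rewrite h setIT.
Qed.

Lemma bounded_measurable_indic (A : set R) : measurable A -> bounded_measurable (\1_A : R -> R).
Proof.
move=> mA; split; first exact: measurable_indic.
by exists 1 => t; rewrite indicE; case: (_ \in _); rewrite ?normr1 ?normr0.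
Qed.

Lemma chebyshev_le f (d : R) : bounded_measurable f -> 0 < d ->
  pr [set t | d < `|f t|] <= d ^- 2 * expect (fun t => f t * f t).
Proof.
move=> bf d0; have mA := measurable_abs_tail d bf.1.
have bff := bounded_measurableM bf bf.
rewrite mulrC ler_pdivlMr ?exprn_gt0// mulrC -expect_indic// -expectZ; last exact: bounded_measurable_indic.
apply: expect_le => //.
  by apply: bounded_measurableM; [exact: bounded_measurable_cst|exact: bounded_measurable_indic].
move=> t; rewrite indicE; case: (boolP (t \in _)) => [|_]; last by rewrite mulr0 -expr2 sqr_ge0.
rewrite inE/= mulr1 => dt; rewrite -expr2 -[leRHS]real_normK ?num_real//.
by rewrite ler_sqr ?nnegrE// ltW.
Qed.

Lemma bounded_measurable_sum n (h : nat -> R -> R) : (forall i, bounded_measurable (h i)) ->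
  bounded_measurable (fun t => \sum_(i < n) h i t).
Proof.
move=> bh; elim: n => [|n IH].
  by under eq_fun do rewrite big_ord0; exact: bounded_measurable_cst.
under eq_fun do rewrite big_ord_recr/=; exact: bounded_measurableD.
Qed.

Lemma expect_sum_orthogonal n (h : nat -> R -> R) g : (forall i, bounded_measurable (h i)) ->
    bounded_measurable g -> (forall i, (i < n)%N -> expect (fun t => h i t * g t) = 0) ->
  expect (fun t => (\sum_(i < n) h i t) * g t) = 0.
Proof.
move=> bh bg; elim: n => [|n IH] h0.
  by under eq_fun do rewrite big_ord0 mul0r; exact: expect_cst.
under eq_fun do rewrite big_ord_recr/= mulrDl.
rewrite expectD ?IH ?h0 ?addr0//.
- by move=> i hi; apply: h0; exact: leqW.
- by apply: bounded_measurableM => //; exact: bounded_measurable_sum.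
- exact: bounded_measurableM.
Qed.

(** The cross terms vanish, because the variables are independent with mean zero. *)
Lemma second_moment_le f (M : R) (j : nat -> nat) n : bounded_measurable f ->
    (forall t, `|f t| <= M) -> expect f = 0 -> injective j ->
  expect (fun t => (\sum_(i < n) f (unif (j i) t)) * (\sum_(i < n) f (unif (j i) t))) <= n%:R * M ^+ 2.
Proof.
move=> bf fM f0 ij.
have bh i : bounded_measurable (fun t => f (unif (j i) t)).
  by apply: (bounded_measurable_comp bf); exact: measurable_unif.
have bS n' := bounded_measurable_sum n' bh.
elim: n => [|n IH].
  by under eq_fun do rewrite big_ord0 mul0r; rewrite expect_cst mul0r.
pose S t := \sum_(i < n) f (unif (j i) t); pose Z t := f (unif (j n) t).
rewrite (_ : (fun t => _) = (fun t => S t * S t + (2 * (S t * Z t) + Z t * Z t))); last first.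
  by apply/funext => t; rewrite !big_ord_recr/= -/(S t) -/(Z t); ring.
have bZ : bounded_measurable Z by exact: bh.
have bSS : bounded_measurable (fun t => S t * S t) by exact: bounded_measurableM (bS n) (bS n).
have bSZ : bounded_measurable (fun t => S t * Z t) by exact: bounded_measurableM (bS n) bZ.
have b2SZ : bounded_measurable (fun t => 2 * (S t * Z t)).
  by apply: bounded_measurableM => //; exact: bounded_measurable_cst.
have bZZ := bounded_measurableM bZ bZ.
have SZ0 : expect (fun t => S t * Z t) = 0.
  apply: (@expect_sum_orthogonal n (fun i t => f (unif (j i) t)) Z) => // i lt_in.
  rewrite expect_unif_prod ?f0 ?mul0r//.
  by apply/eqP => /ij Ein; rewrite Ein ltnn in lt_in.
rewrite expectD//; last exact: bounded_measurableD.
rewrite expectD// expectZ// SZ0.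
rewrite mulr0 add0r -natr1 mulrDl mul1r lerD//.
rewrite -(expect_cst (M ^+ 2)); apply: expect_le => //; first exact: bounded_measurable_cst.
have M0 : 0 <= M by apply: le_trans (fM 0).
by move=> t; rewrite /Z -expr2 -real_normK ?num_real// ler_sqr ?nnegrE.
Qed.

Context {E : banach_fun_space R}.
Context (E_ri : rearrangement_invariant E) (E_separable : separable E)
  (E_fatou : fatou_property E).

(** The weak law of large numbers in the norm of [E]: averages of bounded
    variables converge in measure by the Chebyshev inequality and stay bounded,
    so order continuity of the norm applies to the constant [1]. *)
Lemma average_norm_small (one : E) f : reps one (fun=> 1) -> bounded_measurable f ->
  forall e : R, 0 < e -> exists2 N, (0 < N)%N & forall (j : nat -> nat) (w : E), injective j ->
    reps w (fun t => N%:R^-1 * (\sum_(i < N) f (unif (j i) t)) - expect f) -> `|w| <= e.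
Proof.
move=> one1 bf e e0; pose c := expect f.
pose g t := f t - c.
have bg : bounded_measurable g by apply: bounded_measurableD => //; exact: bounded_measurable_cst.
have g0 : expect g = 0.
  by rewrite /g expectD// ?expect_cst ?subrr//; exact: bounded_measurable_cst.
have [M gM] := bg.2.
have M0 : 0 <= M by apply: le_trans (gM 0).
have [d d0 hd] := norm_restr_small E_ri E_separable E_fatou
  (@measurable_cst _ _ R R setT (1:R)) one1 (ltac:(rewrite divr_gt0//; lra) : 0 < e / (2 * (M + 1))).
(* Values below [eta] contribute [eta * `|one|], which is at most [e / 2]. *)
pose eta := e / (2 * (`|one| + 1)).
have eta0 : 0 < eta by rewrite divr_gt0//; have := normr_ge0 one; lra.
pose N := (Num.bound (eta ^- 2 * M ^+ 2 / d)).+1.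
exists N => // j w ij wN.
pose S t := \sum_(i < N) g (unif (j i) t).
have bS : bounded_measurable S.
  apply: (@bounded_measurable_sum N (fun i t => g (unif (j i) t))) => i.
  by apply: (bounded_measurable_comp bg); exact: measurable_unif.
have N0 : 0 < N%:R :> R by rewrite ltr0n.
pose h t := N%:R^-1 * S t.
have bh : bounded_measurable h by apply: bounded_measurableM => //; exact: bounded_measurable_cst.
have wh : reps w h.
  apply: reps_ae wN _; apply: ae_always => t; rewrite /h /S /g sumrB sumr_const card_ord.
  by rewrite mulrBr -[c *+ N]mulr_natl mulKf// gt_eqF.
have hM t : `|h t| <= M.
  rewrite /h normrM ger0_norm ?invr_ge0 ?ler0n// ler_pdivrMl//.
  apply: le_trans (ler_norm_sum _ _ _) _.
  by apply: le_trans (ler_sum _ (fun i _ => gM _)) _; rewrite sumr_const card_ord mulr_natl.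
pose A := [set t | eta < `|h t|].
have mA : measurable A by exact: measurable_abs_tail bh.1.
have Ad : pr A < d.
  apply: le_lt_trans (chebyshev_le bh eta0) _.
  have -> : expect (fun t => h t * h t) = N%:R ^- 2 * expect (fun t => S t * S t).
    rewrite -expectZ; last exact: bounded_measurableM.
    by congr expect; apply/funext => t; rewrite /h -exprVn; ring.
  have h1 := second_moment_le N bg gM g0 ij.
  have h2 : eta ^- 2 * M ^+ 2 / d < N%:R.
    apply: lt_le_trans (archi_boundP _) _; last by rewrite ler_nat.
    by rewrite !mulr_ge0// ?invr_ge0 ?exprn_ge0// ltW.
  rewrite ltr_pdivrMr// in h2.
  apply: (@le_lt_trans _ _ (eta ^- 2 * (N%:R ^- 2 * (N%:R * M ^+ 2)))).
    have eta20 : 0 <= eta ^- 2 by rewrite invr_ge0 exprn_ge0// ltW.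
    have N20 : 0 <= (N%:R : R) ^- 2 by rewrite invr_ge0 exprn_ge0.
    by apply: (ler_wpM2l eta20); apply: (ler_wpM2l N20).
  rewrite mulrCA [X in _ < X](_ : d = N%:R ^- 2 * (N%:R * (N%:R * d))); last first.
    by rewrite (mulrA N%:R) -expr2 mulKf// gt_eqF// exprn_gt0.
  by rewrite ltr_pM2l ?invr_gt0 ?exprn_gt0// mulrCA ltr_pM2l.
have [oA oAr _] := reps_restr E_ri (@measurable_cst _ _ R R setT (1:R)) mA one1.
have oAs := hd _ _ mA Ad oAr.
have wle : `|w| <= `|eta *: one + M *: oA|.
  apply: (norm_le_of_ae E_ri bh.1 wh (repsD (repsZ eta one1) (repsZ M oAr))).
  apply: ae_always => t; rewrite mulr1 [leRHS]ger0_norm; last first.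
    apply: addr_ge0; first exact: ltW.
    by apply: mulr_ge0 => //; rewrite /restr /= mul1r indicE ler0n.
  have [At|At] := pselect (A t).
    by rewrite restr_in//= mulr1; apply: le_trans (hM t) _; rewrite lerDr ltW.
  by rewrite restr_out// mulr0 addr0 leNgt; apply/negP.
apply: le_trans wle _; apply: le_trans (ler_normD _ _) _.
have -> : `|eta *: one| = eta * `|one| by rewrite normrZ gtr0_norm.
have -> : `|M *: oA| = M * `|oA| by rewrite normrZ ger0_norm.
have frac (r : R) : 0 <= r -> e / (2 * (r + 1)) * r <= e / 2.
  by move=> r0; rewrite mulrAC ler_pdivrMr; [nra|lra].
have h1 : eta * `|one| <= e / 2 by apply: frac.
have h2 : M * `|oA| <= e / 2.
  by apply: le_trans (ler_wpM2l M0 (ltW oAs)) _; rewrite mulrC; exact: frac.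
by lra.
Qed.

End LawOfLargeNumbers.

(** * Convergence of quantile functions *)

Section Selection.
Context {R : realType}.
Notation P := (@leb01 R).

Definition monotone01 (q : R -> R) := forall u v, 0 < u -> u <= v -> v < 1 -> q u <= q v.

(** Pointwise bounded sequences of functions have a cluster point for pointwise
    convergence, by compactness of products of segments. *)
Lemma pointwise_cluster_point (q : nat -> R -> R) (C : R -> R) :
    (forall n u, `|q n u| <= C u) ->
  exists Q : R -> R, forall (us : seq R) (e : R) N, 0 < e ->
    exists2 n, (N <= n)%N & forall u, u \in us -> `|q n u - Q u| < e.
Proof.
move=> qC.
have := @tychonoff R (fun=> R) (fun u => `[- C u, C u]%classic) (fun u => @segment_compact R _ _).
move=> /(_ ((q n : prod_topology (fun _ : R => R)) @[n --> \oo]) _)[|Q [_ clQ]].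
  by exists 0%N => // n _ u /=; rewrite in_itv/= -ler_norml.
exists Q => us e N e0.
pose Q' : prod_topology (fun _ : R => R) := Q.
have nb1 u : nbhs Q' [set g | `|g u - Q u| < e].
  have pc : {for Q', continuous (fun g : prod_topology (fun _ : R => R) => (g u : R))}.
    exact: (@proj_continuous R (fun=> R) u Q').
  have := pc _ (nbhsx_ballx (Q u : R) e e0).
  have -> : [set g | `|g u - Q u| < e] = (fun g : prod_topology (fun _ : R => R) => (g u : R)) @^-1` ball (Q u : R) e.
    by apply/seteqP; split => g /=; rewrite -ball_normE /= distrC.
  exact.
have FQ : Filter (nbhs Q') := nbhs_filter Q'.
have nbB : nbhs Q' [set g | forall u, u \in us -> `|g u - Q u| < e].
  elim: us => [|u us IH]; first exact: (@filterE _ _ FQ).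
  apply: (@filterS _ _ FQ _ _ _ (@filterI _ _ FQ _ _ (nb1 u) IH)) => g [gu gus] v.
  by rewrite inE => /orP[/eqP ->//|]; exact: gus.
pose A : set (R -> R) := [set g | exists2 n, (N <= n)%N & g = q n].
pose B : set (prod_topology (fun _ : R => R)) := [set g | forall u, u \in us -> `|g u - Q u| < e].
have [||g [[n Nn ->] gB]] := clQ A B; last by exists n.
- by exists N => // n /= Nn; exists n.
exact: nbB.
Qed.

Lemma pr_segment_le (a b : R) : 0 <= a -> a < b -> b <= 1 -> pr `[a, b]%classic <= b - a.
Proof.
move=> a0 ab b1; rewrite /pr (@leb01_itv _ true false a b)// => t /=; rewrite in_itv/=.
by split => [[]//|/andP[h1 h2]]; split; [apply/andP|lra].
Qed.

Lemma pr_outside_le (d : R) : 0 < d -> d < 2^-1 ->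
  pr (~` `[d, 1 - d]%classic) <= 2 * d.
Proof.
have mI : measurable (`[d, 1 - d]%classic : set R) by exact: measurable_itv.
move=> d0 d1; rewrite prC//.
suff -> : pr `[d, 1 - d]%classic = 1 - d - d by lra.
rewrite /pr (@leb01_itv _ true false d (1 - d))//; first lra.
by move=> t /=; rewrite in_itv/=; split => [[]//|/andP[h1 h2]]; split; [apply/andP|lra].
Qed.

Lemma grid_interval (t : nat -> R) n u : t 0%N <= u <= t n.+1 ->
  exists2 i, (i <= n)%N & t i <= u <= t i.+1.
Proof.
elim: n => [|n IH] /andP[u0 un]; first by exists 0%N => //; apply/andP.
have [utn|tnu] := leP u (t n.+1).
  by have [|i ni h] := IH; [apply/andP|exists i => //; exact: leqW].
by exists n.+1 => //; rewrite un ltW.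
Qed.

(** On a cell of a fine grid a monotone [q] that is close to [Q] at the grid
    points is close to [Q], unless [Q] has a large increment there; the
    increments add up to a bounded amount, so there are few such cells. *)
Lemma monotone_close_in_measure (Q : R -> R) (e : R) : monotone01 Q -> measurable_fun setT Q -> 0 < e ->
  exists us : seq R, forall q, measurable_fun setT q -> monotone01 q ->
    (forall u, u \in us -> `|q u - Q u| < e / 2) -> pr [set u | e < `|q u - Q u|] <= e.
Proof.
move=> monQ mQ e0.
(* The two ends outside the grid have measure at most [2 d <= e / 2]. *)
pose d := Num.min (e / 4) 4^-1.
have d0 : 0 < d by rewrite lt_min; apply/andP; split; [rewrite divr_gt0|rewrite invr_gt0].
have d4 : d <= 4^-1 by rewrite ge_min lexx orbT.
have de : d <= e / 4 by rewrite ge_min lexx.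
pose V := Q (1 - d) - Q d.
have V0 : 0 <= V by rewrite subr_ge0; apply: monQ; lra.
(* There are at most [2 V / e] cells with an increment above [e / 2], each of
   length at most [1 / m.+1]. *)
pose m := Num.bound (4 * V / e ^+ 2).
pose M : R := m.+1%:R.
have M0 : 0 < M by rewrite ltr0n.
pose t i : R := d + i%:R * ((1 - 2 * d) / M).
have t0 : t 0%N = d by rewrite /t mul0r addr0.
have tM : t m.+1 = 1 - d by rewrite /t mulrC divfK ?gt_eqF//; lra.
have h0 : 0 < (1 - 2 * d) / M by rewrite divr_gt0//; lra.
have tS i : t i.+1 = t i + (1 - 2 * d) / M by rewrite /t -natr1 mulrDl mul1r addrA.
have tle i j : (i <= j)%N -> t i <= t j.
  by move=> ij; rewrite /t lerD2l ler_wpM2r ?ler_nat// ltW.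
have tlo i : d <= t i by rewrite -t0; exact: tle.
have thi i : (i <= m.+1)%N -> t i <= 1 - d by rewrite -tM; exact: tle.
exists [seq t i | i <- iota 0 m.+2] => q mq monq qQ.
have qt i : (i <= m.+1)%N -> `|q (t i) - Q (t i)| < e / 2.
  by move=> im; apply: qQ; apply: map_f; rewrite mem_iota.
pose inc i := Q (t i.+1) - Q (t i).
have inc0 i : (i <= m)%N -> 0 <= inc i.
  by move=> im; rewrite subr_ge0; apply: monQ; [have := tlo i; lra|exact: tle|have := thi i.+1 im; lra].
pose S i : set R := if e / 2 < inc i then `[t i, t i.+1]%classic else set0.
have mS i : measurable (S i) by rewrite /S; case: ifP => _; [exact: measurable_itv|exact: measurable0].
have mB : measurable [set u | e < `|q u - Q u|].
  by apply: (measurable_abs_tail e (q := fun u => q u - Q u)); exact: measurable_funB.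
have cover : [set u | e < `|q u - Q u|] `<=`
    ~` `[d, 1 - d]%classic `|` \bigcup_(i in [set i | (i < m.+1)%N]) S i.
  move=> u /= eu; have [ud|ud] := pselect (`[d, 1 - d]%classic u); last by left.
  right; move: ud; rewrite /= in_itv/= -{1}t0 -tM => ud.
  have [i im /andP[iu ui]] := grid_interval ud.
  exists i; first by rewrite /= ltnS.
  have := qt i (leqW im); have := qt i.+1 im; rewrite !ltr_norml => /andP[a1 a2] /andP[b1 b2].
  have l1 : 0 < t i by have := tlo i; lra.
  have l2 : t i.+1 < 1 by have := thi i.+1 im; lra.
  have Q1 := monQ _ _ l1 iu (le_lt_trans ui l2).
  have Q2 := monQ _ _ (lt_le_trans l1 iu) ui l2.
  have q1 := monq _ _ l1 iu (le_lt_trans ui l2).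
  have q2 := monq _ _ (lt_le_trans l1 iu) ui l2.
  rewrite /S ifT /=; first by rewrite in_itv/= iu.
  move: eu; rewrite /inc; have [h|h] := leP 0 (q u - Q u); first by rewrite ger0_norm//; lra.
  by rewrite ltr0_norm//; lra.
have mU : measurable (\bigcup_(i in [set i | (i < m.+1)%N]) S i) by apply: bigcup_measurable.
have mD : measurable (~` `[d, 1 - d]%classic : set R) by apply: measurableC; exact: measurable_itv.
apply: le_trans (le_pr mB (measurableU _ _ mD mU) cover) _.
apply: le_trans (prU_le mD mU) _.
have h1 : pr (~` `[d, 1 - d]%classic : set R) <= e / 2.
  by apply: le_trans (pr_outside_le d0 _) _; lra.
suff : pr (\bigcup_(i in [set i | (i < m.+1)%N]) S i) <= e / 2 by lra.
apply: le_trans (pr_finite_union_le _ mS) _.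
have Sle (i : 'I_m.+1) : pr (S i) <= (2 / (e * M)) * inc i.
  have im : (i <= m)%N by rewrite -ltnS.
  have := inc0 i im => inci; rewrite /S; case: ifPn => [big|_]; last first.
    by rewrite pr0 mulr_ge0// divr_ge0// mulr_ge0// ltW.
  have step : pr `[t i, t i.+1]%classic <= M^-1.
    apply: le_trans (pr_segment_le _ _ _) _.
    - by have := tlo i; lra.
    - by rewrite tS ltrDl.
    - by have := thi i.+1 im; lra.
    by rewrite tS addrC addKr ler_pdivrMr// mulVf ?gt_eqF//; lra.
  apply: le_trans step _.
  have -> : 2 / (e * M) * inc i = M^-1 * (2 * inc i / e) by field; rewrite !gt_eqF.
  by rewrite ler_peMr ?invr_ge0 ?(ltW M0)// ler_pdivlMr//; lra.
apply: le_trans (ler_sum _ (fun i _ => Sle i)) _; rewrite -mulr_sumr.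
have -> : \sum_(i < m.+1) inc i = V.
  by rewrite -(big_mkord xpredT inc) telescope_sumr// t0 tM.
have : 4 * V / e ^+ 2 < M.
  apply: lt_le_trans (archi_boundP _) _; last by rewrite ler_nat.
  by apply: divr_ge0; [exact: mulr_ge0|exact: sqr_ge0].
rewrite ltr_pdivrMr ?exprn_gt0// => VM.
by rewrite mulrAC ler_pdivrMr ?mulr_gt0//; nra.
Qed.

End Selection.

(** * Independent copies of disjoint sequences *)

Section SameJointLaw.
Context {R : realType} {E : banach_fun_space R}.
Context (E_ri : rearrangement_invariant E).
Notation P := (@leb01 R).

(** The joint law of an independent sequence is determined by the laws of its
    terms, and the norm of a sum by its law. *)
Lemma indep_norm_lin_comb (X Y : nat -> R -> R) (x y : nat -> E) (a : nat -> R) n :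
    (forall k, measurable_fun setT (X k)) -> (forall k, measurable_fun setT (Y k)) ->
    indep X -> indep Y -> (forall k, same_law (X k) (Y k)) ->
    (forall k, reps (x k) (X k)) -> (forall k, reps (y k) (Y k)) ->
  `|\sum_(k < n) a k *: x k| = `|\sum_(k < n) a k *: y k|.
Proof.
move=> mX mY iX iY XY xX yY.
have XYsum : same_law (fun t => \sum_(k < n) a k * X k t) (fun t => \sum_(k < n) a k * Y k t).
  apply: joint_law_sum => // m B mB; rewrite !indep_prefixE//.
  by apply: eq_bigr => k _; exact: XY.
have XYabs : same_law (fun t => `|\sum_(k < n) a k * X k t|) (fun t => `|\sum_(k < n) a k * Y k t|).
  exact: (same_law_comp (@normr_measurable R setT) XYsum).
have [z zX zy] := reps_same_law E_ri (measurable_lin_comb n a mX) (measurable_lin_comb n a mY)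
  (reps_sum n a yY) XYabs.
by rewrite (reps_uniq (reps_sum n a xX) zX).
Qed.

End SameJointLaw.

Section GrowthOfSums.
Context {R : realType} {V : normedModType R}.
Context (p : R).
Context (p1 : 1 <= p).

Lemma powR_scale_le1 (m : nat) : (0 < m)%N -> 0 <= (m%:R : R) `^ (- p^-1) <= 1.
Proof.
move=> m0; rewrite powR_ge0/= -[leRHS](powRr0 (m%:R : R)); apply: ler_powR; first by rewrite ler1n.
by rewrite oppr_le0 invr_ge0; apply: le_trans p1.
Qed.

Lemma bounded_fun_of_norm_le (x : nat -> V) (M : R) : (forall n, `|x n| <= M) -> bounded_fun x.
Proof.
move=> xM; exists M; split; first exact: num_real.
by move=> N MN n _ /=; apply: le_trans (xM n) (ltW MN).
Qed.

Lemma p_BS_subsequence (x : nat -> V) (s : nat -> nat) : increasing_seq s ->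
  p_BS_sequence p x -> p_BS_sequence p (x \o s).
Proof.
move=> si [bx hx]; split; last by move=> r ri; apply: (hx (s \o r)); exact: increasing_seq_comp.
have [M [Mr hM]] := bx; exists M; split => // N MN n _; exact: hM.
Qed.

(** The growth condition is stable under domination of the norms of sums up to
    constants, because the scaling factors are at most [1]. *)
Lemma p_BS_dominated (u v w : nat -> V) (M c d : R) : 
    (forall n, `|w n| <= M) -> 0 <= c -> 0 <= d -> p_BS_sequence p u -> p_BS_sequence p v ->
    (forall r m, increasing_seq r -> `|\sum_(k < m) w (r k)| <=
       c * `|\sum_(k < m) u (r k)| + c * `|\sum_(k < m) v (r k)| + d) ->
  p_BS_sequence p w.
Proof.
move=> wM c0 d0 [_ hu] [_ hv] hw; split; first exact: bounded_fun_of_norm_le wM.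
move=> r ri; have [A hA] := hu r ri; have [B hB] := hv r ri.
exists (c * A + c * B + d) => _ [m /= m0 <-].
have /andP[q0 q1] := powR_scale_le1 m0.
have {}hA : m%:R `^ (- p^-1) * `|\sum_(k < m) u (r k)| <= A by apply: hA; exists m.
have {}hB : m%:R `^ (- p^-1) * `|\sum_(k < m) v (r k)| <= B by apply: hB; exists m.
apply: le_trans (ler_wpM2l q0 (hw r m ri)) _.
move: (m%:R `^ _) q0 q1 hA hB => q q0 q1 hA hB.
rewrite !mulrDr ![q * (c * _)]mulrCA; apply: lerD; last by rewrite ler_piMl.
by apply: lerD; rewrite ler_wpM2l.
Qed.

Lemma norm_sum_geometric (u : nat -> V) (e : R) (r : nat -> nat) m : 0 <= e -> increasing_seq r ->
  (forall k, `|u k| <= e * 2^-1 ^+ k) -> `|\sum_(k < m) u (r k)| <= 2 * e.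
Proof.
move=> e0 ri ue; apply: le_trans (ler_norm_sum _ _ _) _.
apply: (@le_trans _ _ (\sum_(k < m) e * 2^-1 ^+ k)).
  apply: ler_sum => k _; apply: le_trans (ue _) _; apply: ler_wpM2l => //.
  by apply: ler_wiXn2l; [lra|lra|exact: increasing_seq_geq].
by rewrite -mulr_sumr mulrC ler_wpM2r// geometric_sum_le.
Qed.

Lemma norm_convex_le (u : nat -> V) (a : nat -> R) (e : R) n : (forall k, 0 <= a k) ->
  \sum_(k < n) a k = 1 -> (forall k, `|u k| <= e) -> `|\sum_(k < n) a k *: u k| <= e.
Proof.
move=> a0 a1 ue; apply: le_trans (ler_norm_sum _ _ _) _.
rewrite -[leRHS]mul1r -a1 mulr_suml; apply: ler_sum => k _.
by rewrite normrZ ger0_norm// ler_wpM2l.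
Qed.

Lemma weakly_null_subsequence (x : nat -> V) (s : nat -> nat) : increasing_seq s ->
  weakly_null x -> weakly_null (x \o s).
Proof.
move=> si x0 phi cphi; have := x0 phi cphi.
move=> /cvgrPdist_lt h; apply/cvgrPdist_lt => e e0; have [N _ hN] := h e e0.
by exists N => // n /= Nn; apply: hN; apply: leq_trans Nn (increasing_seq_geq _ si).
Qed.

End GrowthOfSums.

Section IndependentCopies.
Context {R : realType} {E : banach_fun_space R}.
Context (E_ri : rearrangement_invariant E) (E_separable : separable E)
  (E_fatou : fatou_property E).
Notation P := (@leb01 R).

(** The terms of a convergent series tend to [0]. *)
Lemma bounded_sums_to0 (u : nat -> R) (C : R) : (forall n, 0 <= u n) ->
    (forall n, \sum_(k < n) u k <= C) ->
  forall d : R, 0 < d -> exists N, forall n, (N <= n)%N -> u n < d.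
Proof.
move=> u0 uC d d0.
have /cvg_series_cvg_0 : cvgn (series u).
  apply: nondecreasing_is_cvgn.
    by apply/nondecreasing_seqP => n; rewrite /series/= big_nat_recr//= lerDl.
  by exists C => _ [n _ <-]; rewrite /series/= big_mkord.
move=> /cvgrPdist_lt/(_ _ d0)[N _ hN]; exists N => n Nn.
by have := hN n Nn; rewrite sub0r normrN ger0_norm.
Qed.

Context (x y : nat -> E) (f : nat -> R -> R).
Context (mf : forall k, measurable_fun setT (f k)) (xf : forall k, reps (x k) (f k))
  (df : disjoint f).
Let h n : R -> R := f n \o unif n.
Context (yh : forall k, reps (y k) (h k)).

Let mh k : measurable_fun setT (h k).
Proof. by apply: measurableT_comp => //; exact: measurable_unif. Qed.

Let indep_h : indep h.
Proof. by apply: indep_comp => //; exact: indep_unif. Qed.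

Let tail_h k (s : R) : pr [set t | s < `|h k t|] = pr [set t | s < `|f k t|].
Proof.
rewrite /pr -[in RHS](unif_uniform k)//; exact: measurable_abs_tail.
Qed.

Let A n := [set t : R | 0 < `|h n t|].

Let mA n : measurable (A n).
Proof. exact: measurable_abs_tail. Qed.

Let A_to0 (d : R) : 0 < d -> exists N, forall n, (N <= n)%N -> pr (A n) < d.
Proof.
apply: (@bounded_sums_to0 (fun n => pr (A n)) 1) => n; first exact: pr_ge0.
have := disjoint_sum_tail (fun=> 1) n mf df (lexx 0).
under eq_bigr => k _ do (under eq_set do rewrite mul1r; rewrite -tail_h).
by move=> <-; apply: pr_le1; exact: (measurable_abs_tail 0 (measurable_lin_comb n (fun=> 1) mf)).
Qed.

(** Far along the sequence, the independent copies have almost disjoint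
    supports; making them disjoint removes at most half of each tail, by
    independence. *)
Lemma disjoint_parts_of_independent_copies (r0 : nat -> nat) (e : R) : increasing_seq r0 -> 0 < e ->
  exists s (z : nat -> E), [/\ increasing_seq s,
    forall k, `|y (r0 (s k)) - z k| <= e * 2^-1 ^+ k,
    forall (r : nat -> nat) (a : nat -> R) n, increasing_seq r ->
      `|\sum_(k < n) a k *: z (r k)| <= `|\sum_(k < n) a k *: x (r0 (s (r k)))| &
    forall (r : nat -> nat) (a : nat -> R) n, increasing_seq r ->
      `|\sum_(k < n) a k *: x (r0 (s (r k)))| <= 2 * `|\sum_(k < n) a k *: z (r k)|].
Proof.
move=> r0i e0.
have hA k t : ~ A (r0 k) t -> h (r0 k) t = 0.
  by rewrite /A/= normr_gt0 => /negP; rewrite negbK => /eqP.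
have A0 (d : R) : 0 < d -> exists N, forall n, (N <= n)%N -> pr (A (r0 n)) < d.
  move=> d0; have [N hN] := A_to0 d0; exists N => n Nn; apply: hN.
  exact: leq_trans Nn (increasing_seq_geq _ r0i).
have [s [z [si sA zh dz yz]]] := nearly_disjoint_subsequence E_ri E_separable E_fatou
  (fun k => mh (r0 k)) (fun k => mA (r0 k)) (fun k => yh (r0 k)) hA A0 e0.
pose B k := ~` \bigcup_j A (r0 (s (k.+1 + j)%N)).
have {}zh : forall k, reps (z k) (restr (h (r0 (s k))) (B k)) by exact: zh.
have {}dz : disjoint (fun k => restr (h (r0 (s k))) (B k)) by exact: dz.
have mB k : measurable (B k) by apply: measurableC; apply: bigcupT_measurable.
have inj (r : nat -> nat) : increasing_seq r -> injective r by exact: increasing_seq_inj.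
have disj_f (r : nat -> nat) : increasing_seq r -> disjoint (fun k => f (r0 (s (r k)))).
  move=> ri i j t ij; apply: df; apply/eqP => /(inj _ r0i)/(inj _ si)/(inj _ ri) E'.
  by rewrite E' eqxx in ij.
have disj_z (r : nat -> nat) : increasing_seq r -> disjoint (fun k => restr (h (r0 (s (r k)))) (B (r k))).
  move=> ri i j t ij; apply: dz; apply/eqP => /(inj _ ri) E'.
  by rewrite E' eqxx in ij.
have mz k : measurable_fun setT (restr (h (r0 (s k))) (B k)) by exact: measurable_restr.
exists s, z; split => // r a n ri.
- rewrite -[leRHS]mul1r -(expr0 2); apply: (disjoint_sum_norm_le E_ri a n (m := 0)
    (fun k => mf (r0 (s (r k)))) (fun k => mz (r k)) (disj_f r ri) (disj_z r ri)
    (fun k => xf (r0 (s (r k)))) (fun k => zh (r k))).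
  move=> k v v0; rewrite expr0 mul1r -tail_h; apply: le_pr; try exact: measurable_abs_tail.
  by move=> t /= /lt_le_trans; apply; exact: norm_restr_le.
- rewrite -[X in X * _](expr1 2); apply: (disjoint_sum_norm_le E_ri a n (m := 1)
    (fun k => mz (r k)) (fun k => mf (r0 (s (r k)))) (disj_z r ri) (disj_f r ri)
    (fun k => zh (r k)) (fun k => xf (r0 (s (r k))))).
  move=> k v v0; rewrite expr1 -tail_h; move: (r k) => {}k.
  set j := r0 (s k); pose T := [set t | v < `|h j t|].
  have mT : measurable T by exact: measurable_abs_tail.
  have cut : pr (T `&` ~` B k) <= 2 * (4^-1 * pr T) * 2^-1 ^+ 0.
    have -> : T `&` ~` B k = \bigcup_(i in [set i | (0 <= i)%N]) (T `&` A (r0 (s (k.+1 + i)%N))).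
      rewrite /B setCK; apply/seteqP; split => t; first by move=> [Tt [i _ Ai]]; exists i.
      by move=> [i _ [Tt Ai]]; split => //; exists i.
    apply: pr_tail_union => i; first by apply: measurableI.
    have ji : j != r0 (s (k.+1 + i)%N).
      by apply/eqP => /(inj _ r0i)/(inj _ si) /eqP; rewrite ltn_eqF// ltnS leq_addr.
    have mv (w : R) : measurable [set u : R | w < `|u|] by exact: (measurable_abs_tail w (@measurable_id _ R setT)).
    have -> : pr (T `&` A (r0 (s (k.+1 + i)%N))) = pr T * pr (A (r0 (s (k.+1 + i)%N))).
      apply: EFin_inj; rewrite EFinM -!prE//; last exact: measurableI.
      exact: (indep_pair indep_h ji (mv v) (mv 0)).
    rewrite [leRHS]mulrAC [leRHS]mulrC; apply: (ler_wpM2l (pr_ge0 _)).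
    apply: le_trans (sA _) _; apply: ler_wpM2l; first by rewrite invr_ge0.
    by apply: ler_wiXn2l; [lra|lra|rewrite leq_addl].
  have part : pr (T `&` B k) <= pr [set t | v < `|restr (h j) (B k) t|].
    apply: le_pr; [by apply: measurableI|exact: (measurable_abs_tail v (mz k))|].
    by move=> t [Tt Bt] /=; rewrite restr_in.
  have := pr_split mT (mB k); rewrite -/T; move: cut part; rewrite expr0 mulr1; lra.
Qed.

(** Convex combinations of the copies are dominated, up to a small error, by the
    same convex combinations of the disjoint sequence. *)
Lemma independent_copy_weakly_null : weakly_null x -> weakly_null y.
Proof.
move=> x0; apply: convex_weakly_null => r0 r0i e e0.
have e4 : 0 < e / 4 by lra.
have [s [z [si yz zx _]]] := disjoint_parts_of_independent_copies r0i e4.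
have xs0 := weakly_null_subsequence (increasing_seq_comp r0i si) x0.
have e2 : 0 < e / 2 by lra.
have [n [a [a0 a1 ax]]] := weakly_null_convex xs0 e2.
exists n, a, s; split => //.
have -> : \sum_(k < n) a k *: y (r0 (s k)) =
    \sum_(k < n) a k *: z k + \sum_(k < n) a k *: (y (r0 (s k)) - z k).
  by rewrite -big_split/=; apply: eq_bigr => k _; rewrite -scalerDr addrC subrK.
have := zx id a n (fun _ _ => erefl); have := @norm_convex_le _ E (fun k => y (r0 (s k)) - z k) a (e / 4) n a0 a1.
move=> h1 h2; apply: le_lt_trans (ler_normD _ _) _.
have {}h1 : `|\sum_(k < n) a k *: (y (r0 (s k)) - z k)| <= e / 4.
  apply: h1 => k; apply: le_trans (yz k) _; rewrite ler_piMr//; first exact: ltW.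
  by apply: exprn_ile1; rewrite ?invr_ge0//; lra.
by move: ax; rewrite /= => ax; have := le_lt_trans h2 ax; lra.
Qed.

(** The converse comparison: the sums of the disjoint sequence are at most twice
    those of the copies, up to a bounded error. *)
Lemma p_BS_of_independent_copy (p M : R) (s0 : nat -> nat) : 1 <= p -> (forall n, `|x n| <= M) ->
    increasing_seq s0 -> p_BS_sequence p (y \o s0) ->
  exists s, increasing_seq s /\ p_BS_sequence p (x \o s).
Proof.
move=> p1 xM s0i yBS.
have [s [z [si yz _ xz]]] := disjoint_parts_of_independent_copies s0i ltr01.
exists (s0 \o s); split; first exact: increasing_seq_comp.
have ysBS := p_BS_subsequence si yBS.
apply: (@p_BS_dominated _ _ p p1 _ _ _ M 2 4 _ _ _ ysBS ysBS) => // [n|r m ri]; first exact: xM.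
have := xz r (fun=> 1) m ri.
under eq_bigr do rewrite scale1r; under [X in _ <= 2 * `|X|]eq_bigr do rewrite scale1r.
move=> h1; apply: le_trans h1 _.
have -> : \sum_(k < m) z (r k) = \sum_(k < m) y (s0 (s (r k))) - \sum_(k < m) (y (s0 (s (r k))) - z (r k)).
  by rewrite -sumrB; apply: eq_bigr => k _; rewrite subKr.
have := norm_sum_geometric m ler01 ri yz => h2.
have := ler_normB (\sum_(k < m) y (s0 (s (r k)))) (\sum_(k < m) (y (s0 (s (r k))) - z (r k))).
have := normr_ge0 (\sum_(k < m) y (s0 (s (r k)))).
move: h2; rewrite /=; lra.
Qed.

End IndependentCopies.

Section GammaIndependentDisjoint.
Context {R : realType} {E : banach_fun_space R}.
Context (E_ri : rearrangement_invariant E) (E_separable : separable E)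
  (E_fatou : fatou_property E).

(** The hypothesis is applied to the independent copies of a disjoint sequence. *)
Lemma Gamma_i_sub_Gamma_d : Gamma_i E `<=` Gamma_d E.
Proof.
move=> p [p1 hp]; split => // x x0 dx.
have [M xM] := weakly_null_bounded x0.
have [f [mf xf df]] := disjoint_representatives dx.
have mh k : measurable_fun setT (f k \o unif k).
  by apply: measurableT_comp => //; exact: measurable_unif.
have hy k : exists y : E, reps y (f k \o unif k).
  have [|y yh _] := reps_same_law E_ri (mh k) (mf k) (xf k); last by exists y.
  move=> B mB; rewrite -[LHS]/(leb01 (unif k @^-1` ((fun t => `|f k t|) @^-1` B))).
  by apply: unif_uniform; apply: (@measurable_preimage _ (fun t => `|f k t|)) => //; exact: measurableT_comp.
have [y yh] := choice hy.
have y0 := independent_copy_weakly_null E_ri E_separable E_fatou mf xf df yh x0.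
have iy : independent (fun n => rep (y n)).
  apply: (@indep_ae _ (fun n => f n \o unif n) (fun n => rep (y n))) => //.
  - by move=> n; exact: measurable_rep.
  - by move=> n; apply: ae_mono (yh n) => t ->.
  - by apply: indep_comp => //; exact: indep_unif.
have [s0 [s0i yBS]] := hp y y0 iy.
exact: (p_BS_of_independent_copy E_ri E_separable E_fatou mf xf df yh p1 xM s0i yBS).
Qed.

End GammaIndependentDisjoint.

(** * Splitting independent sequences *)

Section Constants.
Context {R : realType} {E : banach_fun_space R}.
Context (E_ri : rearrangement_invariant E).
Notation P := (@leb01 R).

(** A function that exceeds each [1 / (n + 1)] in absolute value only on a null set
    vanishes almost everywhere. *)
Lemma reps_neq0_tail (y : E) (f : R -> R) : measurable_fun setT f -> reps y f -> y != 0 ->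
  exists2 c : R, 0 < c & 0 < pr [set t | c < `|f t|].
Proof.
move=> mf yf y0; apply: contrapT => h.
have pr0n (n : nat) : pr [set t | n.+1%:R^-1 < `|f t|] = 0.
  apply/eqP; rewrite eq_le pr_ge0 andbT leNgt; apply/negP => hn.
  by apply: h; exists n.+1%:R^-1; rewrite // invr_gt0.
move/eqP: y0; apply; apply: (@reps_uniq _ _ _ _ (fun=> 0) _ reps0).
apply: reps_ae yf _.
have mA (n : nat) : measurable [set t | n.+1%:R^-1 < `|f t|] by exact: measurable_abs_tail.
have : pr (\bigcup_n [set t | n.+1%:R^-1 < `|f t|]) <= 0.
  by apply: pr_bigcup_le => // n; rewrite big1.
rewrite le_eqVlt ltNge pr_ge0 orbF => /eqP U0.
have mU : measurable (\bigcup_n [set t | n.+1%:R^-1 < `|f t|]) by apply: bigcupT_measurable.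
exists (\bigcup_n [set t | n.+1%:R^-1 < `|f t|]); split => //; first by rewrite prE// U0.
move=> t /= ft; have {}ft : 0 < `|f t| by rewrite normr_gt0; apply/eqP.
exists (Num.bound `|f t|^-1) => //=.
rewrite invf_plt ?posrE//; apply: lt_le_trans (archi_boundP _) _; last by rewrite ler_nat.
by rewrite invr_ge0 ltW.
Qed.

Lemma exists_half_pow_le (c : R) : 0 < c -> exists k, 1 <= 2 ^+ k * c.
Proof.
move=> c0; have [k kc] := half_pow_small c0; exists k.
have k1 : 2 ^+ k * (2^-1 : R) ^+ k = 1 by rewrite -exprMn divff ?expr1n.
by rewrite -[leLHS]k1 ler_wpM2l ?exprn_ge0// ltW.
Qed.

Lemma tail_constant (c s : R) : 0 <= c -> 0 <= s ->
  pr [set t : R | s < `|c|] = if s < c then 1 else 0.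
Proof.
move=> c0 s0; rewrite ger0_norm//; case: ifP => sc.
  by rewrite (_ : mkset _ = setT) ?prT//; apply/seteqP; split.
by rewrite (_ : mkset _ = set0) ?pr0//; apply/seteqP; split => t //=; rewrite sc.
Qed.

(** A multiple of a nonzero element exceeds [1] on a set of measure at least [2^-k],
    and tails may be multiplied by [2^k] at the cost of a factor in the norm. *)
Lemma nonzero_space_has_constants (y : E) : y != 0 ->
  exists one : E, reps one (fun=> 1).
Proof.
move=> y0; have my := measurable_rep y.
have [c c0 pc] := reps_neq0_tail my (reps_rep y) y0.
have [k kc] := exists_half_pow_le pc.
have [|one one1 _] := reps_tail_le_double E_ri (@measurable_cst _ _ R R setT (1 : R))
  (measurable_funM (@measurable_cst _ _ R R setT c^-1) my) (repsZ c^-1 (reps_rep y)) (k := k).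
  move=> s s0; rewrite /= tail_constant//; case: ifP => s1; last by rewrite mulr_ge0 ?exprn_ge0 ?pr_ge0.
  apply: le_trans kc _; rewrite ler_wpM2l ?exprn_ge0//.
  apply: le_pr; [exact: measurable_abs_tail|apply: measurable_abs_tail; exact: measurable_funM|].
  move=> t /= ct; rewrite normrM gtr0_norm ?invr_gt0// ltr_pdivlMl//.
  by apply: le_lt_trans ct; rewrite ler_piMr// ltW.
by exists one.
Qed.

Lemma constant_neq0 (one : E) : reps one (fun=> 1) -> 0 < `|one|.
Proof.
move=> one1; rewrite normr_gt0; apply/eqP => one0.
rewrite one0 in one1.
have [N [mN N0 hN]] := ae_and one1 (@reps0 _ E).
have NT : N = setT.
  apply/seteqP; split => // t _; apply: hN => -[/= -> /eqP]; rewrite oner_eq0//.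
by move: N0; rewrite NT leb01_setT => /eqP; rewrite onee_eq0.
Qed.

(** Sets of measure bounded below have indicators of norm bounded below, so
    norm boundedness controls the tails uniformly. *)
Lemma uniform_tails (one : E) (M : R) : reps one (fun=> 1) -> forall e : R, 0 < e ->
  exists2 C : R, 0 < C & forall (y : E) (f : R -> R), measurable_fun setT f -> reps y f -> `|y| <= M ->
    pr [set t | C < `|f t|] < e.
Proof.
move=> one1 e e0; have n1 := constant_neq0 one1.
have [k ke] := exists_half_pow_le e0.
pose C := (2 ^+ k * `|M| + 1) / `|one|.
have p2 : 0 <= 2 ^+ k * `|M| by rewrite mulr_ge0 ?exprn_ge0.
have C0 : 0 < C by rewrite divr_gt0//; lra.
exists C => // y f mf yf yM; rewrite ltNge; apply/negP => eC.
have [|one' one'1 h] := reps_tail_le_double E_ri (@measurable_cst _ _ R R setT (1 : R))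
  (measurable_funM (@measurable_cst _ _ R R setT C^-1) mf) (repsZ C^-1 yf) (k := k).
  move=> s s0; rewrite /= tail_constant//; case: ifP => s1; last by rewrite mulr_ge0 ?exprn_ge0 ?pr_ge0.
  apply: le_trans ke _; rewrite ler_wpM2l ?exprn_ge0//.
  apply: le_trans eC _.
  apply: le_pr; [exact: measurable_abs_tail|apply: measurable_abs_tail; exact: measurable_funM|].
  move=> t /= ct; rewrite normrM gtr0_norm ?invr_gt0// ltr_pdivlMl//.
  by apply: le_lt_trans ct; rewrite ler_piMr// ltW.
rewrite (reps_uniq one'1 one1) in h.
have : `|C^-1 *: y| = C^-1 * `|y| by rewrite normrZ gtr0_norm ?invr_gt0.
move=> E'; rewrite E' in h.
have : C * `|one| <= 2 ^+ k * `|y|.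
  by rewrite -ler_pdivlMl// mulrCA in h *.
have -> : C * `|one| = 2 ^+ k * `|M| + 1 by rewrite /C divfK// gt_eqF.
have : 2 ^+ k * `|y| <= 2 ^+ k * `|M|.
  by rewrite ler_wpM2l ?exprn_ge0// (le_trans yM)// ler_norm.
lra.
Qed.

(** The quantile at [u] lies between [- C] and [C] as soon as both tails beyond
    these levels have measure less than [u] and [1 - u]. *)
Lemma norm_quantile_le (f : R -> R) (C u : R) : measurable_fun setT f -> 0 < u < 1 ->
  pr [set t | C < `|f t|] < Num.min u (1 - u) -> `|quantile f u| <= C.
Proof.
move=> mf u01; rewrite lt_min => /andP[h1 h2].
have mC := measurable_abs_tail C mf.
rewrite ler_norml; apply/andP; split.
  rewrite leNgt; apply/negP => qC.
  have : u <= cumul f (quantile f u) by rewrite -quantile_le.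
  have : cumul f (quantile f u) <= pr [set t | C < `|f t|].
    apply: le_pr => //.
      have := measurableC (measurable_tail (quantile f u) mf); congr measurable.
      by apply/seteqP; split => t /=; rewrite leNgt => /negP.
    move=> t /= ft; have : f t < - C by apply: le_lt_trans ft qC.
    by move=> h; rewrite -normrN; apply: lt_le_trans (ler_norm _); lra.
  lra.
rewrite quantile_le//.
have : pr [set t | C < f t] <= pr [set t | C < `|f t|].
  by apply: le_pr => //; [exact: measurable_tail|move=> t /= /lt_le_trans; apply; exact: ler_norm].
rewrite tail_cumul//; lra.
Qed.

End Constants.

Section QuantileLimit.
Context {R : realType} {E : banach_fun_space R}.
Context (E_ri : rearrangement_invariant E) (E_separable : separable E)
  (E_fatou : fatou_property E).
Notation P := (@leb01 R).

Lemma quantile_monotone01 (f : R -> R) : measurable_fun setT f -> monotone01 (quantile f).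
Proof. by move=> mf u v; exact: quantile_nondecreasing. Qed.

(** [Q] is a pointwise cluster point. It is monotone as a limit of monotone
    functions, so being close to it at finitely many points means being close in
    measure; the geometric rate gives convergence almost everywhere, and the
    Fatou property places [Q] in [E]. *)
Lemma quantile_limit (one : E) (F : nat -> E) (f : nat -> R -> R) (M : R) : reps one (fun=> 1) ->
    (forall n, measurable_fun setT (f n)) -> (forall n, reps (F n) (f n)) ->
    (forall n, `|F n| <= M) ->
  exists (Q : R -> R) (s : nat -> nat), [/\ measurable_fun setT Q, exists y : E, reps y Q,
    increasing_seq s & forall k, pr [set u | 2^-1 ^+ k < `|quantile (f (s k)) u - Q u|] <= 2^-1 ^+ k].
Proof.
move=> one1 mf Ff FM.
pose q n := quantile (f n).
have mq n : measurable_fun setT (q n) by exact: measurable_quantile.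
have hC (u : R) : exists C : R, forall n, `|q n u| <= C.
  have [u01|u01] := boolP (0 < u < 1); last by exists 0 => n; rewrite /q /quantile (negbTE u01) normr0.
  have [|C C0 hC] := uniform_tails E_ri M one1 (e := Num.min u (1 - u)).
    by rewrite lt_min; apply/andP; lra.
  by exists C => n; apply: norm_quantile_le => //; exact: hC (Ff n) (FM n).
have [C qC] := choice hC.
have [Q hQ] := @pointwise_cluster_point R q C (fun n u => qC u n).
have Qmon : monotone01 Q.
  move=> u v u0 uv v1; apply/ler_addgt0Pr => e e0.
  have e2 : 0 < e / 2 by lra.
  have [n _ hn] := hQ [:: u; v] (e / 2) 0%N e2.
  have := hn u; have := hn v; rewrite !inE !eqxx orbT /= => /(_ isT) h1 /(_ isT) h2.
  have := quantile_nondecreasing (mf n) u0 uv v1; rewrite -/(q n).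
  move: h1 h2; rewrite !ltr_norml => /andP[a1 a2] /andP[b1 b2]; lra.
have Q0 u : ~~ (0 < u < 1) -> Q u = 0.
  move=> u01; apply/eqP; rewrite -normr_le0; apply/ler_addgt0Pr => e e0; rewrite add0r.
  have [n _ hn] := hQ [:: u] e 0%N e0.
  by have := hn u; rewrite inE eqxx /q /quantile (negbTE u01) sub0r normrN => /(_ isT) /ltW.
have mQ : measurable_fun setT Q by exact: measurable_nondecreasing_on01.
have pow0 k : 0 < (2^-1 : R) ^+ k by rewrite exprn_gt0// invr_gt0.
have [k m|s [si s0 sS]] := @extract_subsequence (fun k _ n => pr [set u | 2^-1 ^+ k < `|q n u - Q u|] <= 2^-1 ^+ k).
  have [us hus] := monotone_close_in_measure Qmon mQ (pow0 k).
  have [|n mn hn] := hQ us (2^-1 ^+ k / 2) m.+1; first by rewrite divr_gt0.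
  by exists n; split => //; apply: hus => //; exact: quantile_monotone01.
have hs k : pr [set u | 2^-1 ^+ k < `|q (s k) u - Q u|] <= 2^-1 ^+ k.
  by case: k => [|k]; [exact: s0|exact: sS].
exists Q, s; split => //.
have qel n : exists2 w : E, reps w (q n) & `|w| = `|F n|.
  apply: (reps_same_law E_ri (mq n) (mf n) (Ff n)).
  exact: same_law_comp (@normr_measurable R setT) (quantile_law (mf n)).
have hw n : exists w : E, reps w (q n) /\ `|w| = `|F n|.
  by have [w] := qel n; exists w.
have [w wq] := choice hw.
have wM k : `|w (s k)| <= M by rewrite (wq (s k)).2.
have [|y yQ _] := reps_fatou E_fatou mQ (fun k => (wq (s k)).1) wM; last by exists y.
have mA k : measurable [set u | 2^-1 ^+ k < `|q (s k) u - Q u|].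
  by apply: (measurable_abs_tail _ (q := fun u => q (s k) u - Q u)); exact: measurable_funB.
have h1 k : pr [set u | 2^-1 ^+ k < `|q (s k) u - Q u|] <= 1 * 2^-1 ^+ k by rewrite mul1r.
apply: ae_mono (ae_eventually_outside mA h1) => u [N hN].
apply/cvgrPdist_le => e e0; have [m me] := half_pow_small e0.
exists (maxn N m) => // n /=; rewrite geq_max => /andP[Nn mn].
rewrite distrC; have := hN n Nn; rewrite /= => /negP; rewrite -leNgt => /le_trans; apply.
apply: le_trans (ltW me); apply: ler_wiXn2l => //; lra.
Qed.

End QuantileLimit.

Section WeaklyNullCombinations.
Context {R : realType} {V : normedModType R}.
Implicit Types (x y u : nat -> V).

Lemma weakly_nullB x y : weakly_null x -> weakly_null y -> weakly_null (fun n => x n - y n).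
Proof.
move=> x0 y0 phi cphi; rewrite -(subr0 (0 : R^o)).
under eq_fun do rewrite linearB.
by apply: cvgB; [exact: x0|exact: y0].
Qed.

Lemma weakly_null_geometric u (c : R) : (forall k, `|u k| <= c * 2^-1 ^+ k) -> weakly_null u.
Proof.
move=> uc phi cphi; have [C C0 phiC] := continuous_norm_le cphi.
apply/cvgrPdist_lt => e e0; have c0 : 0 <= c by have := le_trans (normr_ge0 _) (uc 0%N); rewrite expr0 mulr1.
have d0 : 0 < C * c + 1 by rewrite ltr_wpDl// mulr_ge0// ltW.
have [n hn] := half_pow_small (divr_gt0 e0 d0); exists n => // k /= nk.
rewrite sub0r normrN; apply: le_lt_trans (phiC _) _.
have pk : 0 < (2^-1 : R) ^+ k by rewrite exprn_gt0// invr_gt0.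
apply: (@le_lt_trans _ _ (C * (c * 2^-1 ^+ k))); first by rewrite ler_pM2l.
have : (2^-1 : R) ^+ k <= 2^-1 ^+ n by apply: ler_wiXn2l => //; lra.
move=> /le_lt_trans/(_ hn); rewrite ltr_pdivlMr//; nra.
Qed.

Definition block_average (N J : nat) x (m : nat) : V :=
  N%:R^-1 *: \sum_(l < N) x (J + m * N + l)%N.

Lemma norm_average_le (N : nat) x (e : R) : (0 < N)%N -> (forall l, `|x l| <= e) ->
  `|N%:R^-1 *: \sum_(l < N) x l| <= e.
Proof.
move=> N0 xe; have NR : 0 < N%:R :> R by rewrite ltr0n.
rewrite normrZ gtr0_norm ?invr_gt0// ler_pdivrMl//.
apply: le_trans (ler_norm_sum _ _ _) _.
apply: (@le_trans _ _ (\sum_(l < N) e)); last by rewrite sumr_const card_ord mulr_natl.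
by apply: ler_sum => l _; exact: xe.
Qed.

(** The block with number [m] only involves terms with index at least [m]. *)
Lemma weakly_null_block_average N J x : (0 < N)%N -> weakly_null x ->
  weakly_null (block_average N J x).
Proof.
move=> N0 x0 phi cphi; apply/cvgrPdist_le => e e0.
have /cvgrPdist_le/(_ _ e0)[K _ hK] := x0 phi cphi.
exists K => // m /= Km; rewrite sub0r normrN /block_average linearZ linear_sum/=.
have NR : 0 < N%:R :> R by rewrite ltr0n.
rewrite /GRing.scale/= normrM gtr0_norm ?invr_gt0// ler_pdivrMl//.
apply: le_trans (ler_norm_sum _ _ _) _.
apply: (@le_trans _ _ (\sum_(l < N) e)); last by rewrite sumr_const card_ord mulr_natl.
apply: ler_sum => l _; have := hK (J + m * N + l)%N; rewrite sub0r normrN; apply => /=.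
have mN : (m <= m * N)%N by rewrite leq_pmulr.
by apply: (leq_trans Km); apply: (leq_trans mN); rewrite addnAC leq_addl.
Qed.

End WeaklyNullCombinations.

Section CommonPart.
Context {R : realType} {E : banach_fun_space R}.
Context (E_ri : rearrangement_invariant E) (E_separable : separable E)
  (E_fatou : fatou_property E).
Notation P := (@leb01 R).

Definition vanishes_on (D : set R) (z : E) := \forall t \ae P, D t -> rep z t = 0.

Lemma vanishes_on_sum (D : set R) (z : nat -> E) (a : nat -> R) n :
  (forall k, vanishes_on D (z k)) -> vanishes_on D (\sum_(k < n) a k *: z k).
Proof.
move=> zD; have /ae_foralln zD' := zD.
apply: ae_mono (ae_and zD' (reps_sum n a (fun k => reps_rep (z k)))) => t [h ->] Dt.
by apply: big1 => k _; rewrite h// mulr0.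
Qed.

(** The tails of the constant [1] are at most twice those of its restriction. *)
Lemma large_set_constant_norm (one oneD : E) (D : set R) : measurable D -> 2^-1 <= pr D ->
  reps one (fun=> 1) -> reps oneD (restr (fun=> 1) D) -> `|one| <= 2 * `|oneD|.
Proof.
move=> mD D2 one1 oneDr.
have mr : measurable_fun setT (restr (fun=> 1 : R) D) by exact: measurable_restr.
have [|one' one'1] := reps_tail_le_double E_ri (@measurable_cst _ _ R R setT (1 : R)) mr oneDr (k := 1).
  move=> s s0; rewrite /= tail_constant// expr1; case: ifP => s1; last by rewrite mulr_ge0 ?pr_ge0.
  suff : pr D <= pr [set t | s < `|restr (fun=> 1 : R) D t|] by lra.
  apply: le_pr => //; first exact: measurable_abs_tail.
  by move=> t Dt /=; rewrite restr_in// normr1.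
by rewrite (reps_uniq one'1 one1) expr1.
Qed.

(** By order continuity, large values of [Q] carry little norm. *)
Lemma truncation (y : E) (Q : R -> R) (e : R) : measurable_fun setT Q -> reps y Q -> 0 < e ->
  exists T : set R, [/\ measurable T, exists2 w : E, reps w (restr Q T) & `|w| <= e &
    bounded_measurable (restr Q (~` T))].
Proof.
move=> mQ yQ e0.
have [d d0 hd] := norm_restr_small E_ri E_separable E_fatou mQ yQ e0.
have mT (n : nat) : measurable [set t | n%:R < `|Q t|] by exact: measurable_abs_tail.
have [||||n hn] := @pr_decreasing_to0 R (fun n : nat => [set t | n%:R < `|Q t|]) _ _ _ d.
- exact: mT.
- by move=> n m nm t /=; apply: le_lt_trans; rewrite ler_nat.
- by move=> t /(_ (Num.bound `|Q t|)) /=; apply/negP; rewrite -leNgt ltW// archi_boundP.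
- exact: d0.
exists [set t | n%:R < `|Q t|]; split; first exact: mT.
  have [w wT _] := reps_restr E_ri mQ (mT n) yQ; exists w => //.
  by apply: ltW; exact: hd wT.
split; first by apply: measurable_restr => //; exact: measurableC.
exists n%:R => t; have [Tt|Tt] := pselect (n%:R < `|Q t|).
  by rewrite restr_out ?normr0// => /(_ Tt).
by rewrite restr_in//; rewrite leNgt; apply/negP.
Qed.

Context (one : E) (y : E) (Q : R -> R) (j : nat -> nat).
Context (one1 : reps one (fun=> 1)) (mQ : measurable_fun setT Q) (yQ : reps y Q)
  (j_inj : injective j).
Context (F G z u : nat -> E) (A : nat -> set R) (c : R).
Context (GQ : forall k, reps (G k) (Q \o unif (j k))) (F0 : weakly_null F)
  (FE : forall k, F k = G k + z k + u k) (uc : forall k, `|u k| <= c * 2^-1 ^+ k)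
  (mA : forall k, measurable (A k)) (prA : forall k, pr (A k) <= 4^-1 * 2^-1 ^+ k)
  (zA : forall k, vanishes_on (~` A k) (z k)).

(** The law of large numbers applies to the bounded part of [Q], and the rest has
    small norm. *)
Let mean_of_averages (e : R) : 0 < e -> exists N b, (0 < N)%N /\
  forall i : nat -> nat, injective i -> `|N%:R^-1 *: \sum_(l < N) G (i l) - b *: one| <= 2 * e.
Proof.
move=> e0; have [T [mT [w wT we] bz]] := truncation mQ yQ e0.
have [N N0 hN] := average_norm_small E_ri E_separable E_fatou one1 bz e0.
exists N, (expect (restr Q (~` T))); split => // i i_inj.
have mQT : measurable_fun setT (restr Q T) by exact: measurable_restr.
have hv l : exists v : E, reps v (restr Q T \o unif (j (i l))) /\ `|v| <= e.
  have [||v vw vn] := reps_same_law E_ri (g := restr Q T \o unif (j (i l))) _ mQT wT.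
  - by apply: measurableT_comp => //; exact: measurable_unif.
  - move=> B mB; rewrite -[LHS]/(P (unif (j (i l)) @^-1` ((fun t => `|restr Q T t|) @^-1` B))).
    by apply: unif_uniform; apply: (@measurable_preimage _ (fun t => `|restr Q T t|)) => //; exact: measurableT_comp.
  by exists v; rewrite vn.
have [v hv'] := choice hv.
have -> : N%:R^-1 *: \sum_(l < N) G (i l) - expect (restr Q (~` T)) *: one =
    (N%:R^-1 *: \sum_(l < N) 1 *: (G (i l) - v l) - expect (restr Q (~` T)) *: one) +
    N%:R^-1 *: \sum_(l < N) v l.
  under [in RHS]eq_bigr do rewrite scale1r.
  by rewrite sumrB scalerBr addrAC subrK.
apply: le_trans (ler_normD _ _) _; rewrite mulr_natl mulr2n lerD//; last first.
  by apply: norm_average_le => // l; exact: (hv' l).2.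
apply: (hN (j \o i)); first by move=> a b /j_inj/i_inj.
have h1 : forall l, reps (G (i l) - v l) (fun t => Q (unif (j (i l)) t) - restr Q T (unif (j (i l)) t)).
  by move=> l; apply: repsB (GQ (i l)) (hv' l).1.
apply: reps_ae (repsB (repsZ N%:R^-1 (reps_sum N (fun=> 1) h1)) (repsZ (expect (restr Q (~` T))) one1)) _.
apply: ae_always => t; rewrite mulr1; congr (_ * _ - _); apply: eq_bigr => l _; rewrite mul1r /=.
have [Tt|Tt] := pselect (T (unif (j (i l)) t)).
  by rewrite restr_in// restr_out ?subrr// => /(_ Tt).
by rewrite [in LHS]restr_out// subr0 restr_in.
Qed.

(** Averages of the common part concentrate at a constant [b]. Convex
    combinations of averages of the whole sequence are small, and differ from
    [b] by a small vector and by a vector vanishing on a set of measure at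
    least one half; hence [b] itself is small. *)
Lemma common_part_weakly_null : weakly_null G.
Proof.
apply: convex_weakly_null => r0 r0i e e0.
(* The final estimate has the form [10 * d < e]. *)
pose d := e / 11; have d0 : 0 < d by rewrite divr_gt0.
have [N [b [N0 hN]]] := mean_of_averages d0.
have c0 : 0 <= c by have := le_trans (normr_ge0 _) (uc 0%N); rewrite expr0 mulr1.
have c1 : 0 < c + 1 by lra.
have [J hJ] := half_pow_small (divr_gt0 d0 c1).
have uJ k : (J <= k)%N -> `|u k| <= d.
  move=> Jk; apply: le_trans (uc k) _.
  have : (2^-1 : R) ^+ k <= 2^-1 ^+ J by apply: ler_wiXn2l => //; lra.
  have : 0 <= (2^-1 : R) ^+ k by rewrite exprn_ge0// invr_ge0.
  move: hJ; rewrite ltr_pdivlMr//; nra.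
have W0 := weakly_null_block_average J N0 F0.
have [n [a [a0 a1 ha]]] := weakly_null_convex W0 d0.
pose Z := \sum_(m < n) a m *: block_average N J z m.
have ZE : b *: one + Z = \sum_(m < n) a m *: block_average N J F m
    - \sum_(m < n) a m *: (block_average N J G m - b *: one)
    - \sum_(m < n) a m *: block_average N J u m.
  have b1 : \sum_(m < n) a m *: (b *: one) = b *: one by rewrite -scaler_suml a1 scale1r.
  rewrite -{1}b1.
  rewrite /Z -!sumrB -big_split/=; apply: eq_bigr => m _.
  rewrite -!scalerBr -scalerDr; congr (_ *: _).
  have -> : block_average N J F m = block_average N J G m + block_average N J z m + block_average N J u m.
    by rewrite /block_average -!scalerDr -!big_split/=; congr (_ *: _); apply: eq_bigr => l _; exact: FE.
  by rewrite opprB [RHS]addrAC addrK [RHS]addrC addrA subrK.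
have shift_inj m : injective (fun l => J + m * N + l)%N by exact: addnI.
have nZ : `|b *: one + Z| <= 4 * d.
  rewrite ZE; apply: le_trans (ler_normB _ _) _.
  have h1 : `|\sum_(m < n) a m *: block_average N J u m| <= d.
    apply: norm_convex_le => // m.
    apply: (@norm_average_le _ _ N (fun l => u (J + m * N + l)%N)) => // l; apply: uJ.
    by rewrite -addnA leq_addr.
  have h2 : `|\sum_(m < n) a m *: (block_average N J G m - b *: one)| <= 2 * d.
    apply: (@norm_convex_le _ _ (fun m => block_average N J G m - b *: one)) => // m.
    exact: (hN _ (shift_inj m)).
  have := ler_normB (\sum_(m < n) a m *: block_average N J F m) (\sum_(m < n) a m *: (block_average N J G m - b *: one)).
  lra.
pose D := ~` \bigcup_(k in [set k | (J <= k)%N]) A k.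
have mU : measurable (\bigcup_(k in [set k | (J <= k)%N]) A k) by apply: bigcup_measurable.
have mD : measurable D by exact: measurableC.
have D2 : 2^-1 <= pr D.
  rewrite prC//; have := pr_tail_union J mA prA.
  have : (2^-1 : R) ^+ J <= 1 by apply: exprn_ile1; rewrite ?invr_ge0//; lra.
  lra.
have ZD : vanishes_on D Z.
  apply: vanishes_on_sum => m; rewrite /block_average scaler_sumr.
  apply: (@vanishes_on_sum D (fun l => z (J + m * N + l)%N) (fun=> N%:R^-1)) => l.
  apply: ae_mono (zA (J + m * N + l)%N) => t ht Dt; apply: ht => At; apply: Dt.
  by exists (J + m * N + l)%N => //=; rewrite -addnA leq_addr.
have [oneD oneDr _] := reps_restr E_ri (@measurable_cst _ _ R R setT (1 : R)) mD one1.
have n1 := large_set_constant_norm mD D2 one1 oneDr.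
have n2 : `|b *: oneD| <= `|b *: one + Z|.
  apply: (norm_le_of_ae E_ri _ (repsZ b oneDr) (repsD (repsZ b one1) (reps_rep Z))).
    by apply: measurable_funM => //; exact: measurable_restr.
  apply: ae_mono ZD => t ht; have [Dt|Dt] := pselect (D t).
    by rewrite ht// addr0 restr_in.
  by rewrite restr_out// mulr0 normr0.
have n3 : `|b *: one| <= 8 * d.
  have e1 : `|b *: one| = `|b| * `|one| by rewrite normrZ.
  have e2 : `|b *: oneD| = `|b| * `|oneD| by rewrite normrZ.
  rewrite e1; apply: (@le_trans _ _ (`|b| * (2 * `|oneD|))); first exact: ler_wpM2l.
  by rewrite mulrCA -e2; lra.
exists N, (fun=> N%:R^-1), id; split => //.
- by rewrite sumr_const card_ord -[LHS]mulr_natr mulVf// gt_eqF// ltr0n.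
- have := hN r0 (increasing_seq_inj r0i) => h4.
  rewrite -scaler_sumr.
  have := ler_normD (N%:R^-1 *: \sum_(l < N) G (r0 l) - b *: one) (b *: one).
  rewrite subrK /= => h5; apply: le_lt_trans h5 _.
  have : 10 * d < e by rewrite /d; lra.
  lra.
Qed.

End CommonPart.

(** * The equality of the two index sets *)

Section IndependentSequences.
Context {R : realType} {E : banach_fun_space R}.
Context (E_ri : rearrangement_invariant E) (E_separable : separable E)
  (E_fatou : fatou_property E).
Notation P := (@leb01 R).

Lemma p_BS_trivial_space (p : R) (x : nat -> E) : (forall z : E, z = 0) -> p_BS_sequence p x.
Proof.
move=> E0; split; first by apply: (@bounded_fun_of_norm_le _ _ _ 0) => n; rewrite (E0 (x n)) normr0.
by move=> s _; exists 0 => _ [m _ <-]; rewrite (E0 (\sum_(k < m) _)) normr0 mulr0.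
Qed.

(** Each quantile function at a uniform variable has the law of the original term,
    and the laws of the terms of an independent sequence determine the norms of
    its linear combinations. *)
Lemma quantile_copy (F : nat -> E) : independent (fun n => rep (F n)) ->
  exists phi : nat -> E,
    (forall k, reps (phi k) (quantile (rep (F k)) \o unif k)) /\
    forall (s : nat -> nat) (a : nat -> R) n, increasing_seq s ->
      `|\sum_(k < n) a k *: phi (s k)| = `|\sum_(k < n) a k *: F (s k)|.
Proof.
move=> iF; pose f k : R -> R := rep (F k).
have mf k : measurable_fun setT (f k) by exact: measurable_rep.
pose X k := quantile (f k) \o unif k.
have mX k : measurable_fun setT (X k).
  by apply: measurableT_comp; [exact: measurable_quantile|exact: measurable_unif].
have Xf k : same_law (X k) (f k).
  move=> B mB; rewrite -[LHS]/(P (unif k @^-1` (quantile (f k) @^-1` B))).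
  rewrite unif_uniform; first exact: quantile_law.
  by apply: measurable_preimage => //; exact: measurable_quantile.
have hphi k : exists w : E, reps w (X k).
  have [|w wX _] := reps_same_law E_ri (mX k) (mf k) (reps_rep (F k)); last by exists w.
  exact: same_law_comp (@normr_measurable R setT) (Xf k).
have [phi phiX] := choice hphi.
exists phi; split => // s a n si; have s_inj := increasing_seq_inj si.
apply: (indep_norm_lin_comb E_ri (X := X \o s) (Y := f \o s) (x := phi \o s) (y := F \o s) a n).
- by move=> k; exact: mX.
- by move=> k; exact: mf.
- exact: indep_subsequence s_inj (indep_comp (fun k => measurable_quantile (mf k)) (@indep_unif R)).
- exact: indep_subsequence s_inj iF.
- by move=> k; exact: Xf.
- by move=> k; exact: phiX.
- by move=> k; exact: reps_rep.
Qed.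

(** Where the quantile function is far from [Q], which happens on sets of small
    measure, the difference goes into [z] after it has been made disjoint;
    elsewhere the difference is bounded by a small constant and goes into [u]. *)
Lemma quantile_splitting (one : E) (F phi : nat -> E) (M : R) : reps one (fun=> 1) ->
    (forall n, `|F n| <= M) -> (forall k, reps (phi k) (quantile (rep (F k)) \o unif k)) ->
  exists (Q : R -> R) (s : nat -> nat) (G z u : nat -> E) (A : nat -> set R) (c : R),
    [/\ increasing_seq s, measurable_fun setT Q, exists y : E, reps y Q,
        forall k, reps (G k) (Q \o unif (s k)) &
    [/\ forall k, phi (s k) = G k + z k + u k, forall k, `|u k| <= c * 2^-1 ^+ k,
        pairwise_disjoint (fun k => rep (z k)),
        forall k, measurable (A k) /\ pr (A k) <= 4^-1 * 2^-1 ^+ k &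
        forall k, vanishes_on (~` A k) (z k)]].
Proof.
move=> one1 FM phiX; pose f k : R -> R := rep (F k).
have mf k : measurable_fun setT (f k) by exact: measurable_rep.
have [Q [r [mQ [yQ yQr] ri rQ]]] := quantile_limit E_ri E_fatou one1 mf (fun n => reps_rep (F n)) FM.
pose q k u := quantile (f (r k)) u - Q u.
have mq k : measurable_fun setT (q k).
  by apply: measurable_funB => //; exact: measurable_quantile.
pose S k := [set u | 2^-1 ^+ k < `|q k u|].
have mS k : measurable (S k) by exact: measurable_abs_tail.
have mU k : measurable_fun setT (unif (R := R) (r k)) by exact: measurable_unif.
pose A k := unif (r k) @^-1` S k.
have mA k : measurable (A k) by exact: measurable_preimage.
have prA k : pr (A k) <= 2^-1 ^+ k.
  by rewrite /pr unif_uniform//; exact: rQ.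
have hg k : exists w : E, reps w (Q \o unif (r k)).
  have [||w wr _] := reps_same_law E_ri (g := Q \o unif (r k)) _ mQ yQr; last by exists w.
    exact: measurableT_comp.
  move=> B mB; rewrite -[LHS]/(P (unif (r k) @^-1` ((fun t => `|Q t|) @^-1` B))).
  by apply: unif_uniform; apply: (@measurable_preimage _ (fun t => `|Q t|)) => //; exact: measurableT_comp.
have [g gQ] := choice hg.
pose qU k : R -> R := q k \o unif (r k).
have mqU k : measurable_fun setT (qU k) by exact: measurableT_comp.
have qUr k : reps (phi (r k) - g k) (qU k) by exact: repsB (phiX (r k)) (gQ k).
pose h k := restr (qU k) (A k).
have mh k : measurable_fun setT (h k) by exact: measurable_restr.
have hnu k : exists w : E, reps w (h k).
  by have [w] := reps_restr E_ri (mqU k) (mA k) (qUr k); exists w.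
have [nu nuh] := choice hnu.
have rest k : `|phi (r k) - g k - nu k| <= `|one| * 2^-1 ^+ k.
  have p0 : 0 <= (2^-1 : R) ^+ k by rewrite exprn_ge0// invr_ge0.
  have -> : `|one| * 2^-1 ^+ k = `|(2^-1 ^+ k) *: one| by rewrite normrZ ger0_norm// mulrC.
  apply: (norm_le_of_ae E_ri _ (repsB (qUr k) (nuh k)) (repsZ (2^-1 ^+ k) one1)).
    exact: measurable_funB.
  apply: ae_always => t; rewrite mulr1 [leRHS]ger0_norm//.
  have [At|At] := pselect (A k t); first by rewrite /h restr_in// subrr normr0.
  by rewrite /h restr_out// subr0 leNgt; apply/negP.
have A0 (d : R) : 0 < d -> exists N, forall n, (N <= n)%N -> pr (A n) < d.
  move=> d0; have [N hN] := half_pow_small d0; exists N => n Nn.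
  apply: le_lt_trans hN; apply: le_trans (prA n) _.
  by apply: ler_wiXn2l => //; lra.
have hA k t : ~ A k t -> h k t = 0 by move=> At; rewrite /h restr_out.
have [s [z [si sA zh dz nz]]] := nearly_disjoint_subsequence E_ri E_separable E_fatou mh mA nuh hA A0 ltr01.
exists Q, (r \o s), (g \o s), z, (fun k => phi (r (s k)) - g (s k) - z k), (A \o s), (`|one| + 1).
split; [exact: increasing_seq_comp|exact: mQ|by exists yQ|by move=> k; exact: gQ|split].
- by move=> k /=; rewrite -[RHS]addrA (addrC (z k)) subrK [RHS]addrC subrK.
- move=> k; have -> : phi (r (s k)) - g (s k) - z k = (phi (r (s k)) - g (s k) - nu (s k)) + (nu (s k) - z k).
    by rewrite addrA subrK.
  apply: le_trans (ler_normD _ _) _; rewrite mulrDl; apply: lerD; last exact: nz.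
  apply: le_trans (rest (s k)) _; apply: ler_wpM2l => //.
  by apply: ler_wiXn2l; [lra|lra|exact: increasing_seq_geq].
- move=> i k ik; apply: ae_mono (ae_and (zh i) (zh k)) => t [-> ->]; exact: dz.
- by move=> k; split; [exact: mA|exact: sA].
- move=> k; apply: ae_mono (zh k) => t -> At; rewrite /restr hA ?mul0r//.
Qed.

Lemma independent_of_reps (X : nat -> R -> R) (x : nat -> E) : (forall k, measurable_fun setT (X k)) ->
  (forall k, reps (x k) (X k)) -> indep X -> independent (fun n => rep (x n)).
Proof.
move=> mX xX iX; apply: (@indep_ae _ X (fun n => rep (x n))) => //.
- by move=> n; exact: measurable_rep.
- by move=> n; apply: ae_mono (xX n) => t ->.
Qed.

Lemma identically_distributed_of_reps (X : nat -> R -> R) (x : nat -> E) :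
  (forall k, measurable_fun setT (X k)) -> (forall k, reps (x k) (X k)) ->
  (forall i k, same_law (X i) (X k)) -> identically_distributed (fun n => rep (x n)).
Proof.
move=> mX xX same i k B mB.
have E' n : P (rep (x n) @^-1` B) = P (X n @^-1` B).
  apply: leb01_ae_eq; [exact: measurable_preimage (measurable_rep (x n)) mB|exact: measurable_preimage (mX n) mB|].
  by apply: ae_mono (xX n) => t /= ->.
change (P (rep (x i) @^-1` B) = P (rep (x k) @^-1` B)).
by rewrite !E' (same i k).
Qed.

(** The summands [z] and [G] are treated one after the other, the second along the
    subsequence found for the first. *)
Lemma Gamma_iid_d_sub_Gamma_i (p : R) : Gamma_iid E p -> Gamma_d E p -> Gamma_i E p.
Proof.
move=> [p1 hiid] [_ hd]; split => // F F0 iF.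
(* The zero space contains no constants, and is treated apart. *)
have [[y y0]|E0] := pselect (exists y : E, y != 0); last first.
  exists id; split => //; apply: p_BS_trivial_space => w; apply/eqP/negPn/negP => w0.
  by apply: E0; exists w.
have [one one1] := nonzero_space_has_constants E_ri y0.
have [M FM] := weakly_null_bounded F0.
have [phi [phiX phiF]] := quantile_copy iF.
have phi0 : weakly_null phi.
  apply: convex_weakly_null => s si e e0.
  have [n [a [a0 a1 ha]]] := weakly_null_convex (weakly_null_subsequence si F0) e0.
  by exists n, a, id; split => //; rewrite phiF.
have [Q [s [G [z [u [A [c [si mQ [yQ yQr] GQ [phiE uc dz mA zA]]]]]]]]] :=
  quantile_splitting one1 FM phiX.
have s_inj := increasing_seq_inj si.
have phis0 := weakly_null_subsequence si phi0.
have G0 : weakly_null G.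
  exact: (common_part_weakly_null E_ri E_separable E_fatou one1 mQ yQr s_inj GQ phis0 phiE uc
    (fun k => (mA k).1) (fun k => (mA k).2) zA).
have z0 : weakly_null z.
  have := weakly_nullB (weakly_nullB phis0 G0) (weakly_null_geometric uc).
  have -> // : (fun n => (phi \o s) n - G n - u n) = z.
  by apply/funext => k /=; rewrite phiE addrAC addrK addrC addKr.
have [s2 [s2i zBS]] := hd z z0 dz.
have mQU (k : nat) : measurable_fun setT (Q \o unif k) by apply: measurableT_comp => //; exact: measurable_unif.
have GQs k : reps ((G \o s2) k) (Q \o unif (s (s2 k))) by exact: GQ.
have [s3 [s3i GBS]] : exists s3, increasing_seq s3 /\ p_BS_sequence p (G \o s2 \o s3).
  apply: hiid; first exact: weakly_null_subsequence s2i G0.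
  split.
    apply: independent_of_reps GQs _; first by [].
    have inj2 := increasing_seq_inj (increasing_seq_comp si s2i).
    exact: (indep_subsequence inj2 (indep_comp (fun=> mQ) (@indep_unif R))).
  apply: identically_distributed_of_reps GQs _; first by [].
  move=> i k B mB; have law m : P ((Q \o unif m) @^-1` B) = P (Q @^-1` B).
    by rewrite -[LHS]/(P (unif m @^-1` (Q @^-1` B))) unif_uniform//; exact: measurable_preimage.
  by rewrite !law.
have zBS' := p_BS_subsequence s3i zBS.
have r2i := increasing_seq_comp s2i s3i.
exists (s \o (s2 \o s3)); split; first exact: increasing_seq_comp.
have c0 : 0 <= c by have := le_trans (normr_ge0 _) (uc 0%N); rewrite expr0 mulr1.
apply: (@p_BS_dominated _ _ p p1 _ _ _ M 1 (2 * c) _ _ _ GBS zBS') => // [n||r m rinc]; [exact: FM|exact: mulr_ge0|].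
have r3i := increasing_seq_comp r2i rinc.
have := phiF (s \o (s2 \o s3) \o r) (fun=> 1) m (increasing_seq_comp si r3i).
under eq_bigr do rewrite scale1r; under [X in _ = `|X| -> _]eq_bigr do rewrite scale1r.
move=> <-; rewrite !mul1r.
under eq_bigr do rewrite /= phiE.
rewrite !big_split/=.
have := norm_sum_geometric m c0 r3i uc => h1.
apply: le_trans (ler_normD _ _) _; apply: lerD; last exact: h1.
exact: ler_normD.
Qed.

End IndependentSequences.

Theorem theorem18 (R : realType) (E : banach_fun_space R)
    (E_ri : rearrangement_invariant E)
    (E_separable : separable E)
    (E_fatou : fatou_property E) :
  Gamma_iid E = Gamma_i E <-> Gamma_iid E `<=` Gamma_d E.
Proof.
split=> [->|iid_d]; first exact: Gamma_i_sub_Gamma_d.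
apply/seteqP; split => p hp; first by apply: Gamma_iid_d_sub_Gamma_i => //; exact: iid_d.
have [p1 h] := hp; split => // x x0 [ix _]; exact: h.
Qed.
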